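(* There is an algorithm that, given any instance $(T,\mathcal D)$ of Dictionary Matching with $|T|=n$, decides whether the instance is positive using $O(n(1+\log\log n)/\log n)$ suffix array queries on $T$. In addition to the time spent answering these queries, the algorithm takes $O(n(1+\log\log n)/\log n)$ time. The queries can be divided into $O(1+\log\log n)$ rounds, each containing $O(n/\log n)$ queries, such that the queries in a round depend only on the answers from the preceding rounds.
   Context: Logarithms are binary; $[a..b]=\{k\in\mathbb Z:a\le k\le b\}$; strings are indexed from $1$. Dictionary Matching problem: let $n\ge2$ and $k,m\ge1$ be integers with $k=\Theta(n/\log n)$ and $m=\Theta(\log n)$. The input consists of the packed representation of a text $T\in\{0,1\}^n$ and the packed representations of a collection $\mathcal D=\{P_1,\dots,P_k\}\subseteq\{0,1\}^m$ of patterns. The instance is positive (answer YES) if some $P_i$ occurs in $T$ as a substring, and negative (NO) otherwise. The model is the word RAM with word size $w=c\log n$, $c\ge2$ constant (standard arithmetic and bitwise word operations take $O(1)$ time). A suffix array query on $T$: given $i\in[1..n]$, return $\mathrm{SA}_T[i]$, the starting position of the lexicographically $i$th smallest suffix of $T$ (a proper prefix of a string is smaller than the string). The algorithm has oracle access to these queries. The packed representation of a binary string with word size $w$ stores $w$ consecutive bits per word (earlier bits in lower-order positions), with unused bits of the last word set to $0$. *)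

(* Defs.v *)
From Stdlib Require Import Reals List Arith Bool.
Import ListNotations.

(** * Binary strings

    Strings are lists of booleans ([true] is the bit 1); positions are counted
    from 1, so that [nth (p - 1)] is the bit at position [p]. *)

Fixpoint lex_ltb (u v : list bool) : bool :=
  match u, v with
  | _, [] => false
  | [], _ :: _ => true
  | a :: u', b :: v' =>
      if Bool.eqb a b then lex_ltb u' v' else negb a
  end.

Definition suffix (T : list bool) (p : nat) : list bool := skipn (p - 1) T.

Definition suffix_rank (T : list bool) (p : nat) : nat :=
  S (length (filter (fun q => lex_ltb (suffix T q) (suffix T p))
                    (seq 1 (length T)))).

(** [SA T i] is a position in [1..length T] when [i] is in that range (distinct
    suffixes have distinct ranks); it is 0 for every other [i]. *)
Definition SA (T : list bool) (i : nat) : nat :=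
  match find (fun p => suffix_rank T p =? i) (seq 1 (length T)) with
  | Some p => p
  | None => 0
  end.

Definition occurs (P T : list bool) : Prop :=
  exists U V : list bool, T = U ++ P ++ V.

Definition positive_instance (T : list bool) (D : list (list bool)) : Prop :=
  exists P, In P D /\ occurs P T.

(** Earlier bits are less significant. *)
Fixpoint word_of_bits (s : list bool) : nat :=
  match s with
  | [] => 0
  | b :: s' => Nat.b2n b + 2 * word_of_bits s'
  end.

Definition pack (w : nat) (s : list bool) : list nat :=
  map (fun j => word_of_bits (firstn w (skipn (j * w) s)))
      (seq 0 ((length s + w - 1) / w)).

(** * The word RAM with an oracle

    A program is a finite list of instructions over registers [R0, R1, ...]
    (finitely many of which occur in a given program) and a memory of words.
    Every value computed is reduced modulo [2^w].  Register names, jump targets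
    and the constant address of [ReadAt] are part of the program text, so they
    are not restricted to [w] bits, unlike the addresses held in registers. *)

Inductive binop : Set :=
| Add | Sub | Mul | Div | Mod | And | Or | Xor | Shl | Shr.

Inductive instr : Set :=
| Const (r v : nat)             (* Rr := v mod 2^w *)
| Move (r s : nat)              (* Rr := Rs *)
| Op (o : binop) (r s t : nat)  (* Rr := Rs o Rt *)
| Read (r s : nat)              (* Rr := mem[Rs] *)
| ReadAt (r a : nat)            (* Rr := mem[a] *)
| Write (r s : nat)             (* mem[Rr] := Rs *)
| Jump (l : nat)
| JumpLt (r s l : nat)          (* if Rr < Rs then goto l *)
| JumpEq (r s l : nat)          (* if Rr = Rs then goto l *)
| Query (r s : nat)             (* Rr := answer of the oracle to Rs *)
| Halt (answer : bool).

Definition program : Set := list instr.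

(** [asked] is the list of the oracle queries made so far, oldest first; no
    instruction can read it. *)
Record config : Set := Config {
  pc : nat;
  reg : nat -> nat;
  mem : nat -> nat;
  asked : list nat
}.

(** Subtraction wraps around; [x / 0 = 0] and [x mod 0 = x]. *)
Definition eval_op (w : nat) (o : binop) (x y : nat) : nat :=
  match o with
  | Add => x + y
  | Sub => x + 2 ^ w - y
  | Mul => x * y
  | Div => x / y
  | Mod => x mod y
  | And => Nat.land x y
  | Or => Nat.lor x y
  | Xor => Nat.lxor x y
  | Shl => Nat.shiftl x y
  | Shr => Nat.shiftr x y
  end mod 2 ^ w.

Definition upd (f : nat -> nat) (a v : nat) : nat -> nat :=
  fun x => if x =? a then v else f x.

Definition set_reg (c : config) (r v : nat) : config :=
  Config (S (pc c)) (upd (reg c) r v) (mem c) (asked c).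

Definition goto (c : config) (l : nat) : config :=
  Config l (reg c) (mem c) (asked c).

(** A configuration at a [Halt] instruction, or outside of the program, does
    not change any more. *)
Definition step (P : program) (w : nat) (oracle : nat -> nat) (c : config)
  : config :=
  match nth_error P (pc c) with
  | None | Some (Halt _) => c
  | Some (Const r v) => set_reg c r (v mod 2 ^ w)
  | Some (Move r s) => set_reg c r (reg c s)
  | Some (Op o r s t) => set_reg c r (eval_op w o (reg c s) (reg c t))
  | Some (Read r s) => set_reg c r (mem c (reg c s))
  | Some (ReadAt r a) => set_reg c r (mem c a)
  | Some (Write r s) =>
      Config (S (pc c)) (reg c) (upd (mem c) (reg c r) (reg c s)) (asked c)
  | Some (Jump l) => goto c l
  | Some (JumpLt r s l) => goto c (if reg c r <? reg c s then l else S (pc c))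
  | Some (JumpEq r s l) => goto c (if reg c r =? reg c s then l else S (pc c))
  | Some (Query r s) =>
      Config (S (pc c)) (upd (reg c) r (oracle (reg c s) mod 2 ^ w)) (mem c)
             (asked c ++ [reg c s])
  end.

Definition run (P : program) (w : nat) (oracle : nat -> nat) (t : nat)
  (c : config) : config :=
  Nat.iter t (step P w oracle) c.

Definition output (P : program) (c : config) : option bool :=
  match nth_error P (pc c) with
  | Some (Halt b) => Some b
  | _ => None
  end.

(** * Input format *)

Definition digit (w x j : nat) : nat := (x / 2 ^ (w * j)) mod 2 ^ w.

(** [R0 = n], [R1 = w], and the base-[2^w] digits of [k] and [m], least
    significant first, are in [R2, R4, R6, ...] and in [R3, R5, R7, ...].  As
    soon as [k, m < 2^w], this says that [R2 = k], [R3 = m], and that all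
    further registers are 0; the other digits matter only for the finitely many
    [n] where the constants hidden in [k = Theta(n / log n)] and
    [m = Theta(log n)] allow sizes that do not fit in one word. *)
Definition init_reg (n k m w : nat) (r : nat) : nat :=
  match r with
  | 0 => n
  | 1 => w
  | S (S i) => digit w (if Nat.even i then k else m) (Nat.div2 i)
  end.

(** The packed text is followed by the patterns, each of which starts in a new
    word; the rest of the memory is 0. *)
Definition init_mem (w : nat) (T : list bool) (D : list (list bool)) (a : nat)
  : nat :=
  nth a (pack w T ++ concat (map (pack w) D)) 0.

Definition init (w m : nat) (T : list bool) (D : list (list bool)) : config :=
  Config 0 (init_reg (length T) (length D) m w) (init_mem w T D) [].

(** * Rounds

    [rounds] splits the queries made with the oracle [f].  The queries of a
    round depend only on the answers from the preceding rounds: for every oracle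
    [g] with answers in [1..n] that agrees with [f] on the preceding rounds, the
    machine started in the same configuration but with the oracle [g] makes the
    same queries up to and including this round, whatever [g] answers to the
    queries of the round itself. *)
Definition depend_on_preceding_rounds (P : program) (w n : nat)
  (f : nat -> nat) (c0 : config) (rounds : list (list nat)) : Prop :=
  forall (r : nat) (g : nat -> nat),
    r < length rounds ->
    (forall i, 1 <= i <= n -> 1 <= g i <= n) ->
    (forall q, In q (concat (firstn r rounds)) -> g q = f q) ->
    exists t : nat,
      asked (run P w g t c0) = concat (firstn (S r) rounds).

(** * Logarithms *)

Definition log (x : R) : R := (ln x / ln 2)%R.

(* Main.v *)
(** The suffixes at every [w]-th position of the suffix array are a sorted sample
    of [O(n / log n)] strings.  Merging it with the patterns, which an LSD radix
    sort on [O(1)] digits brings into lexicographic order, encloses the rank of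
    the first suffix that is not smaller than a pattern in an interval of length
    [w]; a binary search, made simultaneously for all patterns with one query per
    pattern in each round, finds this rank in [O(1 + log log n)] further rounds,
    and the pattern occurs iff it is a prefix of the suffix of this rank.

    The algorithm is written in a small structured language that computes with
    exact natural numbers, provided that they fit into a word; its compiled code
    takes at most [code length * (loop iterations + 1)] steps.  The finitely many
    inputs that are too short for the asymptotic estimates are decided, without
    any query, by a decision tree over their registers and memory cells. *)
From Stdlib Require Import Reals List Arith Bool Lia Lra Permutation Sorting.Sorted.
From Stdlib Require Import Classical.
Require Import Defs.
Import ListNotations.

(** * A structured language over the machine *)

(** The definition of rounds runs the machine with oracles that answer anything in [[1..n]], even
    what no suffix array answers. So every phase is specified for an arbitrary oracle in that range:
    it must stay free of overflow, end, and ask the same queries. That the suffixes are listed in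
    order enters only when the final answer is proved correct. Packed words keep earlier bits in
    lower positions, so their numeric order is not lexicographic. A table of bit reversals for
    digits of [h = w / H] bits repairs this; as [m = O(w)], a pattern has [O(1)] such digits, which
    serve both the radix sort and every comparison. Since [w <= (c + 1) log n], the choice
    [H > 2c + 2] gives [2 ^ h <= sqrt n], so filling the table and scanning the buckets is cheap.
    Fresh buckets in every pass avoid clearing; they take [E * B * (k + 1)] cells, which can be
    addressed because [c >= 2] gives [2 ^ w >= n ^ 2]. Padding a short suffix with zeros can make it
    look like a pattern, so comparisons break ties by length. *)

Inductive expr : Set :=
| Var (r : nat)
| Cst (v : nat)
| Fetch (e : expr)
| FetchAt (a : nat)
| Bin (o : binop) (e1 e2 : expr).

Inductive cmd : Set :=
| Skip
| Asg (r : nat) (e : expr)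
| Sto (e1 e2 : expr)
| Ask (r : nat) (e : expr)
| Seq (c1 c2 : cmd)
| Ite (e1 e2 : expr) (c1 c2 : cmd)
| While (e1 e2 : expr) (c : cmd).

(* [tk] is a ghost counter of loop iterations. *)
Record state : Set := St {
  rg : nat -> nat;
  mm : nat -> nat;
  qs : list nat;
  tk : nat
}.

Definition set_rg (s : state) (r v : nat) : state :=
  St (upd (rg s) r v) (mm s) (qs s) (tk s).

Definition set_mm (s : state) (a v : nat) : state :=
  St (rg s) (upd (mm s) a v) (qs s) (tk s).

Definition ask_st (s : state) (r q v : nat) : state :=
  St (upd (rg s) r v) (mm s) (qs s ++ [q]) (tk s).

Definition tick (s : state) : state := St (rg s) (mm s) (qs s) (S (tk s)).

Definition exact_op (o : binop) (x y : nat) : nat :=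
  match o with
  | Add => x + y
  | Sub => x - y
  | Mul => x * y
  | Div => x / y
  | Mod => x mod y
  | And => Nat.land x y
  | Or => Nat.lor x y
  | Xor => Nat.lxor x y
  | Shl => Nat.shiftl x y
  | Shr => Nat.shiftr x y
  end.

(** Natural subtraction truncates at 0 while the machine wraps around; the case [Sub] selects a
    range in which both agree. *)
Definition fits (w : nat) (o : binop) (x y : nat) : Prop :=
  match o with
  | Sub => y <= x < 2 ^ w
  | _ => exact_op o x y < 2 ^ w
  end.

Fixpoint val (e : expr) (s : state) : nat :=
  match e with
  | Var r => rg s r
  | Cst v => v
  | Fetch e => mm s (val e s)
  | FetchAt a => mm s a
  | Bin o e1 e2 => exact_op o (val e1 s) (val e2 s)
  end.

Fixpoint safe (w : nat) (e : expr) (s : state) : Prop :=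
  match e with
  | Var _ | FetchAt _ => True
  | Cst v => v < 2 ^ w
  | Fetch e => safe w e s
  | Bin o e1 e2 =>
      safe w e1 s /\ safe w e2 s /\ fits w o (val e1 s) (val e2 s)
  end.

Lemma eval_op_exact w o x y : fits w o x y -> eval_op w o x y = exact_op o x y.
Proof.
  unfold eval_op, fits. destruct o; intros H; try (apply Nat.mod_small; exact H).
  cbn [exact_op].
  replace (x + 2 ^ w - y) with (x - y + 1 * 2 ^ w) by lia.
  rewrite Nat.Div0.mod_add. apply Nat.mod_small; lia.
Qed.

Section Exec.
Variables (w : nat) (g : nat -> nat).

(** No rule applies to an unsafe expression, and a loop is unfolded finitely often, so a derivation
    certifies termination and the absence of overflow together. *)
Inductive exec : cmd -> state -> state -> Prop :=
| exec_skip s : exec Skip s s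
| exec_asg r e s : safe w e s -> exec (Asg r e) s (set_rg s r (val e s))
| exec_sto e1 e2 s : safe w e1 s -> safe w e2 s ->
    exec (Sto e1 e2) s (set_mm s (val e1 s) (val e2 s))
| exec_ask r e s : safe w e s ->
    exec (Ask r e) s (ask_st s r (val e s) (g (val e s) mod 2 ^ w))
| exec_seq c1 c2 s s1 s2 : exec c1 s s1 -> exec c2 s1 s2 ->
    exec (Seq c1 c2) s s2
| exec_ite_t e1 e2 c1 c2 s s' : safe w e1 s -> safe w e2 s ->
    val e1 s < val e2 s -> exec c1 s s' -> exec (Ite e1 e2 c1 c2) s s'
| exec_ite_f e1 e2 c1 c2 s s' : safe w e1 s -> safe w e2 s ->
    val e2 s <= val e1 s -> exec c2 s s' -> exec (Ite e1 e2 c1 c2) s s'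
| exec_while_f e1 e2 c s : safe w e1 s -> safe w e2 s ->
    val e2 s <= val e1 s -> exec (While e1 e2 c) s s
| exec_while_t e1 e2 c s s1 s2 : safe w e1 s -> safe w e2 s ->
    val e1 s < val e2 s -> exec c (tick s) s1 ->
    exec (While e1 e2 c) s1 s2 -> exec (While e1 e2 c) s s2.

(* [asks c s l]: the run of [c] from [s] passes through a point at which the
   list of all queries made is [l]. *)
Inductive asks : cmd -> state -> list nat -> Prop :=
| asks_exec c s s' : exec c s s' -> asks c s (qs s')
| asks_seq1 c1 c2 s l : asks c1 s l -> asks (Seq c1 c2) s l
| asks_seq2 c1 c2 s s1 l : exec c1 s s1 -> asks c2 s1 l -> asks (Seq c1 c2) s l
| asks_ite_f e1 e2 c1 c2 s l : safe w e1 s -> safe w e2 s ->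
    val e2 s <= val e1 s -> asks c2 s l -> asks (Ite e1 e2 c1 c2) s l
| asks_while1 e1 e2 c s l : safe w e1 s -> safe w e2 s ->
    val e1 s < val e2 s -> asks c (tick s) l -> asks (While e1 e2 c) s l
| asks_while2 e1 e2 c s s1 l : safe w e1 s -> safe w e2 s ->
    val e1 s < val e2 s -> exec c (tick s) s1 ->
    asks (While e1 e2 c) s1 l -> asks (While e1 e2 c) s l.

End Exec.

Lemma exec_tk w g c s s' : exec w g c s s' -> tk s <= tk s'.
Proof. induction 1; cbn in *; lia. Qed.

Lemma exec_qs w g c s s' :
  exec w g c s s' -> exists l, qs s' = qs s ++ l.
Proof.
  induction 1; cbn in *; try (exists []; rewrite app_nil_r; reflexivity);
    try assumption.
  - eexists; reflexivity.
  - destruct IHexec1 as [l1 E1], IHexec2 as [l2 E2].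
    exists (l1 ++ l2). rewrite E2, E1, app_assoc. reflexivity.
  - destruct IHexec1 as [l1 E1], IHexec2 as [l2 E2].
    exists (l1 ++ l2). rewrite E2, E1, app_assoc. reflexivity.
Qed.

(** A run sees the oracle only through the answers to its own queries, so it can be replayed with
    any oracle that gives the same ones. *)
Lemma exec_agree w f g c s s' l :
  exec w f c s s' -> qs s' = qs s ++ l -> (forall q, In q l -> g q = f q) ->
  exec w g c s s'.
Proof.
  intros H; revert l.
  (* Query lists only grow: cancelling the common prefix shows that a composed run asks the queries
     of its parts, concatenated. *)
  assert (split : forall (s s1 s2 : state) l l1 l2,
    qs s1 = qs s ++ l1 -> qs s2 = qs s1 ++ l2 -> qs s2 = qs s ++ l ->
    l = l1 ++ l2).
  { intros x x1 x2 l l1 l2 E1 E2 E. rewrite E2, E1, <- app_assoc in E.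
    apply app_inv_head in E. auto. }
  induction H; intros l E A; try (econstructor; eassumption).
  - cbn in E. apply app_inv_head in E. subst l.
    rewrite <- (A (val e s)) by (left; reflexivity). constructor; assumption.
  - destruct (exec_qs _ _ _ _ _ H) as [l1 E1].
    destruct (exec_qs _ _ _ _ _ H0) as [l2 E2].
    pose proof (split _ _ _ _ _ _ E1 E2 E); subst l.
    econstructor; [eapply IHexec1 | eapply IHexec2]; try eassumption;

      intros; apply A, in_or_app; auto.
  - apply exec_ite_t; eauto.
  - apply exec_ite_f; eauto.
  - destruct (exec_qs _ _ _ _ _ H2) as [l1 E1].
    destruct (exec_qs _ _ _ _ _ H3) as [l2 E2].
    pose proof (split s s1 _ _ _ _ E1 E2 E); subst l.
    eapply exec_while_t; eauto;
      [eapply IHexec1 | eapply IHexec2]; try eassumption;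
      intros; apply A, in_or_app; auto.
Qed.

Fixpoint writes (c : cmd) : list nat :=
  match c with
  | Skip | Sto _ _ => []
  | Asg r _ | Ask r _ => [r]
  | Seq c1 c2 | Ite _ _ c1 c2 => writes c1 ++ writes c2
  | While _ _ c => writes c
  end.

Lemma exec_frame w g c s s' r :
  exec w g c s s' -> ~ In r (writes c) -> rg s' r = rg s r.
Proof.
  induction 1; cbn; intros N; try reflexivity;
    try (unfold upd; destruct (Nat.eqb_spec r r0); [lia | reflexivity]).
  - rewrite in_app_iff in N. rewrite IHexec2, IHexec1; tauto.
  - rewrite in_app_iff in N. tauto.
  - rewrite in_app_iff in N. tauto.
  - cbn in *. rewrite IHexec2, IHexec1; tauto.
Qed.

(** * Compilation *)

Fixpoint vars_below (K : nat) (e : expr) : bool :=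
  match e with
  | Var r => r <? K
  | Cst _ | FetchAt _ => true
  | Fetch e => vars_below K e
  | Bin _ e1 e2 => vars_below K e1 && vars_below K e2
  end.

Fixpoint cmd_below (K : nat) (c : cmd) : bool :=
  match c with
  | Skip => true
  | Asg r e | Ask r e => (r <? K) && vars_below K e
  | Sto e1 e2 => vars_below K e1 && vars_below K e2
  | Seq c1 c2 => cmd_below K c1 && cmd_below K c2
  | Ite e1 e2 c1 c2 =>
      vars_below K e1 && vars_below K e2 && cmd_below K c1 && cmd_below K c2
  | While e1 e2 c => vars_below K e1 && vars_below K e2 && cmd_below K c
  end.

Lemma vars_below_mono K K' e :
  K <= K' -> vars_below K e = true -> vars_below K' e = true.
Proof.
  intros HK. induction e; cbn [vars_below]; auto.
  - rewrite !Nat.ltb_lt. lia.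
  - rewrite !andb_true_iff. tauto.
Qed.

Lemma cmd_below_mono K K' c :
  K <= K' -> cmd_below K c = true -> cmd_below K' c = true.
Proof.
  intros HK. pose proof (fun e => vars_below_mono K K' e HK) as HV.
  assert (HL : forall r, (r <? K) = true -> (r <? K') = true).
  { intros r. rewrite !Nat.ltb_lt. lia. }
  induction c; cbn [cmd_below]; rewrite ?andb_true_iff; intuition.
Qed.

(** Registers from [t] upwards act as an evaluation stack: the value ends in [t], and a second
    operand is evaluated one register higher. *)
Fixpoint cexp (e : expr) (t : nat) : list instr :=
  match e with
  | Var r => [Move t r]
  | Cst v => [Const t v]
  | Fetch e => cexp e t ++ [Read t t]
  | FetchAt a => [ReadAt t a]
  | Bin o e1 e2 => cexp e1 t ++ cexp e2 (S t) ++ [Op o t t (S t)]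
  end.

Section Compile.
Variable K : nat.

(** Jump targets are absolute, hence the start address [a]. The conditional jump is taken when the
    test holds, so the else branch comes first in the code. Registers from [K] on are scratch. *)
Fixpoint ccmd (a : nat) (c : cmd) : list instr :=
  match c with
  | Skip => []
  | Asg r e => cexp e K ++ [Move r K]
  | Sto e1 e2 => cexp e1 K ++ cexp e2 (S K) ++ [Write K (S K)]
  | Ask r e => cexp e K ++ [Query r K]
  | Seq c1 c2 =>
      let p1 := ccmd a c1 in p1 ++ ccmd (a + length p1) c2
  | Ite e1 e2 c1 c2 =>
      let p0 := cexp e1 K ++ cexp e2 (S K) in
      let p2 := ccmd (a + length p0 + 1) c2 in
      let l1 := a + length p0 + 1 + length p2 + 1 in
      let p1 := ccmd l1 c1 in
      p0 ++ [JumpLt K (S K) l1] ++ p2 ++ [Jump (l1 + length p1)] ++ p1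
  | While e1 e2 c =>
      let p0 := cexp e1 K ++ cexp e2 (S K) in
      let l1 := a + length p0 + 2 in
      let p1 := ccmd l1 c in
      p0 ++ [JumpLt K (S K) l1; Jump (l1 + length p1 + 1)] ++ p1 ++ [Jump a]
  end.

Definition code_at (P : program) (a : nat) (code : list instr) : Prop :=
  exists pre post, P = pre ++ code ++ post /\ length pre = a.

Lemma code_at_app P a x y :
  code_at P a (x ++ y) -> code_at P a x /\ code_at P (a + length x) y.
Proof.
  intros (pre & post & -> & <-). split.
  - exists pre, (y ++ post). rewrite <- app_assoc. auto.
  - exists (pre ++ x), post. rewrite length_app, <- !app_assoc. auto.
Qed.

Lemma code_at_nth P a i x : code_at P a (i :: x) -> nth_error P a = Some i.
Proof.
  intros (pre & post & -> & <-). rewrite nth_error_app2, Nat.sub_diag by lia.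
  reflexivity.
Qed.

Variables (P : program) (w : nat) (g : nat -> nat).

Definition sim (cf : config) (s : state) : Prop :=
  (forall r, r < K -> reg cf r = rg s r) /\ mem cf = mm s /\ asked cf = qs s.

Lemma run_add t1 t2 cf : run P w g (t1 + t2) cf = run P w g t2 (run P w g t1 cf).
Proof. unfold run. rewrite Nat.add_comm. apply Nat.iter_add. Qed.

Lemma run_one cf : run P w g 1 cf = step P w g cf.
Proof. reflexivity. Qed.

Lemma run_jlt cf r1 r2 l : nth_error P (pc cf) = Some (JumpLt r1 r2 l) ->
  run P w g 1 cf = goto cf (if reg cf r1 <? reg cf r2 then l else S (pc cf)).
Proof. intros E. rewrite run_one. unfold step. rewrite E. reflexivity. Qed.

Lemma run_jump cf l : nth_error P (pc cf) = Some (Jump l) ->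
  run P w g 1 cf = goto cf l.
Proof. intros E. rewrite run_one. unfold step. rewrite E. reflexivity. Qed.

(** The last conjunct keeps the stack below [t] intact; thanks to it the first operand survives the
    evaluation of the second. *)
Lemma cexp_correct e t s : forall cf,
  K <= t -> vars_below K e = true -> safe w e s ->
  code_at P (pc cf) (cexp e t) -> sim cf s ->
  let cf' := run P w g (length (cexp e t)) cf in
  pc cf' = pc cf + length (cexp e t) /\ sim cf' s /\
  reg cf' t = val e s /\ (forall r, r < t -> reg cf' r = reg cf r).
Proof.
  revert t. induction e; intros t cf Ht Hv Hs Hc Hsim; cbn in Hv, Hs, Hc.
  - apply code_at_nth in Hc. cbn. unfold step. rewrite Hc. cbn.
    destruct Hsim as (S1 & S2 & S3). apply Nat.ltb_lt in Hv.
    split; [lia|]. split; [|split].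
    + split; [|split]; cbn; auto. intros r' Hr'. unfold upd.
      destruct (Nat.eqb_spec r' t); [lia|auto].
    + unfold upd. rewrite Nat.eqb_refl. auto.
    + intros r' Hr'. unfold upd. destruct (Nat.eqb_spec r' t); [lia|auto].
  - apply code_at_nth in Hc. cbn -[Nat.modulo Nat.pow]. unfold step. rewrite Hc.
    cbn -[Nat.modulo Nat.pow].
    destruct Hsim as (S1 & S2 & S3).
    split; [lia|]. split; [|split].
    + split; [|split]; cbn -[Nat.modulo Nat.pow]; auto. intros r' Hr'. unfold upd.
      destruct (Nat.eqb_spec r' t); [lia|auto].
    + unfold upd. rewrite Nat.eqb_refl. apply Nat.mod_small, Hs.
    + intros r' Hr'. unfold upd. destruct (Nat.eqb_spec r' t); [lia|auto].
  - apply code_at_app in Hc. destruct Hc as [Hc1 Hc2].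
    specialize (IHe t cf Ht Hv Hs Hc1 Hsim). cbn zeta in IHe |- *.
    cbn [cexp]. rewrite length_app, run_add. cbn [length].
    set (cf1 := run P w g (length (cexp e t)) cf) in *.
    destruct IHe as (A1 & A2 & A3 & A4).
    rewrite <- A1 in Hc2. apply code_at_nth in Hc2.
    rewrite run_one. unfold step. rewrite Hc2. cbn.
    destruct A2 as (S1 & S2 & S3).
    split; [lia|]. split; [|split].
    + split; [|split]; cbn; auto. intros r' Hr'. unfold upd.
      destruct (Nat.eqb_spec r' t); [lia|auto].
    + unfold upd. rewrite Nat.eqb_refl. congruence.
    + intros r' Hr'. unfold upd. destruct (Nat.eqb_spec r' t); [lia|auto].
  - apply code_at_nth in Hc. cbn. unfold step. rewrite Hc. cbn.
    destruct Hsim as (S1 & S2 & S3).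
    split; [lia|]. split; [|split].
    + split; [|split]; cbn; auto. intros r' Hr'. unfold upd.
      destruct (Nat.eqb_spec r' t); [lia|auto].
    + unfold upd. rewrite Nat.eqb_refl. congruence.
    + intros r' Hr'. unfold upd. destruct (Nat.eqb_spec r' t); [lia|auto].
  - apply andb_prop in Hv. destruct Hv as [Hv1 Hv2].
    destruct Hs as (Hs1 & Hs2 & Hs3).
    apply code_at_app in Hc. destruct Hc as [Hc1 Hc2].
    apply code_at_app in Hc2. destruct Hc2 as [Hc2 Hc3].
    specialize (IHe1 t cf Ht Hv1 Hs1 Hc1 Hsim). cbn zeta in IHe1 |- *.
    cbn [cexp]. rewrite !length_app, !run_add. cbn [length].
    set (cf1 := run P w g (length (cexp e1 t)) cf) in *.
    destruct IHe1 as (A1 & A2 & A3 & A4).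
    rewrite <- A1 in Hc2, Hc3.
    specialize (IHe2 (S t) cf1 ltac:(lia) Hv2 Hs2 Hc2 A2). cbn zeta in IHe2.
    set (cf2 := run P w g (length (cexp e2 (S t))) cf1) in *.
    destruct IHe2 as (B1 & B2 & B3 & B4).
    rewrite <- B1 in Hc3. apply code_at_nth in Hc3.
    rewrite run_one. unfold step. rewrite Hc3. cbn -[eval_op].
    destruct B2 as (S1 & S2 & S3).
    split; [lia|]. split; [|split].
    + split; [|split]; cbn -[eval_op]; auto. intros r' Hr'. unfold upd.
      destruct (Nat.eqb_spec r' t); [lia|auto].
    + unfold upd. rewrite Nat.eqb_refl, B3, (B4 t), A3 by lia.
      apply eval_op_exact, Hs3.
    + intros r' Hr'. unfold upd. destruct (Nat.eqb_spec r' t); [lia|].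
      rewrite B4, A4; auto.
Qed.

Lemma cexp2_correct e1 e2 s cf :
  vars_below K e1 = true -> vars_below K e2 = true ->
  safe w e1 s -> safe w e2 s ->
  code_at P (pc cf) (cexp e1 K ++ cexp e2 (S K)) -> sim cf s ->
  let len := length (cexp e1 K ++ cexp e2 (S K)) in
  let cf' := run P w g len cf in
  pc cf' = pc cf + len /\ sim cf' s /\
  reg cf' K = val e1 s /\ reg cf' (S K) = val e2 s.
Proof.
  intros V1 V2 S1 S2 Hc Hs. apply code_at_app in Hc. destruct Hc as [Hc1 Hc2].
  cbn zeta. rewrite length_app, run_add.
  destruct (cexp_correct e1 K s cf (Nat.le_refl K) V1 S1 Hc1 Hs)
    as (A1 & A2 & A3 & A4).
  set (cf1 := run P w g (length (cexp e1 K)) cf) in *.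
  rewrite <- A1 in Hc2.
  destruct (cexp_correct e2 (S K) s cf1 ltac:(lia) V2 S2 Hc2 A2)
    as (B1 & B2 & B3 & B4).
  repeat split; try lia; try apply B2; auto.
  rewrite B4; auto.
Qed.

(** The time bound is [t <= length * (ticks + 1)], written without subtraction. It holds because no
    instruction is executed twice between consecutive ticks. *)
Lemma ccmd_correct c s s' : exec w g c s s' -> forall a cf,
  cmd_below K c = true -> code_at P a (ccmd a c) -> pc cf = a -> sim cf s ->
  exists t, let cf' := run P w g t cf in
    pc cf' = a + length (ccmd a c) /\ sim cf' s' /\
    t + length (ccmd a c) * tk s <= length (ccmd a c) * (tk s' + 1).
Proof.
  induction 1; intros a cf Hb Hc Hpc Hsim; cbn [cmd_below] in Hb.
  - exists 0. cbn. subst a. split; [lia|]. split; [exact Hsim|]. lia.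
  - cbn [ccmd] in Hc |- *. apply andb_prop in Hb. destruct Hb as [Hb1 Hb2].
    apply Nat.ltb_lt in Hb1.
    apply code_at_app in Hc. destruct Hc as [Hc1 Hc2]. subst a.
    destruct (cexp_correct e K s cf (Nat.le_refl K) Hb2 H Hc1 Hsim)
      as (A1 & A2 & A3 & A4).
    exists (length (cexp e K) + 1). rewrite run_add, run_one, length_app.
    set (cf1 := run P w g (length (cexp e K)) cf) in *.
    rewrite <- A1 in Hc2. apply code_at_nth in Hc2.
    unfold step. rewrite Hc2. cbn.
    split; [lia|]. split; [|lia].
    destruct A2 as (S1 & S2 & S3). split; [|split]; cbn; auto.
    intros r' Hr'. unfold upd. destruct (Nat.eqb_spec r' r); auto.
  - cbn [ccmd] in Hc |- *. apply andb_prop in Hb. destruct Hb as [Hb1 Hb2].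
    rewrite app_assoc in Hc |- *.
    apply code_at_app in Hc. destruct Hc as [Hc1 Hc2]. subst a.
    destruct (cexp2_correct e1 e2 s cf Hb1 Hb2 H H0 Hc1 Hsim)
      as (A1 & A2 & A3 & A4).
    exists (length (cexp e1 K ++ cexp e2 (S K)) + 1).
    rewrite run_add, run_one, (length_app _ [_]).
    set (cf1 := run P w g (length (cexp e1 K ++ cexp e2 (S K))) cf) in *.
    rewrite <- A1 in Hc2. apply code_at_nth in Hc2.
    unfold step. rewrite Hc2. cbn [pc].
    split; [cbn; lia|]. split; [|cbn [length tk set_mm]; lia].
    destruct A2 as (S1 & S2 & S3). split; [|split]; cbn; auto.
    congruence.
  - cbn [ccmd] in Hc |- *. apply andb_prop in Hb. destruct Hb as [Hb1 Hb2].
    apply Nat.ltb_lt in Hb1.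
    apply code_at_app in Hc. destruct Hc as [Hc1 Hc2]. subst a.
    destruct (cexp_correct e K s cf (Nat.le_refl K) Hb2 H Hc1 Hsim)
      as (A1 & A2 & A3 & A4).
    exists (length (cexp e K) + 1). rewrite run_add, run_one, length_app.
    set (cf1 := run P w g (length (cexp e K)) cf) in *.
    rewrite <- A1 in Hc2. apply code_at_nth in Hc2.
    unfold step. rewrite Hc2. cbn -[Nat.modulo Nat.pow].
    split; [lia|]. split; [|lia].
    destruct A2 as (S1 & S2 & S3).
    split; [|split]; cbn -[Nat.modulo Nat.pow]; auto; [|congruence].
    intros r' Hr'. unfold upd. destruct (Nat.eqb_spec r' r); auto.
  - apply andb_prop in Hb. destruct Hb as [Hb1 Hb2].
    cbn [ccmd] in Hc |- *. cbn zeta in Hc |- *.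
    apply code_at_app in Hc. destruct Hc as [Hc1 Hc2].
    destruct (IHexec1 a cf Hb1 Hc1 Hpc Hsim) as (t1 & A1 & A2 & A3).
    destruct (IHexec2 _ _ Hb2 Hc2 A1 A2) as (t2 & B1 & B2 & B3).
    exists (t1 + t2). cbn zeta. rewrite run_add, length_app.
    split; [lia|]. split; [exact B2|].
    pose proof (exec_tk _ _ _ _ _ H). pose proof (exec_tk _ _ _ _ _ H0). nia.
  - apply andb_prop in Hb. destruct Hb as [Hb Hb4].
    apply andb_prop in Hb. destruct Hb as [Hb Hb3].
    apply andb_prop in Hb. destruct Hb as [Hb1 Hb2].
    cbn [ccmd] in Hc |- *. cbn zeta in Hc |- *.
    apply code_at_app in Hc. destruct Hc as [Hc1 Hc].
    apply code_at_app in Hc. destruct Hc as [Hc2 Hc].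
    apply code_at_app in Hc. destruct Hc as [Hc3 Hc].
    apply code_at_app in Hc. destruct Hc as [Hc4 Hc5]. subst a.
    destruct (cexp2_correct e1 e2 s cf Hb1 Hb2 H H0 Hc1 Hsim)
      as (A1 & A2 & A3 & A4).
    set (L0 := length (cexp e1 K ++ cexp e2 (S K))) in *.
    set (cf1 := run P w g L0 cf) in *.
    apply code_at_nth in Hc2.
    cbn [length] in *.
    set (p2 := ccmd (pc cf + L0 + 1) c2) in *.
    set (l1 := pc cf + L0 + 1 + length p2 + 1) in *.
    set (p1 := ccmd l1 c1) in *.
    destruct (IHexec l1 (goto cf1 l1) Hb3) as (t & B1 & B2 & B3);
      [exact Hc5 | reflexivity | exact A2 |].
    exists (L0 + (1 + t)). cbn zeta. rewrite !run_add.
    fold cf1. rewrite <- A1 in Hc2.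
    rewrite (run_jlt _ _ _ _ Hc2), A3, A4.
    replace (val e1 s <? val e2 s) with true
      by (symmetry; apply Nat.ltb_lt; assumption).
    cbv iota; try rewrite A1.
    rewrite !length_app. cbn [length].
    assert (EL : L0 = length (cexp e1 K) + length (cexp e2 (S K)))
      by apply length_app.
    fold p1 in B1, B3. split; [rewrite B1; unfold l1; lia|].
    split; [exact B2|].
    pose proof (exec_tk _ _ _ _ _ H2). nia.
  - apply andb_prop in Hb. destruct Hb as [Hb Hb4].
    apply andb_prop in Hb. destruct Hb as [Hb Hb3].
    apply andb_prop in Hb. destruct Hb as [Hb1 Hb2].
    cbn [ccmd] in Hc |- *. cbn zeta in Hc |- *.
    apply code_at_app in Hc. destruct Hc as [Hc1 Hc].
    apply code_at_app in Hc. destruct Hc as [Hc2 Hc].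
    apply code_at_app in Hc. destruct Hc as [Hc3 Hc].
    apply code_at_app in Hc. destruct Hc as [Hc4 Hc5]. subst a.
    destruct (cexp2_correct e1 e2 s cf Hb1 Hb2 H H0 Hc1 Hsim)
      as (A1 & A2 & A3 & A4).
    set (L0 := length (cexp e1 K ++ cexp e2 (S K))) in *.
    set (cf1 := run P w g L0 cf) in *.
    apply code_at_nth in Hc2.
    cbn [length] in *.
    set (p2 := ccmd (pc cf + L0 + 1) c2) in *.
    set (l1 := pc cf + L0 + 1 + length p2 + 1) in *.
    set (p1 := ccmd l1 c1) in *.
    destruct (IHexec (pc cf + L0 + 1) (goto cf1 (S (pc cf + L0))) Hb4)
      as (t & B1 & B2 & B3); [exact Hc3 | cbn; lia | exact A2 |].
    exists (L0 + (1 + (t + 1))). cbn zeta. rewrite !run_add.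
    fold cf1. rewrite <- A1 in Hc2. rewrite (run_jlt _ _ _ _ Hc2), A3, A4.
    replace (val e1 s <? val e2 s) with false
      by (symmetry; apply Nat.ltb_ge; assumption).
    cbv iota; try rewrite A1.
    fold p2 in B1, B3.
    set (cf2 := run P w g t _) in *.
    rewrite <- B1 in Hc4. apply code_at_nth in Hc4.
    rewrite (run_jump _ _ Hc4). cbn [goto pc].
    rewrite !length_app. cbn [length].
    assert (EL : L0 = length (cexp e1 K) + length (cexp e2 (S K)))
      by apply length_app.
    split; [unfold l1; lia|].
    split; [exact B2|].
    pose proof (exec_tk _ _ _ _ _ H2). nia.
  - apply andb_prop in Hb. destruct Hb as [Hb Hb3].
    apply andb_prop in Hb. destruct Hb as [Hb1 Hb2].
    cbn [ccmd] in Hc |- *. cbn zeta in Hc |- *.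
    apply code_at_app in Hc. destruct Hc as [Hc1 Hc].
    apply code_at_app in Hc. destruct Hc as [Hc2 Hc].
    subst a.
    destruct (cexp2_correct e1 e2 s cf Hb1 Hb2 H H0 Hc1 Hsim)
      as (A1 & A2 & A3 & A4).
    set (L0 := length (cexp e1 K ++ cexp e2 (S K))) in *.
    set (cf1 := run P w g L0 cf) in *.
    apply (code_at_app _ _ [_] [_]) in Hc2.
    destruct Hc2 as [Hc2 Hc3]. cbn [length] in Hc3.
    apply code_at_nth in Hc2, Hc3.
    exists (L0 + (1 + 1)). cbn zeta. rewrite !run_add.
    fold cf1. rewrite <- A1 in Hc2. rewrite (run_jlt _ _ _ _ Hc2), A3, A4.
    replace (val e1 s <? val e2 s) with false
      by (symmetry; apply Nat.ltb_ge; assumption).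
    cbv iota; try rewrite A1.
    erewrite run_jump by (cbn [goto pc]; rewrite <- Nat.add_1_r; exact Hc3).
    cbn [goto pc].
    rewrite !length_app. cbn [length]. 
    assert (EL : L0 = length (cexp e1 K) + length (cexp e2 (S K)))
      by apply length_app.
    split; [lia|].
    split; [exact A2|]. lia.
  - pose proof Hb as Hb0. pose proof Hc as Hc0.
    apply andb_prop in Hb. destruct Hb as [Hb Hb3].
    apply andb_prop in Hb. destruct Hb as [Hb1 Hb2].
    cbn [ccmd] in Hc. cbn zeta in Hc.
    apply code_at_app in Hc. destruct Hc as [Hc1 Hc].
    apply code_at_app in Hc. destruct Hc as [Hc2 Hc].
    apply code_at_app in Hc. destruct Hc as [Hc3 Hc4].
    subst a.
    destruct (cexp2_correct e1 e2 s cf Hb1 Hb2 H H0 Hc1 Hsim)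
      as (A1 & A2 & A3 & A4).
    set (L0 := length (cexp e1 K ++ cexp e2 (S K))) in *.
    set (cf1 := run P w g L0 cf) in *.
    apply code_at_nth in Hc2.
    cbn [length] in *.
    set (l1 := pc cf + L0 + 2) in *.
    destruct (IHexec1 l1 (goto cf1 l1) Hb3) as (t & B1 & B2 & B3);
      [exact Hc3 | reflexivity | exact A2 |].
    set (cf2 := run P w g t _) in *.
    rewrite <- B1 in Hc4. apply code_at_nth in Hc4.
    destruct (IHexec2 (pc cf) (goto cf2 (pc cf)) Hb0 Hc0 eq_refl B2)
      as (t2 & D1 & D2 & D3).
    exists (L0 + (1 + (t + (1 + t2)))). cbn zeta. rewrite !run_add.
    fold cf1. rewrite <- A1 in Hc2. rewrite (run_jlt _ _ _ _ Hc2), A3, A4.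
    replace (val e1 s <? val e2 s) with true
      by (symmetry; apply Nat.ltb_lt; assumption).
    cbv iota; try rewrite A1.
    fold cf2. rewrite (run_jump _ _ Hc4).
    split; [exact D1|]. split; [exact D2|].
    pose proof (exec_tk _ _ _ _ _ H2). pose proof (exec_tk _ _ _ _ _ H3).
    cbn [tick tk] in *.
    (* The tick of this iteration grants [L0 + 3] steps and the length of the body, which pays for
       the test, the two jumps and the additive term in the bound for the body. *)
    assert (E : length (ccmd (pc cf) (While e1 e2 c))
            = L0 + 3 + length (ccmd l1 c)).
    { cbn [ccmd]. cbn zeta. rewrite length_app. fold L0. cbn [length app].
      rewrite length_app. cbn [length]. fold l1. lia. }
    rewrite E in *. nia.
Qed.

(** Rounds end in the middle of a run, where [ccmd_correct] says nothing; here only the queries made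
    up to such a point matter. *)
Lemma asks_correct c s l : asks w g c s l -> forall a cf,
  cmd_below K c = true -> code_at P a (ccmd a c) -> pc cf = a -> sim cf s ->
  exists t, asked (run P w g t cf) = l.
Proof.
  induction 1; intros a cf Hb Hc Hpc Hsim.
  - destruct (ccmd_correct _ _ _ H a cf Hb Hc Hpc Hsim) as (t & _ & A & _).
    exists t. apply A.
  - cbn [cmd_below] in Hb. apply andb_prop in Hb. destruct Hb as [Hb1 Hb2].
    cbn [ccmd] in Hc. cbn zeta in Hc. apply code_at_app in Hc. destruct Hc.
    eapply IHasks; eauto.
  - cbn [cmd_below] in Hb. apply andb_prop in Hb. destruct Hb as [Hb1 Hb2].
    cbn [ccmd] in Hc. cbn zeta in Hc. apply code_at_app in Hc.
    destruct Hc as [Hc1 Hc2].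
    destruct (ccmd_correct _ _ _ H a cf Hb1 Hc1 Hpc Hsim) as (t & A1 & A2 & _).
    destruct (IHasks _ _ Hb2 Hc2 A1 A2) as [t2 A].
    exists (t + t2). rewrite run_add. exact A.
  - cbn [cmd_below] in Hb. apply andb_prop in Hb. destruct Hb as [Hb Hb4].
    apply andb_prop in Hb. destruct Hb as [Hb Hb3].
    apply andb_prop in Hb. destruct Hb as [Hb1 Hb2].
    cbn [ccmd] in Hc |- *. cbn zeta in Hc |- *.
    apply code_at_app in Hc. destruct Hc as [Hc1 Hc].
    apply code_at_app in Hc. destruct Hc as [Hc2 Hc].
    apply code_at_app in Hc. destruct Hc as [Hc3 Hc]. subst a.
    destruct (cexp2_correct e1 e2 s cf Hb1 Hb2 H H0 Hc1 Hsim)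
      as (A1 & A2 & A3 & A4).
    set (L0 := length (cexp e1 K ++ cexp e2 (S K))) in *.
    set (cf1 := run P w g L0 cf) in *.
    apply code_at_nth in Hc2.
    cbn [length] in *.
    destruct (IHasks (pc cf + L0 + 1) (goto cf1 (S (pc cf + L0))) Hb4)
      as (t & B); [exact Hc3 | cbn; lia | exact A2 |].
    exists (L0 + (1 + t)). rewrite !run_add. fold cf1. rewrite <- A1 in Hc2.
    rewrite (run_jlt _ _ _ _ Hc2), A3, A4.
    replace (val e1 s <? val e2 s) with false
      by (symmetry; apply Nat.ltb_ge; assumption).
    cbv iota; try rewrite A1.
    exact B.
  - cbn [cmd_below] in Hb. apply andb_prop in Hb. destruct Hb as [Hb Hb3].
    apply andb_prop in Hb. destruct Hb as [Hb1 Hb2].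
    cbn [ccmd] in Hc. cbn zeta in Hc.
    apply code_at_app in Hc. destruct Hc as [Hc1 Hc].
    apply code_at_app in Hc. destruct Hc as [Hc2 Hc].
    apply code_at_app in Hc. destruct Hc as [Hc3 Hc4]. subst a.
    destruct (cexp2_correct e1 e2 s cf Hb1 Hb2 H H0 Hc1 Hsim)
      as (A1 & A2 & A3 & A4).
    set (L0 := length (cexp e1 K ++ cexp e2 (S K))) in *.
    set (cf1 := run P w g L0 cf) in *.
    apply code_at_nth in Hc2.
    cbn [length] in *.
    set (l1 := pc cf + L0 + 2) in *.
    destruct (IHasks l1 (goto cf1 l1) Hb3) as (t & B);
      [exact Hc3 | reflexivity | exact A2 |].
    exists (L0 + (1 + t)). rewrite !run_add. fold cf1. rewrite <- A1 in Hc2.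
    rewrite (run_jlt _ _ _ _ Hc2), A3, A4.
    replace (val e1 s <? val e2 s) with true
      by (symmetry; apply Nat.ltb_lt; assumption).
    cbv iota; try rewrite A1.
    exact B.
  - pose proof Hb as Hb0. pose proof Hc as Hc0.
    cbn [cmd_below] in Hb.
    apply andb_prop in Hb. destruct Hb as [Hb Hb3].
    apply andb_prop in Hb. destruct Hb as [Hb1 Hb2].
    cbn [ccmd] in Hc. cbn zeta in Hc.
    apply code_at_app in Hc. destruct Hc as [Hc1 Hc].
    apply code_at_app in Hc. destruct Hc as [Hc2 Hc].
    apply code_at_app in Hc. destruct Hc as [Hc3 Hc4].
    subst a.
    destruct (cexp2_correct e1 e2 s cf Hb1 Hb2 H H0 Hc1 Hsim)
      as (A1 & A2 & A3 & A4).
    set (L0 := length (cexp e1 K ++ cexp e2 (S K))) in *.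
    set (cf1 := run P w g L0 cf) in *.
    apply code_at_nth in Hc2.
    cbn [length] in *.
    set (l1 := pc cf + L0 + 2) in *.
    destruct (ccmd_correct _ _ _ H2 l1 (goto cf1 l1) Hb3) as (t & B1 & B2 & B3);
      [exact Hc3 | reflexivity | exact A2 |].
    set (cf2 := run P w g t _) in *.
    rewrite <- B1 in Hc4. apply code_at_nth in Hc4.
    destruct (IHasks (pc cf) (goto cf2 (pc cf)) Hb0 Hc0 eq_refl B2)
      as (t2 & D).
    exists (L0 + (1 + (t + (1 + t2)))). rewrite !run_add.
    fold cf1. rewrite <- A1 in Hc2. rewrite (run_jlt _ _ _ _ Hc2), A3, A4.
    replace (val e1 s <? val e2 s) with true
      by (symmetry; apply Nat.ltb_lt; assumption).
    cbv iota; try rewrite A1.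
    fold cf2. rewrite (run_jump _ _ Hc4). exact D.
Qed.

End Compile.

(** * Numeric keys of strings *)

(* The value of the first [h] bits of [u], padded with zeros, earlier bits
   being MORE significant: the order of these numbers is lexicographic. *)
Fixpoint mval (h : nat) (u : list bool) : nat :=
  match h, u with
  | S h', b :: u' => Nat.b2n b * 2 ^ h' + mval h' u'
  | _, _ => 0
  end.

Lemma mval_nil h : mval h [] = 0.
Proof. destruct h; reflexivity. Qed.

Lemma mval_lt h u : mval h u < 2 ^ h.
Proof.
  revert u; induction h; intros u; destruct u as [|b u]; cbn [mval].
  1, 2: cbn; lia.
  - pose proof (Nat.pow_nonzero 2 (S h)). lia.
  - specialize (IHh u). rewrite Nat.pow_succ_r'. destruct b; cbn [Nat.b2n]; lia.
Qed.

Lemma mval_firstn h u : mval h (firstn h u) = mval h u.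
Proof.
  revert u; induction h; intros u; [reflexivity|]. destruct u as [|b u]; cbn; auto.
Qed.

Lemma mval_add a b u : mval (a + b) u = mval a u * 2 ^ b + mval b (skipn a u).
Proof.
  revert u; induction a; intros u; [reflexivity|].
  destruct u as [|x u]; cbn [mval Nat.add skipn].
  - rewrite mval_nil. reflexivity.
  - rewrite IHa, Nat.pow_add_r. lia.
Qed.

(* Bit reversal of the [h] low bits. *)
Fixpoint rv (h x : nat) : nat :=
  match h with
  | 0 => 0
  | S h' => (x mod 2) * 2 ^ h' + rv h' (x / 2)
  end.

(** Short strings fit in: their missing bits are zeros at the top of the word, and the reversal
    moves them to the end, where [mval] pads. *)
Lemma rv_word h u : rv h (word_of_bits u) = mval h u.
Proof.
  revert u; induction h; intros u; [reflexivity|].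
  destruct u as [|b u]; cbn [rv mval word_of_bits].
  - specialize (IHh []). cbn [word_of_bits] in IHh.
    change (0 / 2) with 0. change (0 mod 2) with 0. rewrite IHh, mval_nil. lia.
  - rewrite <- IHh. rewrite Nat.add_comm, (Nat.mul_comm 2).
    rewrite Nat.add_comm at 1. rewrite Nat.Div0.mod_add, Nat.div_add by lia.
    destruct b; reflexivity.
Qed.

Lemma rv_double h y : y < 2 ^ h -> rv (S h) y = 2 * rv h y.
Proof.
  revert y; induction h; intros y Hy.
  - cbn in Hy. replace y with 0 by lia. reflexivity.
  - change (rv (S (S h)) y) with ((y mod 2) * 2 ^ (S h) + rv (S h) (y / 2)).
    rewrite Nat.pow_succ_r' in Hy.
    rewrite IHh by (apply Nat.Div0.div_lt_upper_bound; lia).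
    rewrite Nat.pow_succ_r'. cbn [rv]. lia.
Qed.

(** The recurrence that fills the reversal table. The top bit of [x / 2] is 0, so its reversal is
    even and halving it is exact; the lowest bit of [x] becomes the highest. *)
Lemma rv_half h x : 1 <= h -> x < 2 ^ h ->
  rv h x = rv h (x / 2) / 2 + (x mod 2) * 2 ^ (h - 1).
Proof.
  intros Hh Hx. destruct h as [|h]; [lia|]. rewrite Nat.pow_succ_r' in Hx.
  rewrite (rv_double h (x / 2)) by (apply Nat.Div0.div_lt_upper_bound; lia).
  rewrite (Nat.mul_comm 2), Nat.div_mul by lia.
  replace (S h - 1) with h by lia. cbn [rv]. lia.
Qed.

Lemma rv_lt h x : rv h x < 2 ^ h.
Proof.
  revert x; induction h; intros x; cbn [rv]; [cbn; lia|].
  specialize (IHh (x / 2)). rewrite Nat.pow_succ_r'.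
  pose proof (Nat.mod_upper_bound x 2). nia.
Qed.

(** * The lexicographic order *)

Lemma lex_irrefl u : lex_ltb u u = false.
Proof. induction u as [|a u]; cbn; [reflexivity|]. now rewrite eqb_reflx. Qed.

Lemma lex_trans u v x :
  lex_ltb u v = true -> lex_ltb v x = true -> lex_ltb u x = true.
Proof.
  revert v x; induction u as [|a u]; intros [|b v] [|c x]; cbn; try easy.
  destruct a, b, c; cbn; try easy; eauto.
Qed.

Lemma lex_total u v :
  lex_ltb u v = false -> lex_ltb v u = false -> u = v.
Proof.
  revert v; induction u as [|a u]; intros [|b v]; cbn; try easy.
  destruct a, b; cbn; try easy; intros; f_equal; auto.
Qed.

(** Strictness would fail: a string and its extension by zeros have the same key. *)
Lemma mval_mono M u v : lex_ltb v u = false -> mval M u <= mval M v.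
Proof.
  revert u v; induction M; intros u v H; [reflexivity|].
  destruct u as [|a u], v as [|b v]; cbn [mval]; try (cbn in H; easy || lia).
  cbn in H. pose proof (mval_lt M u). pose proof (mval_lt M v).
  specialize (IHM u v).
  destruct a, b; cbn in H |- *; try easy; try specialize (IHM H); lia.
Qed.

Lemma lex_firstn m u v :
  lex_ltb v u = false -> lex_ltb (firstn m v) (firstn m u) = false.
Proof.
  revert u v; induction m; intros u v H; [reflexivity|].
  destruct u as [|a u], v as [|b v]; cbn in H |- *; try easy.
  destruct a, b; cbn in H |- *; auto.
Qed.

(** With equal keys the shorter string must be a prefix of the longer one, whose remaining bits are
    zeros. *)
Lemma mval_short M v u :
  mval M v = mval M u -> length v < length u <= M -> lex_ltb v u = true.
Proof.
  revert v u; induction M; intros v u E L; [lia|].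
  destruct u as [|a u], v as [|b v]; cbn in L |- *; try lia; try easy.
  cbn [mval] in E. pose proof (mval_lt M u). pose proof (mval_lt M v).
  destruct a, b; cbn [Nat.b2n] in E; cbn; try lia; try easy;
    apply IHM; lia.
Qed.

Lemma mval_inj M u v : length u = length v -> length u <= M ->
  mval M u = mval M v -> u = v.
Proof.
  revert u v; induction M; intros u v L1 L2 E;
    destruct u as [|a u], v as [|b v]; cbn in L1, L2; try lia; try easy.
  cbn [mval] in E. pose proof (mval_lt M u). pose proof (mval_lt M v).
  destruct a, b; cbn [Nat.b2n] in E; try lia; f_equal; apply IHM; lia.
Qed.

Lemma lex_firstn_true m u v :
  lex_ltb v (firstn m u) = true -> lex_ltb v u = true.
Proof.
  revert m v; induction u as [|a u]; intros m v H.
  - rewrite firstn_nil in H. exact H.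
  - destruct m; [destruct v; easy|]. destruct v as [|b v]; [easy|].
    cbn in H |- *. destruct a, b; cbn in H |- *; try easy; eauto.
Qed.

(* The position of [u] relative to the strings with prefix [P]: 0 before them,
   1 among them, 2 after them.  Equal keys with [u] shorter than [P] mean that
   [u] is a proper prefix of [P] and that zeros were added. *)
Definition place (M : nat) (P u : list bool) : nat :=
  let a := mval M (firstn (length P) u) in
  let b := mval M P in
  if a <? b then 0 else if b <? a then 2 else
  if length u <? length P then 0 else 1.

Lemma place_mono M P u v : length P <= M -> lex_ltb v u = false ->
  place M P u <= place M P v.
Proof.
  intros LP H. unfold place.
  pose proof (mval_mono M _ _ (lex_firstn (length P) _ _ H)).
  repeat match goal with
         | |- context [?x <? ?y] => destruct (Nat.ltb_spec x y)
         end; try lia.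
  (* Left over: equal keys, [u] at least as long as [P], and [v] shorter than [P]. Then [v] would be
     a proper prefix of [u] and so smaller than [u]. *)
  exfalso. rewrite (firstn_all2 v) in * by lia.
  enough (lex_ltb v u = true) by congruence.
  apply lex_firstn_true with (m := length P).
  apply (mval_short M); [lia|]. rewrite firstn_length_le; lia.
Qed.

Lemma place_match M P u : length P <= M ->
  place M P u = 1 <-> firstn (length P) u = P.
Proof.
  intros LP. unfold place. split.
  - repeat match goal with
           | |- context [?x <? ?y] => destruct (Nat.ltb_spec x y)
           end; try lia. intros _.
    apply (mval_inj M); rewrite ?firstn_length_le; lia.
  - intros E. rewrite E, Nat.ltb_irrefl.
    destruct (Nat.ltb_spec (length u) (length P)) as [L|L]; [|reflexivity].
    rewrite firstn_all2 in E by lia. subst u. lia.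
Qed.

Lemma place_le2 M P u : place M P u <= 2.
Proof. unfold place. repeat destruct (_ <? _); lia. Qed.

(** This is what lets the merge advance without going back: a sample before one pattern is before
    all later ones in key order. Equal lengths make both comparisons look at the same prefix of
    [u]. *)
Lemma place_key_mono M P P' u : length P = length P' ->
  mval M P <= mval M P' -> place M P u = 0 -> place M P' u = 0.
Proof.
  intros L H. unfold place. rewrite <- L.
  repeat match goal with
         | |- context [?x <? ?y] => destruct (Nat.ltb_spec x y)
         end; lia.
Qed.

Lemma occurs_place M P T : 1 <= length P <= M ->
  occurs P T <->
  exists p, 1 <= p <= length T /\ place M P (suffix T p) = 1.
Proof.
  intros L. split.
  (* The start [S (length U)] lies inside the text because the pattern is not empty. *)
  - intros (U & V & ->). exists (S (length U)).
    rewrite !length_app. split; [lia|].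
    apply place_match; [lia|]. unfold suffix.
    replace (S (length U) - 1) with (length U) by lia.
    rewrite skipn_app, skipn_all, Nat.sub_diag. cbn [skipn app].
    rewrite firstn_app, firstn_all, Nat.sub_diag. cbn. now rewrite app_nil_r.
  - intros (p & Hp & E). apply place_match in E; [|lia].
    exists (firstn (p - 1) T), (skipn (length P) (suffix T p)).
    rewrite <- E at 1. rewrite firstn_skipn. unfold suffix.
    now rewrite firstn_skipn.
Qed.

(** * Suffix arrays *)

Lemma filter_length_lt (A : Type) (f g : A -> bool) l x :
  (forall y, f y = true -> g y = true) -> In x l -> f x = false ->
  g x = true -> length (filter f l) < length (filter g l).
Proof.
  intros H. assert (LE : forall l, length (filter f l) <= length (filter g l)).
  { induction l0 as [|y l0 IH]; cbn; [lia|]. specialize (H y).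
    destruct (f y), (g y); cbn; (lia || now specialize (H eq_refl)). }
  induction l as [|y l IH]; cbn; [easy|]. intros [->|I] F G.
  - rewrite F, G. cbn. specialize (LE l). lia.
  - specialize (IH I F G). specialize (H y).
    destruct (f y), (g y); cbn; (lia || now specialize (H eq_refl)).
Qed.

Section SuffixArray.
Variable T : list bool.
Let n := length T.

Lemma suffix_length p : length (suffix T p) = n - (p - 1).
Proof. unfold suffix. apply length_skipn. Qed.

(** Whatever precedes the suffix at [p] precedes the one at [q] by transitivity, and [p] itself is
    counted only for [q]. *)
Lemma suffix_rank_lt p q : 1 <= p <= n -> 1 <= q <= n ->
  lex_ltb (suffix T p) (suffix T q) = true ->
  suffix_rank T p < suffix_rank T q.
Proof.
  intros Hp Hq H. unfold suffix_rank. apply -> Nat.succ_lt_mono.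
  apply filter_length_lt with (x := p).
  - intros y. intros Hy. eapply lex_trans; eassumption.
  - apply in_seq. fold n. lia.
  - apply lex_irrefl.
  - exact H.
Qed.

Lemma suffix_rank_range p : 1 <= p <= n -> 1 <= suffix_rank T p <= n.
Proof.
  intros Hp. unfold suffix_rank. split; [lia|].
  pose proof (filter_length_lt _
    (fun q => lex_ltb (suffix T q) (suffix T p)) (fun _ => true)
    (seq 1 (length T)) p) as H.
  replace (filter (fun _ => true) (seq 1 (length T)))
    with (seq 1 (length T)) in H.
  - rewrite length_seq in H. apply H; auto.
    + apply in_seq. fold n. lia.
    + apply lex_irrefl.
  - clear. induction (seq 1 (length T)); cbn; congruence.
Qed.

Lemma suffix_rank_inj p q : 1 <= p <= n -> 1 <= q <= n ->
  suffix_rank T p = suffix_rank T q -> p = q.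
Proof.
  intros Hp Hq E.
  assert (suffix T p = suffix T q) as S.
  { apply lex_total; apply not_true_is_false; intros H;
      apply suffix_rank_lt in H; lia. }
  apply (f_equal (@length bool)) in S. rewrite !suffix_length in S. lia.
Qed.

Lemma SA_rank p : 1 <= p <= n -> SA T (suffix_rank T p) = p.
Proof.
  intros Hp. unfold SA.
  destruct (find _ _) as [q|] eqn:F.
  - apply find_some in F. destruct F as [F1 F2]. apply in_seq in F1.
    apply Nat.eqb_eq in F2. apply suffix_rank_inj; fold n in F1; auto; lia.
  - eapply find_none with (x := p) in F; [|apply in_seq; fold n; lia].
    rewrite Nat.eqb_refl in F. easy.
Qed.

(** By the pigeonhole principle: the [n] ranks are distinct and lie in [[1..n]], so each rank is
    attained. *)
Lemma SA_spec i : 1 <= i <= n ->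
  1 <= SA T i <= n /\ suffix_rank T (SA T i) = i.
Proof.
  intros Hi.
  assert (ND : NoDup (map (suffix_rank T) (seq 1 n))).
  { apply NoDup_map_NoDup_ForallPairs; [|apply seq_NoDup].
    intros x y Hx Hy. apply in_seq in Hx, Hy. apply suffix_rank_inj; lia. }
  assert (I : incl (seq 1 n) (map (suffix_rank T) (seq 1 n))).
  { apply NoDup_length_incl; auto.
    - now rewrite length_map.
    - intros x Hx. apply in_map_iff in Hx. destruct Hx as (y & <- & Hy).
      apply in_seq in Hy. apply in_seq.
      pose proof (suffix_rank_range y). lia. }
  specialize (I i ltac:(apply in_seq; lia)).
  apply in_map_iff in I. destruct I as (p & <- & Hp). apply in_seq in Hp.
  rewrite SA_rank by lia. split; [lia|reflexivity].
Qed.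

Lemma SA_mono i j : 1 <= i -> i <= j -> j <= n ->
  lex_ltb (suffix T (SA T j)) (suffix T (SA T i)) = false.
Proof.
  intros Hi Hij Hj. apply not_true_is_false. intros H.
  destruct (SA_spec i ltac:(lia)) as [A1 A2].
  destruct (SA_spec j ltac:(lia)) as [B1 B2].
  apply suffix_rank_lt in H; lia.
Qed.

End SuffixArray.

(** * Radix sort *)

(** A filter keeps the order of [L]; this is the stability on which the radix sort rests. *)
Definition bucket (f : nat -> nat) (L : list nat) (b : nat) : list nat :=
  filter (fun i => f i =? b) L.

Definition pass (B : nat) (f : nat -> nat) (L : list nat) : list nat :=
  flat_map (bucket f L) (seq 0 B).

Lemma pass_perm B f L : (forall i, In i L -> f i < B) ->
  Permutation (pass B f L) L.
Proof.
  intros H.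
  (* The first [b] buckets together hold the elements with digit below [b]; for [b = B] that is all
     of [L]. *)
  assert (G : forall b, Permutation (pass b f L) (filter (fun i => f i <? b) L)).
  { induction b as [|b IH].
    - unfold pass. cbn. clear. induction L; cbn; auto.
    - unfold pass in *. rewrite seq_S, flat_map_app, IH. cbn [flat_map Nat.add].
      rewrite app_nil_r. clear. unfold bucket. induction L as [|x L IH]; [reflexivity|].
      cbn [filter].
      destruct (Nat.ltb_spec (f x) b), (Nat.ltb_spec (f x) (S b)),
        (Nat.eqb_spec (f x) b); try lia; auto.
      + cbn. now constructor.
      + rewrite <- Permutation_middle. now constructor. }
  rewrite G. replace (filter _ L) with L; [reflexivity|].
  clear G. induction L as [|x L IH]; [reflexivity|]. cbn [filter].
  rewrite (proj2 (Nat.ltb_lt _ _)) by (apply H; now left).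
  f_equal. apply IH. intros. apply H. now right.
Qed.

Lemma StronglySorted_app_iff (R : nat -> nat -> Prop) l1 l2 :
  StronglySorted R l1 -> StronglySorted R l2 ->
  (forall x y, In x l1 -> In y l2 -> R x y) -> StronglySorted R (l1 ++ l2).
Proof.
  induction 1 as [|x l1 S1 IH F]; intros S2 H; [exact S2|]. cbn.
  constructor.
  - apply IH; auto. intros. apply H; [now right|auto].
  - apply Forall_app. split; [exact F|]. apply Forall_forall.
    intros y Hy. apply H; [now left|auto].
Qed.

(** [Q] exceeds every old key, so the new digit dominates: elements of different buckets are ordered
    by [f], those of one bucket by stability. *)
Lemma pass_sorted (B Q : nat) (f key : nat -> nat) L :
  (forall i, key i < Q) ->
  StronglySorted (fun i j => key i <= key j) L ->
  StronglySorted (fun i j => f i * Q + key i <= f j * Q + key j) (pass B f L).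
Proof.
  intros HQ S.
  assert (Sb : forall b, StronglySorted
    (fun i j => f i * Q + key i <= f j * Q + key j) (bucket f L b)).
  { intros b. unfold bucket. induction S as [|x L S IH F]; cbn; [constructor|].
    destruct (Nat.eqb_spec (f x) b); [|exact IH]. constructor; [exact IH|].
    apply Forall_forall. intros y Hy. apply filter_In in Hy.
    destruct Hy as [Hy E]. apply Nat.eqb_eq in E.
    rewrite Forall_forall in F. specialize (F y Hy). nia. }
  unfold pass. induction B as [|B IH]; [constructor|].
  rewrite seq_S, flat_map_app. cbn [flat_map Nat.add]. rewrite app_nil_r.
  apply StronglySorted_app_iff; auto.
  intros x y Hx Hy. apply in_flat_map in Hx. destruct Hx as (b & Hb & Hx).
  apply in_seq in Hb. apply filter_In in Hx, Hy.
  destruct Hx as [_ Ex], Hy as [_ Ey]. apply Nat.eqb_eq in Ex, Ey.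
  specialize (HQ x). nia.
Qed.

Lemma StronglySorted_nth (key : nat -> nat) L p q :
  StronglySorted (fun i j => key i <= key j) L ->
  p <= q < length L -> key (nth p L 0) <= key (nth q L 0).
Proof.
  intros S. revert p q; induction S as [|x L S IH F]; cbn; intros p q H; [lia|].
  destruct q as [|q]; [replace p with 0 by lia; lia|].
  destruct p as [|p]; [|apply IH; lia].
  rewrite Forall_forall in F. apply F, nth_In. lia.
Qed.

(* [dg i e] is the [e]-th of the [E] digits of the key of [i], most significant
   first; the passes go from the last digit to the first. *)
Fixpoint radix (B E : nat) (dg : nat -> nat -> nat) (L : list nat) (e : nat)
  : list nat :=
  match e with
  | 0 => L
  | S e => pass B (fun i => dg i (E - 1 - e)) (radix B E dg L e)
  end.

Lemma radix_perm B E dg L e : (forall i e', dg i e' < B) ->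
  Permutation (radix B E dg L e) L.
Proof.
  intros H. induction e as [|e IH]; cbn; [reflexivity|].
  rewrite pass_perm by auto. exact IH.
Qed.

Lemma radix_sorted h E (str : nat -> list bool) L :
  StronglySorted (fun i j => mval (E * h) (str i) <= mval (E * h) (str j))
    (radix (2 ^ h) E (fun i e => mval h (skipn (e * h) (str i))) L E).
Proof.
  (* After [e] passes the list is sorted by the last [e] digits. *)
  assert (G : forall e, e <= E -> StronglySorted
    (fun i j => mval (e * h) (skipn ((E - e) * h) (str i))
             <= mval (e * h) (skipn ((E - e) * h) (str j)))
    (radix (2 ^ h) E (fun i e => mval h (skipn (e * h) (str i))) L e)).
  { induction e as [|e IH]; intros He.
    - cbn. clear. induction L; constructor; auto.
      apply Forall_forall; auto.
    - cbn [radix].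
      assert (X : forall i, mval (S e * h) (skipn ((E - S e) * h) (str i)) =
        mval h (skipn ((E - 1 - e) * h) (str i)) * 2 ^ (e * h)
        + mval (e * h) (skipn ((E - e) * h) (str i))).
      { intros i. change (S e * h) with (h + e * h). rewrite mval_add, skipn_skipn.
        replace (E - 1 - e) with (E - S e) by lia.
        do 3 f_equal. replace (E - e) with (S (E - S e)) by lia. lia. }
      pose proof (pass_sorted (2 ^ h) (2 ^ (e * h))
        (fun i => mval h (skipn ((E - 1 - e) * h) (str i)))
        (fun i => mval (e * h) (skipn ((E - e) * h) (str i))) _
        ltac:(intros; apply mval_lt) (IH ltac:(lia))) as P.
      cbn beta in P. revert P. generalize (pass (2 ^ h)
        (fun i => mval h (skipn ((E - 1 - e) * h) (str i)))
        (radix (2 ^ h) E (fun i e => mval h (skipn (e * h) (str i))) L e)).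
      intros l Sl. induction Sl as [|x l Sl IHl F]; constructor; auto.
      eapply Forall_impl; [|exact F]. cbn beta. intros y Hy.
      rewrite !X. exact Hy. }
  specialize (G E (le_n E)). rewrite Nat.sub_diag in G. exact G.
Qed.

(** * Packed strings *)

Lemma word_of_bits_testbit s j : Nat.testbit (word_of_bits s) j = nth j s false.
Proof.
  revert j; induction s as [|b s IH]; intros j.
  - cbn [word_of_bits]. rewrite Nat.bits_0. destruct j; reflexivity.
  - cbn [word_of_bits]. rewrite Nat.add_comm. destruct j as [|j]; cbn [nth].
    + destruct b; cbn [Nat.b2n]; [apply Nat.testbit_odd_0|].
      rewrite Nat.add_0_r. apply Nat.testbit_even_0.
    + rewrite <- IH. destruct b; cbn [Nat.b2n]; [apply Nat.testbit_odd_succ; lia|].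
      rewrite Nat.add_0_r. apply Nat.testbit_even_succ; lia.
Qed.

Lemma word_of_bits_lt s : word_of_bits s < 2 ^ length s.
Proof.
  induction s as [|b s IH]; [cbn; lia|]. cbn [word_of_bits length].
  rewrite Nat.pow_succ_r'. destruct b; cbn [Nat.b2n]; lia.
Qed.

Lemma word_of_bits_firstn_lt l s : word_of_bits (firstn l s) < 2 ^ l.
Proof.
  eapply Nat.lt_le_trans; [apply word_of_bits_lt|].
  apply Nat.pow_le_mono_r; [lia|]. apply firstn_le_length.
Qed.

Lemma pack_length w s : length (pack w s) = (length s + w - 1) / w.
Proof. unfold pack. now rewrite length_map, length_seq. Qed.

(** In terms of packing: [l] bits have a word number [q] iff that word starts before the end. *)
Lemma div_up_gt w l q : 1 <= w -> q * w < l <-> q < (l + w - 1) / w.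
Proof.
  intros Hw. split; intros H.
  - apply (Nat.div_le_lower_bound _ _ (S q)); lia.
  - assert ((S q) * w <= l + w - 1); [|lia].
    rewrite Nat.mul_comm. etransitivity; [|apply Nat.Div0.mul_div_le with (b := w)].
    apply Nat.mul_le_mono_l. exact H.
Qed.

Lemma pack_nth w s q : 1 <= w -> q * w < length s ->
  nth q (pack w s) 0 = word_of_bits (firstn w (skipn (q * w) s)).
Proof.
  intros Hw H. unfold pack. apply div_up_gt in H; [|lia].
  rewrite nth_indep with (d' := word_of_bits (firstn w (skipn (0 * w) s)))
    by (rewrite length_map, length_seq; exact H).
  rewrite (map_nth (fun j => word_of_bits (firstn w (skipn (j * w) s)))).
  rewrite seq_nth by exact H. reflexivity.
Qed.

Lemma pack_bound w s x : In x (pack w s) -> x < 2 ^ w.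
Proof.
  intros H. apply in_map_iff in H. destruct H as (j & <- & _).
  apply word_of_bits_firstn_lt.
Qed.

(** Only words that start inside the string are constrained; the cells behind it may hold other
    data. *)
Definition packed (w : nat) (f : nat -> nat) (base : nat) (s : list bool)
  : Prop :=
  forall q, q * w < length s ->
    f (base + q) = word_of_bits (firstn w (skipn (q * w) s)).

Lemma testbit_add_shift a b t j : a < 2 ^ t ->
  Nat.testbit (a + b * 2 ^ t) j =
  if j <? t then Nat.testbit a j else Nat.testbit b (j - t).
Proof.
  intros Ha. destruct (Nat.ltb_spec j t) as [L|L].
  - rewrite <- (Nat.mod_pow2_bits_low (a + b * 2 ^ t) t) by exact L.
    rewrite Nat.Div0.mod_add, Nat.mod_small by exact Ha. reflexivity.
  - replace j with ((j - t) + t) at 1 by lia. rewrite <- Nat.div_pow2_bits.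
    rewrite Nat.div_add, Nat.div_small by (auto; apply Nat.pow_nonzero; lia).
    reflexivity.
Qed.

(** At most [w] bits meet at most two consecutive words: the high part of the first, shifted down,
    is followed by the low part of the second. The second cell may lie behind the string, but then
    the final [mod] cuts its bits off. *)
Lemma window w f base s pos l :
  1 <= w -> packed w f base s -> pos + l <= length s -> l <= w ->
  pos < length s ->
  (f (base + pos / w) / 2 ^ (pos mod w)
   + (f (base + pos / w + 1) mod 2 ^ (pos mod w)) * 2 ^ (w - pos mod w))
    mod 2 ^ l = word_of_bits (firstn l (skipn pos s)).
Proof.
  intros Hw Hp Hl Hlw Hpos.
  pose proof (Nat.div_mod pos w ltac:(lia)) as E.
  pose proof (Nat.mod_upper_bound pos w ltac:(lia)) as Hr.
  set (q := pos / w) in *. set (r := pos mod w) in *.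
  apply Nat.bits_inj. intros j. rewrite word_of_bits_testbit, nth_firstn.
  destruct (Nat.ltb_spec j l) as [L|L].
  2: { apply Nat.mod_pow2_bits_high. lia. }
  rewrite Nat.mod_pow2_bits_low by exact L.
  rewrite nth_skipn, (Hp q) by lia.
  rewrite testbit_add_shift.
  2: { apply Nat.Div0.div_lt_upper_bound. rewrite <- Nat.pow_add_r.
       replace (r + (w - r)) with w by lia. apply word_of_bits_firstn_lt. }
  destruct (Nat.ltb_spec j (w - r)) as [L2|L2].
  - rewrite Nat.div_pow2_bits, word_of_bits_testbit, nth_firstn, nth_skipn.
    destruct (Nat.ltb_spec (j + r) w); [f_equal; lia|lia].
  - rewrite Nat.mod_pow2_bits_low by lia.
    replace (base + q + 1) with (base + S q) by lia. rewrite (Hp (S q)) by lia.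
    rewrite word_of_bits_testbit, nth_firstn, nth_skipn.
    destruct (Nat.ltb_spec (j - (w - r)) w); [f_equal; lia|lia].
Qed.


(** The two parts occupy disjoint bit ranges of one word, the [w - r] low bits and the [r] high
    ones. *)
Lemma window_lt w r a b : r < w -> a < 2 ^ w ->
  a / 2 ^ r + (b mod 2 ^ r) * 2 ^ (w - r) < 2 ^ w.
Proof.
  intros Hr HA.
  assert (Ha : a / 2 ^ r < 2 ^ (w - r)).
  { apply Nat.Div0.div_lt_upper_bound. rewrite <- Nat.pow_add_r.
    replace (r + (w - r)) with w by lia. exact HA. }
  assert (Hb : b mod 2 ^ r < 2 ^ r)
    by (apply Nat.mod_upper_bound, Nat.pow_nonzero; lia).
  assert (HW : 2 ^ r * 2 ^ (w - r) = 2 ^ w)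
    by (rewrite <- Nat.pow_add_r; f_equal; lia).
  nia.
Qed.

Lemma nth_concat_const (A : Type) (e : nat) (L : list (list A)) i j d :
  (forall l, In l L -> length l = e) -> i < length L -> j < e ->
  nth (i * e + j) (concat L) d = nth j (nth i L []) d.
Proof.
  revert i; induction L as [|l L IH]; cbn [length]; intros i H Hi Hj; [lia|].
  assert (length l = e) by (apply H; now left).
  cbn [concat]. destruct i as [|i]; cbn [nth].
  - rewrite app_nth1 by lia. reflexivity.
  - rewrite app_nth2 by lia.
    replace (S i * e + j - length l) with (i * e + j) by lia.
    apply IH; auto; [|lia]. intros; apply H; now right.
Qed.

Lemma length_concat_const (A : Type) (e : nat) (L : list (list A)) :
  (forall l, In l L -> length l = e) -> length (concat L) = length L * e.
Proof.
  induction L as [|l L IH]; intros H; [reflexivity|]. cbn [concat length].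
  rewrite length_app, IH, H; [lia|now left|]. intros; apply H; now right.
Qed.

Section InitMem.
Variables (w m : nat) (T : list bool) (D : list (list bool)).
Hypothesis Hw : 1 <= w.
Hypothesis HD : forall p, In p D -> length p = m.
Let NT := (length T + w - 1) / w.
Let EW := (m + w - 1) / w.

Lemma pack_lengths l : In l (map (pack w) D) -> length l = EW.
Proof.
  intros H. apply in_map_iff in H. destruct H as (p & <- & Hp).
  rewrite pack_length, HD by exact Hp. reflexivity.
Qed.

Lemma init_mem_text : packed w (init_mem w T D) 0 T.
Proof.
  intros q Hq. unfold init_mem. cbn [Nat.add].
  rewrite app_nth1 by (rewrite pack_length; apply div_up_gt; auto).
  apply pack_nth; auto.
Qed.

Lemma init_mem_pattern i : i < length D ->
  packed w (init_mem w T D) (NT + i * EW) (nth i D []).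
Proof.
  intros Hi q Hq. unfold init_mem.
  assert (length (nth i D []) = m) as L by (apply HD, nth_In; exact Hi).
  rewrite app_nth2 by (rewrite pack_length; fold NT; lia).
  rewrite pack_length. fold NT.
  replace (NT + i * EW + q - NT) with (i * EW + q) by lia.
  rewrite nth_concat_const.
  - rewrite nth_indep with (d' := pack w []) by now rewrite length_map.
    rewrite map_nth. apply pack_nth; auto.
  - apply pack_lengths.
  - now rewrite length_map.
  - apply div_up_gt; auto. lia.
Qed.

Lemma init_mem_zero a : NT + length D * EW <= a -> init_mem w T D a = 0.
Proof.
  intros H. unfold init_mem. apply nth_overflow.
  rewrite length_app, pack_length, (length_concat_const _ EW), length_map
    by apply pack_lengths. exact H.
Qed.

Lemma init_mem_bound a : init_mem w T D a < 2 ^ w.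
Proof.
  unfold init_mem.
  destruct (nth_in_or_default a (pack w T ++ concat (map (pack w) D)) 0)
    as [I | ->].
  - apply in_app_or in I. destruct I as [I|I].
    + eapply pack_bound, I.
    + apply in_concat in I. destruct I as (l & Hl & I).
      apply in_map_iff in Hl. destruct Hl as (p & <- & _).
      eapply pack_bound, I.
  - apply Nat.neq_0_lt_0, Nat.pow_nonzero. discriminate.
Qed.

End InitMem.

(** * Program logic *)

(** Total correctness, overflow included, because [exec] relates only safe and finished runs. *)
Definition wp (w : nat) (g : nat -> nat) (c : cmd) (Q : state -> Prop)
  (s : state) : Prop := exists s', exec w g c s s' /\ Q s'.

(** Boolean, so that frame conditions on concrete programs hold by computation. *)
Definition written (c : cmd) (r : nat) : bool :=
  existsb (Nat.eqb r) (writes c).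

Definition same (c : cmd) (s' s : state) : Prop :=
  forall r, written c r = false -> rg s' r = rg s r.

Lemma same_trans c s1 s2 s3 : same c s1 s2 -> same c s2 s3 -> same c s1 s3.
Proof. intros H1 H2 r Hr. rewrite H1, H2; auto. Qed.

Lemma exec_same w g c s s' : exec w g c s s' -> same c s' s.
Proof.
  intros H r Hr. eapply exec_frame; [exact H|]. intros I.
  enough (written c r = true) by congruence.
  apply existsb_exists. exists r. split; [exact I|apply Nat.eqb_refl].
Qed.

Section Wp.
Variables (w : nat) (g : nat -> nat).
Notation wp := (wp w g).

(** The frame condition is handed to the continuation, so a specification does not have to list the
    registers that it leaves alone. *)
Lemma wp_conseq c (Q Q' : state -> Prop) s :
  wp c Q s -> (forall s', same c s' s -> Q s' -> Q' s') -> wp c Q' s.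
Proof.
  intros (s' & X & H) I. exists s'. split; [exact X|].
  apply I; [eapply exec_same, X|exact H].
Qed.

Lemma wp_skip (Q : state -> Prop) s : Q s -> wp Skip Q s.
Proof. intros H. eexists. split; [constructor|exact H]. Qed.

Lemma wp_asg r e (Q : state -> Prop) s :
  safe w e s -> Q (set_rg s r (val e s)) -> wp (Asg r e) Q s.
Proof. intros H1 H. eexists. split; [constructor; exact H1|exact H]. Qed.

Lemma wp_sto e1 e2 (Q : state -> Prop) s : safe w e1 s -> safe w e2 s ->
  Q (set_mm s (val e1 s) (val e2 s)) -> wp (Sto e1 e2) Q s.
Proof. intros H1 H2 H. eexists. split; [constructor; auto|exact H]. Qed.

Lemma wp_ask r e (Q : state -> Prop) s : safe w e s ->
  Q (ask_st s r (val e s) (g (val e s) mod 2 ^ w)) -> wp (Ask r e) Q s.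
Proof. intros H1 H. eexists. split; [constructor; auto|exact H]. Qed.

Lemma wp_seq c1 c2 (Q : state -> Prop) s :
  wp c1 (wp c2 Q) s -> wp (Seq c1 c2) Q s.
Proof.
  intros (s1 & X1 & s2 & X2 & H). exists s2. split; [|exact H].
  econstructor; eassumption.
Qed.

Lemma wp_ite e1 e2 c1 c2 (Q : state -> Prop) s :
  safe w e1 s -> safe w e2 s ->
  (val e1 s < val e2 s -> wp c1 Q s) ->
  (val e2 s <= val e1 s -> wp c2 Q s) -> wp (Ite e1 e2 c1 c2) Q s.
Proof.
  intros S1 S2 H1 H2. destruct (Nat.lt_ge_cases (val e1 s) (val e2 s)) as [L|L].
  - destruct (H1 L) as (s' & X & H). exists s'. split; [|exact H].
    apply exec_ite_t; assumption.
  - destruct (H2 L) as (s' & X & H). exists s'. split; [|exact H].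
    apply exec_ite_f; assumption.
Qed.

Lemma wp_while (I : state -> Prop) (mu : state -> nat) e1 e2 c
  (Q : state -> Prop) s0 :
  I s0 ->
  (forall s, I s -> same c s s0 ->
    safe w e1 s /\ safe w e2 s /\
    (val e1 s < val e2 s -> wp c (fun s' => I s' /\ mu s' < mu s) (tick s)) /\
    (val e2 s <= val e1 s -> Q s)) ->
  wp (While e1 e2 c) Q s0.
Proof.
  intros H0 H.
  assert (G : forall N s, mu s < N -> I s -> same c s s0 ->
    wp (While e1 e2 c) Q s).
  { induction N as [|N IH]; intros s Hs HI Hf; [lia|].
    destruct (H s HI Hf) as (S1 & S2 & Ht & Hq).
    destruct (Nat.lt_ge_cases (val e1 s) (val e2 s)) as [L|L].
    - destruct (Ht L) as (s1 & X1 & HI1 & Hm).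
      destruct (IH s1) as (s2 & X2 & H2); auto; [lia| |].
      { eapply same_trans; [eapply exec_same, X1|exact Hf]. }
      exists s2. split; [|exact H2]. eapply exec_while_t; eassumption.
    - exists s. split; [|auto]. apply exec_while_f; assumption. }
  apply (G (S (mu s0)) s0); auto. intros r _. reflexivity.
Qed.

(** The index of [I] counts the iterations made so far, so an invariant can state the number of
    ticks exactly. *)
Lemma wp_for (N : nat) (I : nat -> state -> Prop) e1 e2 c
  (Q : state -> Prop) s0 :
  I 0 s0 ->
  (forall i s, i < N -> I i s -> same c s s0 ->
    safe w e1 s /\ safe w e2 s /\ val e1 s < val e2 s /\
    wp c (I (S i)) (tick s)) ->
  (forall s, I N s -> same c s s0 ->
    safe w e1 s /\ safe w e2 s /\ val e2 s <= val e1 s /\ Q s) ->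
  wp (While e1 e2 c) Q s0.
Proof.
  intros H0 Hs HN.
  assert (G : forall d i s, i + d = N -> I i s -> same c s s0 ->
    wp (While e1 e2 c) Q s).
  { induction d as [|d IH]; intros i s Hi HI Hf.
    - replace i with N in HI by lia.
      destruct (HN s HI Hf) as (S1 & S2 & L & HQ).
      exists s. split; [|exact HQ]. apply exec_while_f; assumption.
    - destruct (Hs i s ltac:(lia) HI Hf) as (S1 & S2 & L & s1 & X1 & HI1).
      destruct (IH (S i) s1) as (s2 & X2 & H2); auto; [lia| |].
      { eapply same_trans; [eapply exec_same, X1|exact Hf]. }
      exists s2. split; [|exact H2]. eapply exec_while_t; eassumption. }
  apply (G N 0 s0); auto. intros r _. reflexivity.
Qed.

End Wp.

(** * Arithmetic of addresses and three-way comparison of numbers by digits *)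

Lemma firstn_S_nth (A : Type) (d : A) p L : p < length L ->
  firstn (S p) L = firstn p L ++ [nth p L d].
Proof.
  revert L; induction p; intros [|x L] H; cbn in H |- *; try lia; [reflexivity|].
  f_equal. apply IHp. lia.
Qed.

Lemma mul_succ_le a b c : a < b -> a * c + c <= b * c.
Proof. intros. replace (a * c + c) with (S a * c) by lia. apply Nat.mul_le_mono_r. lia. Qed.

Lemma mul_add_inj c a b x y :
  x < c -> y < c -> a * c + x = b * c + y -> a = b /\ x = y.
Proof. intros. assert (a = b) by nia. subst. lia. Qed.

(** The coding agrees with that of [place]: 0 below, 1 equal, 2 above. *)
Definition cmp3 (a b : nat) : nat :=
  if a <? b then 0 else if b <? a then 2 else 1.

Lemma cmp3_digit Q a b x y : x < Q -> y < Q ->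
  cmp3 (a * Q + x) (b * Q + y) =
  if cmp3 a b =? 1 then cmp3 x y else cmp3 a b.
Proof.
  intros Hx Hy. unfold cmp3.
  destruct (Nat.lt_trichotomy a b) as [L|[->|L]].
  - assert (a * Q + x < b * Q + y) by nia.
    rewrite (proj2 (Nat.ltb_lt _ _)) by assumption.
    now rewrite (proj2 (Nat.ltb_lt a b)).
  - rewrite Nat.ltb_irrefl, Nat.eqb_refl.
    repeat match goal with
         | |- context [?x <? ?y] => destruct (Nat.ltb_spec x y)
         end; lia.
  - assert (b * Q + y < a * Q + x) by nia.
    rewrite (proj2 (Nat.ltb_ge (a * Q + x) _)) by lia.
    rewrite (proj2 (Nat.ltb_lt (b * Q + y) _)) by lia.
    rewrite (proj2 (Nat.ltb_ge a b)) by lia.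
    now rewrite (proj2 (Nat.ltb_lt b a)).
Qed.

Arguments upd _ _ _ _ /.

Ltac rd := cbn [rg mm qs tk set_rg set_mm ask_st tick upd val exact_op fits
  safe Nat.eqb] in *.
Ltac rs := rd;
  repeat match goal with
  | H : rg ?s ?r = _ |- context [rg ?s ?r] => rewrite H
  end;
  rewrite ?Nat.shiftr_div_pow2, ?Nat.shiftl_mul_pow2, ?Nat.mul_1_l.
Ltac arith := rs; repeat split; try lia; try assumption.
Ltac asg := apply wp_seq, wp_asg; [arith | rs].
Ltac asg1 := apply wp_asg; [arith | rs].

Infix ";;" := Seq (at level 60, right associativity).

(** * Rounds *)

Section Rounds.
Variables w n : nat.

Definition in_range (g : nat -> nat) : Prop :=
  forall i, 1 <= i <= n -> 1 <= g i <= n.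

(* [c] run from [s] with the oracle [f] ends in [s'] and makes the queries [rs],
   split into rounds; with another oracle that agrees with [f] on the first [r]
   rounds it reaches the end of round [r + 1] with the same queries. *)
Definition in_rounds (f : nat -> nat) (c : cmd) (s : state)
  (rs : list (list nat)) (s' : state) : Prop :=
  exec w f c s s' /\ qs s' = qs s ++ concat rs /\
  forall r g, r < length rs -> in_range g ->
    (forall q, In q (concat (firstn r rs)) -> g q = f q) ->
    asks w g c s (qs s ++ concat (firstn (S r) rs)).

Lemma in_rounds_quiet f c s s' :
  exec w f c s s' -> qs s' = qs s -> in_rounds f c s [] s'.
Proof.
  intros X Q. split; [exact X|]. split; [now rewrite app_nil_r|].
  intros r g Hr. cbn in Hr. lia.
Qed.

(** A single round is established by running its command with every oracle in the range and
    observing the same queries, whatever the answers. *)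
Lemma in_rounds_one f c s s' l :
  exec w f c s s' -> qs s' = qs s ++ l ->
  (forall g, in_range g -> exists s1, exec w g c s s1 /\ qs s1 = qs s ++ l) ->
  in_rounds f c s [l] s'.
Proof.
  intros X Q G. split; [exact X|]. cbn [concat]. rewrite app_nil_r.
  split; [exact Q|]. intros r g Hr Hg _. replace r with 0 by (cbn in Hr; lia).
  cbn [firstn concat]. rewrite app_nil_r. destruct (G g Hg) as (s1 & X1 & Q1).
  rewrite <- Q1. apply asks_exec, X1.
Qed.

(** Shared by sequences and loops. Round [r + 1] belongs to [c1] or to [c2]; in the latter case [g]
    agrees with [f] on all queries of [c1], so [c1] reaches the same state [s1] under [g]. *)
Lemma in_rounds_app f g rs1 rs2 s s1 c1 c2 l r (P : list nat -> Prop) :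
  in_rounds f c1 s rs1 s1 -> in_rounds f c2 s1 rs2 l ->
  r < length (rs1 ++ rs2) -> in_range g ->
  (forall q, In q (concat (firstn r (rs1 ++ rs2))) -> g q = f q) ->
  (forall x, asks w g c1 s x -> P x) ->
  (forall x, exec w g c1 s s1 -> asks w g c2 s1 x -> P x) ->
  P (qs s ++ concat (firstn (S r) (rs1 ++ rs2))).
Proof.
  intros (X1 & Q1 & G1) (X2 & Q2 & G2) Hr Hg Ha HP1 HP2.
  rewrite length_app in Hr.
  destruct (Nat.lt_ge_cases r (length rs1)) as [L|L].
  - rewrite firstn_app in Ha. rewrite firstn_app. replace (S r - length rs1) with 0 by lia.
    replace (r - length rs1) with 0 in Ha by lia.
    cbn [firstn] in *. rewrite app_nil_r in *. apply HP1, G1; auto.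
  - rewrite firstn_app in Ha. rewrite firstn_app.
    rewrite (firstn_all2 rs1) in Ha by lia. rewrite (firstn_all2 rs1) by lia.
    rewrite concat_app in Ha. rewrite concat_app.
    replace (S r - length rs1) with (S (r - length rs1)) by lia.
    rewrite app_assoc, <- Q1. apply HP2.
    + eapply exec_agree; [exact X1|exact Q1|].
      intros q Hq. apply Ha, in_or_app. now left.
    + apply G2; [lia|auto|]. intros q Hq. apply Ha, in_or_app. now right.
Qed.

Lemma in_rounds_seq f c1 c2 s s1 s2 rs1 rs2 :
  in_rounds f c1 s rs1 s1 -> in_rounds f c2 s1 rs2 s2 ->
  in_rounds f (c1 ;; c2) s (rs1 ++ rs2) s2.
Proof.
  intros A1 A2. pose proof A1 as (X1 & Q1 & _). pose proof A2 as (X2 & Q2 & _).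
  split; [econstructor; eassumption|].
  split; [now rewrite Q2, Q1, concat_app, app_assoc|].
  intros r g Hr Hg Ha.
  eapply in_rounds_app with (P := asks w g (c1 ;; c2) s); try eassumption.
  - intros x. apply asks_seq1.
  - intros x. apply asks_seq2.
Qed.

Lemma in_rounds_while f e1 e2 c s s1 s2 rs1 rs2 :
  safe w e1 s -> safe w e2 s -> val e1 s < val e2 s ->
  in_rounds f c (tick s) rs1 s1 -> in_rounds f (While e1 e2 c) s1 rs2 s2 ->
  in_rounds f (While e1 e2 c) s (rs1 ++ rs2) s2.
Proof.
  intros S1 S2 L A1 A2.
  pose proof A1 as (X1 & Q1 & _). pose proof A2 as (X2 & Q2 & _).
  split; [eapply exec_while_t; eassumption|].
  split; [rewrite Q2, Q1, concat_app, app_assoc; reflexivity|].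
  intros r g Hr Hg Ha. change (qs s) with (qs (tick s)).
  eapply in_rounds_app with (P := asks w g (While e1 e2 c) s); try eassumption.
  - intros x. apply asks_while1; assumption.
  - intros x. apply asks_while2; assumption.
Qed.

Lemma in_rounds_while_end f e1 e2 c s :
  safe w e1 s -> safe w e2 s -> val e2 s <= val e1 s ->
  in_rounds f (While e1 e2 c) s [] s.
Proof. intros. apply in_rounds_quiet; [apply exec_while_f; auto|reflexivity]. Qed.

End Rounds.

(** * The program *)

Notation "$ r" := (Var r) (at level 1, r at level 0, format "$ r").
Infix "+'" := (Bin Add) (at level 50, left associativity).
Infix "-'" := (Bin Sub) (at level 50, left associativity).
Infix "*'" := (Bin Mul) (at level 40, left associativity).
Infix "/'" := (Bin Div) (at level 40, left associativity).
Infix "%'" := (Bin Mod) (at level 40, left associativity).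

Notation rN := 0 (only parsing).
Notation rW := 1 (only parsing).
Notation rK := 2 (only parsing).
Notation rM := 3 (only parsing).
Notation rAns := 4 (only parsing).
Notation rH := 5 (only parsing).
Notation rB := 6 (only parsing).
Notation rE := 7 (only parsing).
Notation rEW := 8 (only parsing).
Notation rNT := 9 (only parsing).
Notation rREV := 10 (only parsing).
Notation rDIG := 11 (only parsing).
Notation rORD := 12 (only parsing).
Notation rLO := 13 (only parsing).
Notation rSM := 14 (only parsing).
Notation rBK := 15 (only parsing).
Notation rHB := 17 (only parsing).
Notation rK1 := 18 (only parsing).
Notation rBase := 20 (only parsing).
Notation rLen := 21 (only parsing).
Notation rPos := 22 (only parsing).
Notation rOut := 23 (only parsing).
Notation rP := 30 (only parsing).
Notation rI := 31 (only parsing).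
Notation rRes := 32 (only parsing).

Definition consts : list nat :=
  [rN; rW; rK; rM; rH; rB; rE; rEW; rNT; rREV; rDIG; rORD; rLO; rSM; rBK;
   rHB; rK1].

(* The digit of [rH] bits that starts at offset [rPos] of the string of [rLen]
   bits packed at address [rBase]. *)
Definition get_digit : cmd :=
  Ite $rPos $rLen
    (Asg 24 ($rBase +' $rPos /' $rW) ;;
     Asg 25 ($rPos %' $rW) ;;
     Asg 26 ($rLen -' $rPos) ;;
     Ite $rH $26 (Asg 26 $rH) Skip ;;
     Asg rOut (Bin Shr (Fetch $24) $25
               +' Bin Shl (Fetch ($24 +' Cst 1) %' Bin Shl (Cst 1) $25)
                          ($rW -' $25)) ;;
     Asg rOut (Fetch ($rREV +' $rOut %' Bin Shl (Cst 1) $26)))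
    (Asg rOut (Cst 0)).

(* [rRes] := the place of the suffix [rP] with respect to the pattern [rI]. *)
Definition compare : cmd :=
  Asg 34 ($rP -' Cst 1 +' $rM) ;;
  Asg rBase (Cst 0) ;;
  Asg rLen $34 ;;
  Ite $rN $34 (Asg rLen $rN) Skip ;;
  Asg rRes (Cst 1) ;;
  Asg 33 (Cst 0) ;;
  While $33 $rE
    (Asg rPos ($rP -' Cst 1 +' $33 *' $rH) ;;
     get_digit ;;
     Asg 24 (Fetch ($rDIG +' $rI *' $rE +' $33)) ;;
     Ite (Cst 0) $rRes
       (Ite $rRes (Cst 2)
          (Ite $rOut $24 (Asg rRes (Cst 0))
             (Ite $24 $rOut (Asg rRes (Cst 2)) Skip))
          Skip)
       Skip ;;
     Asg 33 ($33 +' Cst 1)) ;;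
  Ite (Cst 0) $rRes
    (Ite $rRes (Cst 2) (Ite $rN $34 (Asg rRes (Cst 0)) Skip) Skip)
    Skip.

(* The constant [H] makes the number [2 ^ (w / H)] of buckets sublinear. *)
Definition setup (H : nat) : cmd :=
  Asg rH ($rW /' Cst H) ;;
  Asg rB (Bin Shl (Cst 1) $rH) ;;
  Asg rHB ($rB /' Cst 2) ;;
  Asg rK1 ($rK +' Cst 1) ;;
  Asg rE (($rM +' $rH -' Cst 1) /' $rH) ;;
  Asg rEW (($rM +' $rW -' Cst 1) /' $rW) ;;
  Asg rNT (($rN +' $rW -' Cst 1) /' $rW) ;;
  Asg rREV ($rNT +' $rK *' $rEW) ;;
  Asg rDIG ($rREV +' $rB) ;;
  Asg rORD ($rDIG +' $rK *' $rE) ;;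
  Asg rLO ($rORD +' $rK) ;;
  Asg rSM ($rLO +' $rK) ;;
  Asg rBK ($rSM +' $rN +' Cst 1).

(** Entries come from [rv_half] in increasing order. Entry 0 is computed from itself, so its cell
    has to be 0 at the start. *)
Definition rev_table : cmd :=
  Asg 40 (Cst 0) ;;
  While $40 $rB
    (Sto ($rREV +' $40)
         (Fetch ($rREV +' $40 /' Cst 2) /' Cst 2 +' $40 %' Cst 2 *' $rHB) ;;
     Asg 40 ($40 +' Cst 1)).

Definition digit_table : cmd :=
  Asg 40 (Cst 0) ;;
  While $40 $rK
    (Sto ($rORD +' $40) $40 ;;
     Asg 41 (Cst 0) ;;
     Asg rBase ($rNT +' $40 *' $rEW) ;;
     Asg rLen $rM ;;
     While $41 $rE
       (Asg rPos ($41 *' $rH) ;;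
        get_digit ;;
        Sto ($rDIG +' $40 *' $rE +' $41) $rOut ;;
        Asg 41 ($41 +' Cst 1)) ;;
     Asg 40 ($40 +' Cst 1)).

(* Bucket [b] of a pass occupies [k + 1] cells, the first of which is its size.
   Every pass uses new cells, which still are 0. *)
Definition push_all : cmd :=
  Asg 41 (Cst 0) ;;
  While $41 $rK
    (Asg 42 (Fetch ($rORD +' $41)) ;;
     Asg 43 (Fetch ($rDIG +' $42 *' $rE +' ($rE -' Cst 1 -' $40))) ;;
     Asg 44 ($46 +' $43 *' $rK1) ;;
     Asg 45 (Fetch $44) ;;
     Sto ($44 +' Cst 1 +' $45) $42 ;;
     Sto $44 ($45 +' Cst 1) ;;
     Asg 41 ($41 +' Cst 1)).

Definition collect : cmd :=
  Asg 41 (Cst 0) ;;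
  Asg 42 (Cst 0) ;;
  While $42 $rB
    (Asg 44 ($46 +' $42 *' $rK1) ;;
     Asg 43 (Cst 0) ;;
     While $43 (Fetch $44)
       (Sto ($rORD +' $41) (Fetch ($44 +' Cst 1 +' $43)) ;;
        Asg 41 ($41 +' Cst 1) ;;
        Asg 43 ($43 +' Cst 1)) ;;
     Asg 42 ($42 +' Cst 1)).

Definition radix_sort : cmd :=
  Asg 40 (Cst 0) ;;
  While $40 $rE
    (Asg 46 ($rBK +' $40 *' $rB *' $rK1) ;;
     push_all ;;
     collect ;;
     Asg 40 ($40 +' Cst 1)).

Definition sample : cmd :=
  Asg 40 $rW ;;
  Asg 41 $rSM ;;
  While $40 ($rN +' Cst 1)
    (Ask 42 $40 ;;
     Sto $41 $42 ;;
     Asg 40 ($40 +' $rW) ;;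
     Asg 41 ($41 +' Cst 1)).

(** [R41] is the rank of the last sample found before the current pattern, 0 for none, and [R47] the
    address of the next sample. Behind the last sample the default 1 in [rRes] stands for a suffix
    that is not smaller. *)
Definition merge : cmd :=
  Asg 40 (Cst 0) ;;
  Asg 41 (Cst 0) ;;
  Asg 47 $rSM ;;
  While $40 $rK
    (Asg rI (Fetch ($rORD +' $40)) ;;
     Asg rRes (Cst 1) ;;
     Ite ($41 +' $rW) ($rN +' Cst 1) (Asg rP (Fetch $47) ;; compare) Skip ;;
     Ite $rRes (Cst 1)
       (Asg 41 ($41 +' $rW) ;; Asg 47 ($47 +' Cst 1))
       (Sto ($rLO +' $rI) $41 ;; Asg 40 ($40 +' Cst 1))).

(** The step is rounded up so that neither half is longer. A middle beyond [n] counts as a suffix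
    that is not smaller and is not queried. Length 1 is followed by 0, which ends the search. *)
Definition search_round : cmd :=
  Asg 41 (($40 +' Cst 1) /' Cst 2) ;;
  Asg 42 (Cst 0) ;;
  While $42 $rK
    (Asg 43 (Fetch ($rLO +' $42)) ;;
     Asg 43 ($43 +' $41) ;;
     Ite $43 ($rN +' Cst 1)
       (Ask rP $43 ;;
        Asg rI $42 ;;
        compare ;;
        Ite $rRes (Cst 1)
          (Sto ($rLO +' $42) $43)
          (Ite $rRes (Cst 2) (Asg rAns (Cst 1)) Skip))
       Skip ;;
     Asg 42 ($42 +' Cst 1)) ;;
  Ite (Cst 1) $40 (Asg 40 $41) (Asg 40 (Cst 0)).

(* In each round the first suffix that is not smaller than the pattern [i] is
   in the interval of length [R40] that follows [LO[i]]; the round with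
   [R40 = 1] queries it. *)
Definition search : cmd :=
  Asg rAns (Cst 0) ;;
  Asg 40 $rW ;;
  While (Cst 0) $40 search_round.

Definition dictionary_matching (H : nat) : cmd :=
  setup H ;; rev_table ;; digit_table ;; radix_sort ;; sample ;; merge ;; search.

(** * Specification of the phases, for an arbitrary oracle with answers in [[1..n]] *)

Section Algorithm.
Variables (H w k m : nat) (T : list bool) (D : list (list bool)).
Let n := length T.
Let h := w / H.
Let B := 2 ^ h.
Let E := (m + h - 1) / h.
Let EW := (m + w - 1) / w.
Let NT := (n + w - 1) / w.
Let REV := NT + k * EW.
Let DIG := REV + B.
Let ORD := DIG + k * E.
Let LO := ORD + k.
Let SM := LO + k.
Let BK := SM + n + 1.
Notation in_range := (in_range n).
Notation in_rounds := (in_rounds w n).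

Hypothesis HDk : length D = k.
Hypothesis HDm : forall p, In p D -> length p = m.
Hypothesis Hk : 1 <= k.
Hypothesis Hm : 1 <= m.
Hypothesis Hh : 1 <= h < w.
(** Dominates the addresses and intermediate sums of the program, so that the absence of overflow is
    mostly left to linear arithmetic. *)
Hypothesis Hsize : BK + E * B * (k + 1) + n + m + 2 * w + H + 2 < 2 ^ w.

Definition Consts (s : state) : Prop :=
  rg s rN = n /\ rg s rW = w /\ rg s rK = k /\ rg s rM = m /\ rg s rH = h /\
  rg s rB = B /\ rg s rE = E /\ rg s rEW = EW /\ rg s rNT = NT /\
  rg s rREV = REV /\ rg s rDIG = DIG /\ rg s rORD = ORD /\ rg s rLO = LO /\
  rg s rSM = SM /\ rg s rBK = BK /\ rg s rHB = B / 2 /\ rg s rK1 = k + 1.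

Ltac consts_of HC :=
  repeat match goal with
  | H : rg _ ?r = _ |- _ =>
      let b := eval compute in (existsb (Nat.eqb r) consts) in
      lazymatch b with true => clear H end
  end;
  pose proof HC as
  (?C0 & ?C1 & ?C2 & ?C3 & ?C5 & ?C6 & ?C7 & ?C8 & ?C9 & ?C10 & ?C11 & ?C12 &
   ?C13 & ?C14 & ?C15 & ?C17 & ?C18).

Lemma same_Consts c s s0 :
  same c s s0 -> forallb (fun r => negb (written c r)) consts = true ->
  Consts s0 -> Consts s.
Proof.
  intros Hs F. rewrite forallb_forall in F.
  assert (G : forall r, In r consts -> rg s r = rg s0 r).
  { intros r Hr. apply Hs, negb_true_iff, F, Hr. }
  unfold Consts. rewrite !G by (cbn; tauto). auto.
Qed.

Definition pat (i : nat) : list bool := nth i D [].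

Lemma pat_length i : i < k -> length (pat i) = m.
Proof. intros Hi. apply HDm, nth_In. lia. Qed.

Lemma E_bounds : m <= E * h < m + h.
Proof.
  unfold E. pose proof (Nat.div_mod (m + h - 1) h ltac:(lia)).
  pose proof (Nat.mod_upper_bound (m + h - 1) h ltac:(lia)). nia.
Qed.

Lemma E_small : E < 2 ^ w.
Proof. pose proof E_bounds. assert (E * 1 <= E * h) by (apply Nat.mul_le_mono_l; lia). lia. Qed.

Lemma B_bounds : 2 <= B < 2 ^ w.
Proof.
  unfold B. split.
  - change 2 with (2 ^ 1) at 1. apply Nat.pow_le_mono_r; lia.
  - apply Nat.pow_lt_mono_r; lia.
Qed.

Definition rev_ok (f : nat -> nat) : Prop :=
  forall x, x < B -> f (REV + x) = rv h x.

Lemma get_digit_spec g s str len pos base :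
  Consts s -> rg s rBase = base -> rg s rLen = len -> rg s rPos = pos ->
  packed w (mm s) base str -> len <= length str -> rev_ok (mm s) ->
  (pos < len -> base + pos / w + 1 < 2 ^ w) -> len < 2 ^ w -> 
  wp w g get_digit
    (fun s' => rg s' rOut = mval h (skipn pos (firstn len str)) /\
       mm s' = mm s /\ qs s' = qs s /\ tk s' = tk s) s.
Proof.
  intros HC R1 R2 R3 HP HL HR HB HT. consts_of HC. unfold get_digit.
  apply wp_ite; [rd; auto|rd; auto| |]; rs; intros L.
  2: { asg1. rewrite skipn_all2, mval_nil by (rewrite length_firstn; lia). auto. }
  specialize (HB L).
  pose proof (Nat.div_mod pos w ltac:(lia)) as DM.
  pose proof (Nat.mod_upper_bound pos w ltac:(lia)) as Hr.
  pose proof B_bounds as HBb.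
  asg.
  asg. 
  asg.
  apply wp_seq.
  (* Near the end fewer than [h] bits remain. Taking only these leaves zeros at the top of the table
     index, which the reversal turns into the padding. *)
  eapply wp_conseq with (Q := fun s' => rg s' 26 = min h (len - pos) /\
    mm s' = mm s /\ qs s' = qs s /\ tk s' = tk s).
  { apply wp_ite; [rd; auto|rd; auto| |]; rs; intros L2.
    - asg1. arith.
    - apply wp_skip. arith. }
  intros s1 Hs (R26 & M1 & Q1 & T1).
  pose proof (same_Consts _ _ _ Hs eq_refl HC) as HC1.
  pose proof (Hs 24 eq_refl) as R24. pose proof (Hs 25 eq_refl) as R25. rd.
  consts_of HC1.
  assert (HA : mm s (base + pos / w) < 2 ^ w).
  { rewrite (HP (pos / w)) by lia. apply word_of_bits_firstn_lt. }
  pose proof (window w (mm s) base str pos (min h (len - pos)) ltac:(lia) HP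
    ltac:(lia) ltac:(lia) ltac:(lia)) as W.
  rewrite <- M1 in HA, W.
  pose proof (window_lt w (pos mod w) (mm s1 (base + pos / w))
    (mm s1 (base + pos / w + 1)) Hr HA) as Hab.
  assert (Hb2 : 2 ^ (pos mod w) <> 0) by (apply Nat.pow_nonzero; lia).
  pose proof (Nat.mod_upper_bound (mm s1 (base + pos / w + 1)) _ Hb2) as Hb.
  assert (Hr2 : 2 ^ (pos mod w) < 2 ^ w) by (apply Nat.pow_lt_mono_r; lia).
  asg.
  set (l := min h (len - pos)) in *.
  assert (Hl2 : 2 ^ l < 2 ^ w) by (apply Nat.pow_lt_mono_r; lia).
  assert (HlB : 2 ^ l <= B) by (apply Nat.pow_le_mono_r; lia).
  pose proof (word_of_bits_firstn_lt l (skipn pos str)) as Hx.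
  rewrite <- W in Hx.
  asg1.
  rewrite M1 in *. rewrite HR, W, rv_word by lia. repeat split; auto.
  rewrite skipn_firstn_comm. set (u := skipn pos str).
  replace (firstn l u) with (firstn h (firstn (len - pos) u))
    by (rewrite firstn_firstn; reflexivity).
  apply mval_firstn.
Qed.

Definition digit_of (i e : nat) : nat := mval h (skipn (e * h) (pat i)).

Definition digits_ok (f : nat -> nat) : Prop :=
  forall i e, i < k -> e < E -> f (DIG + i * E + e) = digit_of i e.

(** The data on which [compare] relies. It lies below [ORD], so later phases, which write from [ORD]
    on, preserve it. *)
Definition static (f : nat -> nat) : Prop :=
  packed w f 0 T /\ rev_ok f /\ digits_ok f.

Lemma digit_addr i e : i < k -> e < E -> DIG + i * E + e < ORD.
Proof. intros Hi He. unfold ORD. pose proof (mul_succ_le i k E Hi). lia. Qed.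

Lemma text_addr q : q * w < n -> q < NT.
Proof. intros L. apply div_up_gt; lia. Qed.

Lemma static_ext f f' :
  (forall a, a < ORD -> f' a = f a) -> static f -> static f'.
Proof.
  intros X (H1 & H2 & H3). repeat split.
  - intros q Hq. pose proof (text_addr q Hq). rewrite X by lia. now apply H1.
  - intros x Hx. rewrite X by lia. now apply H2.
  - intros i e Hi He. pose proof (digit_addr i e Hi He).
    rewrite X by lia. now apply H3.
Qed.

Lemma compare_spec g s p i :
  Consts s -> static (mm s) -> rg s rP = p -> rg s rI = i ->
  1 <= p <= n -> i < k ->
  wp w g compare
    (fun s' => rg s' rRes = place (E * h) (pat i) (suffix T p) /\
       mm s' = mm s /\ qs s' = qs s /\ tk s' = tk s + E) s.
Proof.
  intros HC (HT & HR & HD) R1 R2 Hp Hi. consts_of HC. unfold compare.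
  pose proof E_bounds as HE.
  asg. asg. asg.
  apply wp_seq.
  (* The window stops after [m] bits, so the digit in which the pattern ends is padded with zeros on
     both sides of the comparison. *)
  eapply wp_conseq with (Q := fun s' => rg s' rLen = min n (p - 1 + m) /\
    mm s' = mm s /\ qs s' = qs s /\ tk s' = tk s).
  { apply wp_ite; [rd; auto|rd; auto| |]; rs; intros L2.
    - asg1. arith.
    - apply wp_skip. arith. }
  intros s1 Hs (R21 & M1 & Q1 & T1).
  pose proof (same_Consts _ _ _ Hs eq_refl HC) as HC1.
  pose proof (Hs rBase eq_refl) as R20. pose proof (Hs 34 eq_refl) as R34.
  pose proof (Hs rP eq_refl) as R30. pose proof (Hs rI eq_refl) as R31. rd.
  rewrite R1 in R30. rewrite R2 in R31.
  clear Hs.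
  consts_of HC1.
  asg. asg.
  set (u := firstn m (suffix T p)).
  apply wp_seq.
  match goal with |- wp _ _ _ _ ?st => set (s2 := st) end.
  apply wp_for with (N := E) (I := fun e s' => rg s' 33 = e /\
    rg s' rRes = cmp3 (mval (e * h) u) (mval (e * h) (pat i)) /\
    mm s' = mm s /\ qs s' = qs s /\ tk s' = tk s + e).
  - unfold s2. rs. repeat split; auto. lia.
  - intros e s3 He (R33 & R32 & M3 & Q3 & T3) Hs.
    pose proof (same_Consts _ _ s2 Hs eq_refl HC1) as HC3.
    pose proof (Hs rBase eq_refl) as R20'. pose proof (Hs rLen eq_refl) as R21'.
    pose proof (Hs rP eq_refl) as R30'. pose proof (Hs rI eq_refl) as R31'.
    unfold s2 in R20', R21', R30', R31'. rd.
    rewrite R20 in R20'. rewrite R21 in R21'. rewrite R30 in R30'.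
    rewrite R31 in R31'.
    clear Hs s2.
    consts_of HC3. rs. repeat split; try lia.
    pose proof (mul_succ_le e E h He).
    asg.
    apply wp_seq.
    eapply wp_conseq.
    { eapply get_digit_spec with (str := T); rd; try eassumption; try reflexivity.
      - rewrite M3. exact HT.
      - fold n. lia.
      - rewrite M3. exact HR.
      - intros L.
        assert ((p - 1 + e * h) / w < NT).
        { apply text_addr.
          pose proof (Nat.Div0.mul_div_le (p - 1 + e * h) w). lia. }
        lia.
      - lia. }
    intros s4 Hs (R23 & M4 & Q4 & T4). rd.
    pose proof (same_Consts _ _ _ Hs eq_refl HC3) as HC4.
    pose proof (Hs rI eq_refl) as R31b. pose proof (Hs 33 eq_refl) as R33b.
    pose proof (Hs rRes eq_refl) as R32b. rd.
    rewrite R31' in R31b. rewrite R33 in R33b. rewrite R32 in R32b.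
    clear Hs.
    consts_of HC4.
    pose proof (digit_addr i e Hi He).
    assert (i * E < ORD) by lia.
    asg. rewrite M4, M3, HD by auto.
    assert (Y : cmp3 (mval (S e * h) u) (mval (S e * h) (pat i)) =
      let x := mval h (skipn (p - 1 + e * h) (firstn (min n (p - 1 + m)) T)) in
      if cmp3 (mval (e * h) u) (mval (e * h) (pat i)) =? 1
      then cmp3 x (digit_of i e)
      else cmp3 (mval (e * h) u) (mval (e * h) (pat i))).
    { replace (S e * h) with (e * h + h) by lia.
      rewrite !mval_add, cmp3_digit by apply mval_lt.
      cbn zeta. unfold digit_of.
      replace (skipn (p - 1 + e * h) (firstn (min n (p - 1 + m)) T))
        with (skipn (e * h) u); [reflexivity|].
      rewrite Nat.add_comm, <- skipn_skipn. f_equal.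
      unfold u, suffix. rewrite skipn_firstn_comm.
      destruct (Nat.le_ge_cases n (p - 1 + m)).
      - rewrite !firstn_all2; auto; rewrite length_skipn; fold n; lia.
      - f_equal. lia. }
    cbn zeta in Y. rewrite <- R23 in Y.
    set (y := digit_of i e) in *. set (x := rg s4 rOut) in *.
    set (cc := cmp3 (mval (e * h) u) (mval (e * h) (pat i))) in *.
    apply wp_seq.
    eapply wp_conseq with (Q := fun s' =>
      rg s' rRes = cmp3 (mval (S e * h) u) (mval (S e * h) (pat i)) /\
      rg s' 33 = e /\ mm s' = mm s /\ qs s' = qs s /\ tk s' = tk s + S e).
    { rewrite Y. assert (cc <= 2).
      { unfold cc, cmp3. repeat destruct (_ <? _); lia. }
      unfold cmp3.
      apply wp_ite; [arith|arith| |]; rs; intros L1.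
      - apply wp_ite; [arith|arith| |]; rs; intros L2.
        + replace cc with 1 by lia. cbn [Nat.eqb].
          apply wp_ite; [arith|arith| |]; rs; fold x; intros L3.
          * asg1. rewrite (proj2 (Nat.ltb_lt _ _)) by exact L3.
            arith; congruence.
          * rewrite (proj2 (Nat.ltb_ge _ _)) by exact L3.
            apply wp_ite; [arith|arith| |]; rs; fold x; intros L4.
            -- asg1. rewrite (proj2 (Nat.ltb_lt _ _)) by exact L4.
               arith; congruence.
            -- apply wp_skip. rewrite (proj2 (Nat.ltb_ge _ _)) by exact L4.
               arith; try congruence.
        + apply wp_skip. replace cc with 2 by lia. cbn [Nat.eqb].
          arith; try congruence.
      - apply wp_skip. replace cc with 0 by lia. cbn [Nat.eqb].
        arith; try congruence. }
    intros s5 Hs (R32c & R33c & M5 & Q5 & T5).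
    asg1. repeat split; auto; lia.
  - intros s3 (R33 & R32 & M3 & Q3 & T3) Hs.
    pose proof (same_Consts _ _ s2 Hs eq_refl HC1) as HC3.
    pose proof (Hs 34 eq_refl) as R34'. unfold s2 in R34'. rd.
    rewrite R34 in R34'.
    clear Hs s2.
    consts_of HC3. rs. repeat split; try lia.
    assert (LS : length (suffix T p) = n - (p - 1)) by apply suffix_length.
    assert (LP : length (pat i) = m) by (apply pat_length; exact Hi).
    (* The padded keys may agree although the suffix is too short; [n < p - 1 + m] detects this and
       reproduces the tie rule of [place]. *)
    assert (HZ : place (E * h) (pat i) (suffix T p) =
      let cc := cmp3 (mval (E * h) u) (mval (E * h) (pat i)) in
      if cc =? 1 then (if n <? p - 1 + m then 0 else 1) else cc).
    { unfold place, cmp3. rewrite LP, LS. fold u. cbn zeta.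
      repeat match goal with
         | |- context [?x <? ?y] => destruct (Nat.ltb_spec x y)
         end; cbn [Nat.eqb]; try reflexivity; lia. }
    cbn zeta in HZ. rewrite HZ.
    set (cc := cmp3 (mval (E * h) u) (mval (E * h) (pat i))) in *.
    assert (cc <= 2).
    { unfold cc, cmp3. repeat destruct (_ <? _); lia. }
    apply wp_ite; [arith|arith| |]; rs; intros L1.
    + apply wp_ite; [arith|arith| |]; rs; intros L2.
      * replace cc with 1 by lia. cbn [Nat.eqb].
        apply wp_ite; [arith|arith| |]; rs; intros L3.
        -- asg1. rewrite (proj2 (Nat.ltb_lt _ _)) by exact L3.
           arith; congruence.
        -- apply wp_skip. rewrite (proj2 (Nat.ltb_ge _ _)) by exact L3.
           arith; try congruence.
      * apply wp_skip. replace cc with 2 by lia. cbn [Nat.eqb].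
        arith; try congruence.
    + apply wp_skip. replace cc with 0 by lia. cbn [Nat.eqb].
      arith; try congruence.
Qed.

Lemma setup_spec g s : 1 <= H ->
  rg s rN = n -> rg s rW = w -> rg s rK = k -> rg s rM = m ->
  wp w g (setup H) (fun s' => Consts s' /\ mm s' = mm s /\ qs s' = qs s /\
    tk s' = tk s) s.
Proof.
  intros HH R0 R1 R2 R3. unfold setup.
  assert (DL : forall x y, x / y <= x).
  { intros x y. destruct y; [apply Nat.le_0_l|].
    apply Nat.Div0.div_le_upper_bound. nia. }
  pose proof B_bounds as HB.
  asg; try (apply Nat.le_lt_trans with w; [apply DL|lia]). fold h.
  asg; try (fold B; lia). fold B.
  asg; try (pose proof (DL B 2); lia).
  asg.
  asg; try (pose proof (DL (m + h - 1) h); lia). fold E.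
  asg; try (pose proof (DL (m + w - 1) w); lia). fold EW.
  asg; try (pose proof (DL (n + w - 1) w); lia). fold NT.
  asg; try (fold REV; lia). fold REV.
  asg. fold DIG.
  asg; try (unfold ORD in *; lia). fold ORD.
  asg. fold LO. asg. fold SM. asg1. fold BK.
  unfold Consts. rs. repeat split; auto.
Qed.

Lemma rev_table_spec g s : Consts s -> (forall a, REV <= a -> mm s a = 0) ->
  wp w g rev_table (fun s' => Consts s' /\ rev_ok (mm s') /\
    (forall a, a < REV \/ DIG <= a -> mm s' a = mm s a) /\
    qs s' = qs s /\ tk s' = tk s + B) s.
Proof.
  intros HC HZ. consts_of HC. unfold rev_table. pose proof B_bounds as HB.
  assert (HB2 : B / 2 = 2 ^ (h - 1)).
  { unfold B. replace h with (S (h - 1)) at 1 by lia.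
    rewrite Nat.pow_succ_r', Nat.mul_comm. apply Nat.div_mul. lia. }
  asg.
  match goal with |- wp _ _ _ _ ?st => set (s1 := st) end.
  apply wp_for with (N := B) (I := fun i s' => rg s' 40 = i /\
    (forall x, x < i -> mm s' (REV + x) = rv h x) /\
    (forall a, a < REV \/ REV + i <= a -> mm s' a = mm s a) /\
    qs s' = qs s /\ tk s' = tk s + i).
  - unfold s1. rs. repeat split; auto; lia.
  - intros i s2 Hi (R40 & M & MF & Q2 & T2) Hs.
    pose proof (same_Consts _ _ s1 Hs eq_refl HC) as HC2.
    clear Hs s1.
    consts_of HC2.
    assert (X : mm s2 (REV + i / 2) = rv h (i / 2)).
    (* Entry 0 reads the very cell about to be written, still 0, which equals [rv h 0]; every other
       entry reads one already filled. *)
    { destruct (Nat.eq_dec i 0) as [->|N].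
      - change (0 / 2) with 0. rewrite MF, HZ by lia.
        change 0 with (word_of_bits []) at 2. now rewrite rv_word, mval_nil.
      - apply M. apply Nat.div_lt; lia. }
    pose proof (rv_half h i ltac:(lia) Hi) as RH.
    pose proof (rv_lt h (i / 2)) as R1. fold B in R1.
    pose proof (rv_lt h i) as R2. fold B in R2.
    pose proof (Nat.mod_upper_bound i 2 ltac:(lia)).
    assert (i / 2 <= i) by (apply Nat.Div0.div_le_upper_bound; lia).
    assert (rv h (i / 2) / 2 <= rv h (i / 2))
      by (apply Nat.Div0.div_le_upper_bound; lia).
    assert (i mod 2 * (B / 2) <= 1 * (B / 2)) by (apply Nat.mul_le_mono_r; lia).
    arith.
    apply wp_seq, wp_sto; [arith|arith|]; rs; rewrite ?X; try lia.
    rewrite HB2, <- RH.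
    asg1.
    arith.
    + intros x Hx. destruct (Nat.eqb_spec (REV + x) (REV + i)).
      * f_equal. lia.
      * apply M. lia.
    + intros a Ha. destruct (Nat.eqb_spec a (REV + i)); [lia|].
      apply MF. lia.
  - intros s2 (R40 & M & MF & Q2 & T2) Hs.
    pose proof (same_Consts _ _ s1 Hs eq_refl HC) as HC2.
    clear Hs s1.
    consts_of HC2. arith; auto.
Qed.

Lemma digit_table_spec g s : Consts s -> packed w (mm s) 0 T ->
  (forall i, i < k -> packed w (mm s) (NT + i * EW) (pat i)) ->
  rev_ok (mm s) ->
  wp w g digit_table (fun s' => Consts s' /\ static (mm s') /\
    (forall i, i < k -> mm s' (ORD + i) = i) /\
    (forall a, LO <= a -> mm s' a = mm s a) /\
    qs s' = qs s /\ tk s' = tk s + k * (E + 1)) s.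
Proof.
  intros HC HT HP HR. consts_of HC. unfold digit_table.
  pose proof B_bounds as HB. pose proof E_bounds as HE.
  asg.
  match goal with |- wp _ _ _ _ ?st => set (s1 := st) end.
  apply wp_for with (N := k) (I := fun i s' => rg s' 40 = i /\
    (forall i' e, i' < i -> e < E -> mm s' (DIG + i' * E + e) = digit_of i' e) /\
    (forall i', i' < i -> mm s' (ORD + i') = i') /\
    (forall a, a < DIG \/ LO <= a -> mm s' a = mm s a) /\
    qs s' = qs s /\ tk s' = tk s + i * (E + 1)).
  - unfold s1. rs. repeat split; auto; lia.
  - intros i s2 Hi (R40 & M & MO & MF & Q2 & T2) Hs.
    pose proof (same_Consts _ _ s1 Hs eq_refl HC) as HC2.
    clear Hs s1.
    consts_of HC2.
    assert (NT + i * EW + EW <= REV)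
      by (pose proof (mul_succ_le i k EW Hi); unfold REV; lia).
    assert (OB : ORD + k <= LO) by (unfold LO; lia).
    arith.
    apply wp_seq, wp_sto; [arith|arith|]; rs.
    asg. asg. asg.
    apply wp_seq.
    match goal with |- wp _ _ _ _ ?st => set (s3 := st) end.
    apply wp_for with (N := E) (I := fun e s' => rg s' 41 = e /\
      (forall i' e, i' < i -> e < E -> mm s' (DIG + i' * E + e) = digit_of i' e) /\
      (forall e', e' < e -> mm s' (DIG + i * E + e') = digit_of i e') /\
      (forall i', i' < S i -> mm s' (ORD + i') = i') /\
      (forall a, a < DIG \/ LO <= a -> mm s' a = mm s a) /\
      qs s' = qs s /\ tk s' = S (tk s + i * (E + 1)) + e).
    + unfold s3. rs. repeat split; auto; try lia.
      * intros i' e Hi' He. pose proof (digit_addr i' e ltac:(lia) He).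
        destruct (Nat.eqb_spec (DIG + i' * E + e) (ORD + i)); [lia|auto].
      * intros i' Hi'.
        destruct (Nat.eqb_spec (ORD + i') (ORD + i)); [lia|apply MO; lia].
      * intros a Ha. destruct (Nat.eqb_spec a (ORD + i)); [lia|auto].
    + intros e s4 He (R41 & N1 & N2 & N3 & NF & Q4 & T4) Hs.
      pose proof (same_Consts _ _ s3 Hs eq_refl HC2) as HC4.
      pose proof (Hs 40 eq_refl) as R40'. pose proof (Hs rBase eq_refl) as R20.
      pose proof (Hs rLen eq_refl) as R21. unfold s3 in R40', R20, R21. rd.
      rewrite R40 in R40'.
      clear Hs s3.
      consts_of HC4.
      pose proof (mul_succ_le e E h He).
      arith. asg.
      apply wp_seq.
      eapply wp_conseq.
      { eapply get_digit_spec with (str := pat i); rd; try eassumption;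
          try reflexivity.
        - intros q Hq. rewrite NF; [apply HP; auto|].
          left. rewrite pat_length in Hq by lia.
          assert (q < EW) by (apply div_up_gt; lia). lia.
        - rewrite pat_length; lia.
        - intros x Hx. rewrite NF by lia. auto.
        - intros L. assert (e * h / w < EW); [|lia]. apply div_up_gt; [lia|].
          pose proof (Nat.Div0.mul_div_le (e * h) w). lia.
        - lia. }
      intros s5 Hs (R23 & M5 & Q5 & T5). rd.
      pose proof (same_Consts _ _ _ Hs eq_refl HC4) as HC5.
      pose proof (Hs 40 eq_refl) as R40b. pose proof (Hs 41 eq_refl) as R41b. rd.
      rewrite R40' in R40b. rewrite R41 in R41b.
      clear Hs.
      consts_of HC5.
      pose proof (digit_addr i e Hi He) as DA.
      rewrite firstn_all2 in R23 by (rewrite pat_length; lia).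
      change (rg s5 23 = digit_of i e) in R23.
      apply wp_seq, wp_sto; [arith|arith|]; rs.
      asg1. rewrite M5 in *. arith; try congruence.
      * intros i' e' Hi' He'.
        destruct (Nat.eqb_spec (DIG + i' * E + e') (DIG + i * E + e)); [|auto].
        (* Digit indices are below [E], so different pairs of pattern and index have different
           cells. *)
        pose proof (mul_add_inj E i' i e' e). lia.
      * intros e' He'.
        destruct (Nat.eqb_spec (DIG + i * E + e') (DIG + i * E + e)).
        -- f_equal. lia.
        -- apply N2. lia.
      * intros i' Hi'.
        destruct (Nat.eqb_spec (ORD + i') (DIG + i * E + e)); [lia|auto].
      * intros a Ha.
        destruct (Nat.eqb_spec a (DIG + i * E + e)); [lia|auto].
    + intros s4 (R41 & N1 & N2 & N3 & NF & Q4 & T4) Hs.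
      pose proof (same_Consts _ _ s3 Hs eq_refl HC2) as HC4.
      pose proof (Hs 40 eq_refl) as R40'. unfold s3 in R40'. rd.
      rewrite R40 in R40'.
      clear Hs s3.
      consts_of HC4. arith. asg1. arith; auto.
      intros i' e Hi' He. destruct (Nat.eq_dec i' i) as [->|]; auto.
      apply N1; lia.
  - intros s2 (R40 & M & MO & MF & Q2 & T2) Hs.
    pose proof (same_Consts _ _ s1 Hs eq_refl HC) as HC2.
    clear Hs s1.
    consts_of HC2. arith; auto.
    + intros q Hq. rewrite MF; [auto|]. pose proof (text_addr q Hq).
      assert (NT <= REV) by (unfold REV; lia). lia.
    + intros x Hx. rewrite MF by lia. auto.
Qed.

(** Start of the bucket area of pass [e]; different passes have disjoint areas. *)
Definition PB (e : nat) : nat := BK + e * B * (k + 1).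

Lemma PB_S e : PB (S e) = PB e + B * (k + 1).
Proof. unfold PB. lia. Qed.

Lemma PB_bound e : e < E -> BK <= PB e /\ PB (S e) <= BK + E * B * (k + 1).
Proof.
  intros He. split; [unfold PB; lia|]. unfold PB.
  apply Nat.add_le_mono_l, Nat.mul_le_mono_r, Nat.mul_le_mono_r. exact He.
Qed.

Definition ord_is (f : nat -> nat) (L : list nat) : Prop :=
  length L = k /\ forall p, p < k -> f (ORD + p) = nth p L 0.

Definition buckets_at (f : nat -> nat) (e : nat) (bk : nat -> list nat) : Prop :=
  forall b, b < B ->
    f (PB e + b * (k + 1)) = length (bk b) /\
    forall c, c < length (bk b) ->
      f (PB e + b * (k + 1) + 1 + c) = nth c (bk b) 0.

Lemma bucket_length f L b : length (bucket f L b) <= length L.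
Proof. apply filter_length_le. Qed.

Lemma push_all_spec g s e L :
  Consts s -> static (mm s) -> rg s 40 = e -> e < E -> rg s 46 = PB e ->
  ord_is (mm s) L -> (forall x, In x L -> x < k) ->
  (forall a, PB e <= a -> mm s a = 0) ->
  wp w g push_all (fun s' => Consts s' /\
    buckets_at (mm s') e (bucket (fun i => digit_of i (E - 1 - e)) L) /\
    (forall a, a < PB e \/ PB (S e) <= a -> mm s' a = mm s a) /\
    qs s' = qs s /\ tk s' = tk s + k) s.
Proof.
  intros HC HS R40 He R46 [HL HO] HLk HZ. consts_of HC. unfold push_all.
  pose proof (PB_bound e He) as [HP1 HP2]. rewrite PB_S in HP2.
  asg.
  match goal with |- wp _ _ _ _ ?st => set (s1 := st) end.
  set (f := fun i => digit_of i (E - 1 - e)).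
  assert (HfB : forall x, f x < B) by (intros; apply mval_lt).
  apply wp_for with (N := k) (I := fun p s' => rg s' 41 = p /\
    buckets_at (mm s') e (bucket f (firstn p L)) /\
    (forall a, a < PB e \/ PB (S e) <= a -> mm s' a = mm s a) /\
    qs s' = qs s /\ tk s' = tk s + p).
  (* A fresh area is 0 everywhere, which already encodes empty buckets. *)
  - unfold s1. rs. repeat split; auto; try lia.
    + rewrite HZ by lia. reflexivity.
    + cbn. lia.
  - intros p s2 Hp (R41 & HBk & MF & Q2 & T2) Hs.
    pose proof (same_Consts _ _ s1 Hs eq_refl HC) as HC2.
    pose proof (Hs 40 eq_refl) as R40'. pose proof (Hs 46 eq_refl) as R46'.
    unfold s1 in R40', R46'. rd. rewrite R40 in R40'. rewrite R46 in R46'.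
    clear Hs s1.
    consts_of HC2.
    set (x := nth p L 0) in *.
    assert (Hx : x < k) by (apply HLk, nth_In; lia).
    assert (Mx : mm s2 (ORD + p) = x) by (rewrite MF by lia; auto).
    assert (Hd : mm s2 (DIG + x * E + (E - 1 - e)) = f x).
    { rewrite MF by (pose proof (digit_addr x (E - 1 - e) Hx ltac:(lia)); lia).
      apply HS; lia. }
    pose proof (digit_addr x (E - 1 - e) Hx ltac:(lia)) as DA.
    pose proof (HfB x) as Hfx.
    pose proof (mul_succ_le (f x) B (k + 1) Hfx) as Hd2.
    destruct (HBk (f x) Hfx) as [HB1 _].
    assert (Hc : length (bucket f (firstn p L) (f x)) <= p).
    { etransitivity; [apply bucket_length|apply firstn_le_length]. }
    set (c := length (bucket f (firstn p L) (f x))) in *.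
    assert (HPB : PB e + B * (k + 1) < 2 ^ w) by lia.
    pose proof E_small.
    assert (x * E <= DIG + x * E + (E - 1 - e)) by lia.
    arith.
    asg. rewrite Mx.
    asg. rewrite Hd.
    asg.
    asg. rewrite HB1.
    apply wp_seq, wp_sto; [arith|arith|]; rs.
    apply wp_seq, wp_sto; [arith|arith|]; rs.
    (* Appending at the end of a bucket is what makes the machine's pass stable. *)
    assert (Hbk : forall b, bucket f (firstn (S p) L) b =
      bucket f (firstn p L) b ++ (if f x =? b then [x] else [])).
    { intros b. rewrite (firstn_S_nth _ 0) by lia. unfold bucket.
      rewrite filter_app. reflexivity. }
    asg1. rewrite PB_S in *. split; [lia|]. split; [|arith].
    + intros b Hb. destruct (HBk b Hb) as [G1 G2]. rewrite Hbk. cbn [upd].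
      destruct (Nat.eqb_spec (f x) b) as [<-|Hne].
      * rewrite length_app. fold c. rewrite Nat.eqb_refl.
        split; [reflexivity|]. intros c' Hc'. cbn [length] in Hc'.
        destruct (Nat.eqb_spec (PB e + f x * (k + 1) + 1 + c') (PB e + f x * (k + 1)));
          [lia|].
        destruct (Nat.eqb_spec (PB e + f x * (k + 1) + 1 + c')
                    (PB e + f x * (k + 1) + 1 + c)).
        -- replace c' with c by lia. unfold c. now rewrite nth_middle.
        -- rewrite app_nth1 by (unfold c in *; lia). apply G2. fold c; lia.
      * rewrite app_nil_r.
        assert (Hl : length (bucket f (firstn p L) b) <= p).
        { etransitivity; [apply bucket_length|apply firstn_le_length]. }
        (* A bucket holds at most [k] entries behind its size cell, so its offsets stay within its
           own [k + 1] cells. *)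
        assert (Hdis : forall u v, u <= k -> v <= k ->
          b * (k + 1) + u <> f x * (k + 1) + v).
        { intros u v Hu Hv Huv.
          apply mul_add_inj in Huv; lia. }
        split.
        -- destruct (Nat.eqb_spec (PB e + b * (k + 1)) (PB e + f x * (k + 1))).
           { specialize (Hdis 0 0). lia. }
           destruct (Nat.eqb_spec (PB e + b * (k + 1))
                       (PB e + f x * (k + 1) + 1 + c)).
           { specialize (Hdis 0 (1 + c)). lia. }
           exact G1.
        -- intros c' Hc'.
           destruct (Nat.eqb_spec (PB e + b * (k + 1) + 1 + c')
                       (PB e + f x * (k + 1))).
           { specialize (Hdis (1 + c') 0). lia. }
           destruct (Nat.eqb_spec (PB e + b * (k + 1) + 1 + c')
                       (PB e + f x * (k + 1) + 1 + c)).
           { specialize (Hdis (1 + c') (1 + c)). lia. }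
           auto.
    + intros a Ha.
      destruct (Nat.eqb_spec a (PB e + f x * (k + 1))); [lia|].
      destruct (Nat.eqb_spec a (PB e + f x * (k + 1) + 1 + c)); [lia|auto].
  - intros s2 (R41 & HBk & MF & Q2 & T2) Hs.
    pose proof (same_Consts _ _ s1 Hs eq_refl HC) as HC2.
    clear Hs s1.
    rewrite firstn_all2 in HBk by lia. consts_of HC2.
    rs. split; [auto|]. split; [auto|]. split; [lia|]. auto.
Qed.

Lemma flat_map_seq_S (bk : nat -> list nat) b :
  flat_map bk (seq 0 (S b)) = flat_map bk (seq 0 b) ++ bk b.
Proof.
  rewrite seq_S, flat_map_app. cbn [flat_map Nat.add]. now rewrite app_nil_r.
Qed.

Lemma flat_map_seq_le (bk : nat -> list nat) b b' : b <= b' ->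
  length (flat_map bk (seq 0 b)) <= length (flat_map bk (seq 0 b')).
Proof.
  induction 1 as [|b' _ IH]; [lia|]. rewrite flat_map_seq_S, length_app. lia.
Qed.

(** The inner loops make [k] iterations in total, as the buckets hold [k] entries altogether; this
    keeps the cost at [B + k] instead of a product. *)
Lemma collect_spec g s e bk :
  Consts s -> rg s 46 = PB e -> e < E -> buckets_at (mm s) e bk ->
  length (flat_map bk (seq 0 B)) = k ->
  wp w g collect (fun s' => Consts s' /\
    ord_is (mm s') (flat_map bk (seq 0 B)) /\
    (forall a, a < ORD \/ LO <= a -> mm s' a = mm s a) /\
    qs s' = qs s /\ tk s' = tk s + B + k) s.
Proof.
  intros HC R46 He HBk HL. consts_of HC. unfold collect.
  pose proof (PB_bound e He) as [HP1 HP2]. rewrite PB_S in HP2.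
  set (F := fun b => flat_map bk (seq 0 b)).
  asg. asg.
  match goal with |- wp _ _ _ _ ?st => set (s1 := st) end.
  apply wp_for with (N := B) (I := fun b s' => rg s' 42 = b /\
    rg s' 41 = length (F b) /\
    (forall p, p < length (F b) -> mm s' (ORD + p) = nth p (F b) 0) /\
    (forall a, a < ORD \/ LO <= a -> mm s' a = mm s a) /\
    qs s' = qs s /\ tk s' = tk s + b + length (F b)).
  - unfold s1. rs. cbn. repeat split; auto; lia.
  - intros b s2 Hb (R42 & R41 & MO & MF & Q2 & T2) Hs.
    pose proof (same_Consts _ _ s1 Hs eq_refl HC) as HC2.
    pose proof (Hs 46 eq_refl) as R46'. unfold s1 in R46'. rd. rewrite R46 in R46'.
    clear Hs s1.
    consts_of HC2.
    pose proof (mul_succ_le b B (k + 1) Hb) as Hb2.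
    destruct (HBk b Hb) as [G1 G2].
    assert (HF : F (S b) = F b ++ bk b) by apply flat_map_seq_S.
    assert (HFk : length (F (S b)) <= k).
    { rewrite <- HL. apply flat_map_seq_le. exact Hb. }
    rewrite HF, length_app in HFk.
    set (l := length (bk b)) in *.
    assert (HPB : PB e + B * (k + 1) < 2 ^ w) by lia.
    arith.
    asg. asg.
    apply wp_seq.
    match goal with |- wp _ _ _ _ ?st => set (s3 := st) end.
    apply wp_for with (N := l) (I := fun c s' => rg s' 43 = c /\
      rg s' 41 = length (F b) + c /\
      (forall p, p < length (F b) + c ->
         mm s' (ORD + p) = nth p (F b ++ bk b) 0) /\
      (forall a, a < ORD \/ LO <= a -> mm s' a = mm s a) /\
      qs s' = qs s /\ tk s' = S (tk s + b + length (F b)) + c).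
    + unfold s3. rs. repeat split; auto; try lia.
      intros p Hp. rewrite app_nth1 by lia. apply MO. lia.
    + intros c s4 Hc (R43 & R41b & NO & NF & Q4 & T4) Hs.
      pose proof (same_Consts _ _ s3 Hs eq_refl HC2) as HC4.
      pose proof (Hs 44 eq_refl) as R44. unfold s3 in R44. rd.
      clear Hs s3.
      consts_of HC4. rs.
      assert (N1 : mm s4 (PB e + b * (k + 1)) = l) by (rewrite NF by lia; auto).
      assert (N2 : mm s4 (PB e + b * (k + 1) + 1 + c) = nth c (bk b) 0)
        by (rewrite NF by lia; auto).
      rewrite N1. arith.
      apply wp_seq, wp_sto; [arith|arith|]; rs. rewrite N2.
      asg. asg1. arith.
      * intros p Hp. destruct (Nat.eqb_spec (ORD + p) (ORD + (length (F b) + c))).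
        -- rewrite app_nth2 by lia. f_equal. lia.
        -- apply NO. lia.
      * intros a Ha.
        destruct (Nat.eqb_spec a (ORD + (length (F b) + c))); [lia|auto].
    + intros s4 (R43 & R41b & NO & NF & Q4 & T4) Hs.
      pose proof (same_Consts _ _ s3 Hs eq_refl HC2) as HC4.
      pose proof (Hs 44 eq_refl) as R44. pose proof (Hs 42 eq_refl) as R42b.
      unfold s3 in R44, R42b. rd. rewrite R42 in R42b.
      clear Hs s3.
      consts_of HC4. rs.
      assert (N1 : mm s4 (PB e + b * (k + 1)) = l) by (rewrite NF by lia; auto).
      rewrite N1. arith.
      pose proof B_bounds.
      asg1. rewrite HF, length_app. fold l. arith.
  - intros s2 (R42 & R41 & MO & MF & Q2 & T2) Hs.
    pose proof (same_Consts _ _ s1 Hs eq_refl HC) as HC2.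
    clear Hs s1.
    fold (F B) in HL |- *. rewrite HL in *.
    consts_of HC2.
    rs. repeat split; auto; lia.
Qed.

Definition sorted_ids : list nat := radix B E digit_of (seq 0 k) E.

Lemma radix_ids e :
  let L := radix B E digit_of (seq 0 k) e in
  length L = k /\ (forall x, In x L <-> x < k).
Proof.
  assert (P : Permutation (radix B E digit_of (seq 0 k) e) (seq 0 k)).
  { apply radix_perm. intros. apply mval_lt. }
  split.
  - rewrite (Permutation_length P). apply length_seq.
  - intros x. split; intros Hx.
    + apply (Permutation_in _ P), in_seq in Hx. lia.
    + apply (Permutation_in _ (Permutation_sym P)), in_seq. lia.
Qed.

Lemma radix_sort_spec g s :
  Consts s -> static (mm s) -> (forall i, i < k -> mm s (ORD + i) = i) ->
  (forall a, BK <= a -> mm s a = 0) ->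
  wp w g radix_sort (fun s' => Consts s' /\ static (mm s') /\
    ord_is (mm s') sorted_ids /\ qs s' = qs s /\
    tk s' = tk s + E * (1 + k + B + k)) s.
Proof.
  intros HC HS HO HZ. consts_of HC. unfold radix_sort.
  asg.
  match goal with |- wp _ _ _ _ ?st => set (s1 := st) end.
  (* The zero cells from [PB e] on are the empty buckets of the coming passes. *)
  apply wp_for with (N := E) (I := fun e s' => rg s' 40 = e /\
    static (mm s') /\ ord_is (mm s') (radix B E digit_of (seq 0 k) e) /\
    (forall a, PB e <= a -> mm s' a = 0) /\
    qs s' = qs s /\ tk s' = tk s + e * (1 + k + B + k)).
  - unfold s1. rs. split; [reflexivity|]. split; [auto|].
    split; [|repeat split; auto; lia || (intros; apply HZ; unfold PB in *; lia)].
    split; [cbn; apply length_seq|]. intros p Hp. cbn [radix].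
    rewrite seq_nth by lia. auto.
  - intros e s2 He (R40 & HS2 & HO2 & HZ2 & Q2 & T2) Hs.
    pose proof (same_Consts _ _ s1 Hs eq_refl HC) as HC2.
    clear Hs s1.
    consts_of HC2.
    pose proof (PB_bound e He) as [HP1 HP2].
    assert (HeB : e * B * 1 <= e * B * (k + 1))
      by (apply Nat.mul_le_mono_l; lia).
    assert (e * B * (k + 1) <= PB e) by (unfold PB; lia).
    rewrite PB_S in HP2.
    destruct (radix_ids e) as [HL HI].
    arith.
    asg; try (fold (PB e); lia). fold (PB e).
    apply wp_seq.
    eapply wp_conseq.
    { eapply push_all_spec with (e := e); rd; try eassumption; try reflexivity.
      intros x. apply HI. }
    intros s3 Hs (HC3 & HBk & MF3 & Q3 & T3). rd.
    pose proof (Hs 40 eq_refl) as R40b. pose proof (Hs 46 eq_refl) as R46b. rd.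
    rewrite R40 in R40b.
    clear Hs.
    apply wp_seq.
    destruct (radix_ids (S e)) as [HL' HI'].
    eapply wp_conseq.
    { eapply collect_spec with (e := e); eassumption. }
    intros s4 Hs (HC4 & HO4 & MF4 & Q4 & T4).
    pose proof (Hs 40 eq_refl) as R40c. rewrite R40b in R40c.
    clear Hs. consts_of HC4. pose proof E_small.
    asg1. split; [lia|]. split.
    { eapply static_ext; [|exact HS2]. intros a Ha.
      rewrite MF4, MF3 by lia. reflexivity. }
    split; [exact HO4|]. split.
    { intros a Ha. rewrite PB_S in *. rewrite MF4, MF3 by lia. apply HZ2. lia. }
    split; [congruence|]. lia.
  - intros s2 (R40 & HS2 & HO2 & HZ2 & Q2 & T2) Hs.
    pose proof (same_Consts _ _ s1 Hs eq_refl HC) as HC2.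
    clear Hs s1.
    consts_of HC2. rs. split; [auto|]. split; [auto|]. split; [lia|]. auto.
Qed.

Definition sample_queries : list nat := map (fun j => (j + 1) * w) (seq 0 (n / w)).

Definition samples_ok (g f : nat -> nat) : Prop :=
  forall j, (j + 1) * w <= n -> f (SM + j) = g ((j + 1) * w).

Lemma sample_spec g s : in_range g -> Consts s ->
  wp w g sample (fun s' => Consts s' /\ samples_ok g (mm s') /\
    (forall a, a < SM \/ BK <= a -> mm s' a = mm s a) /\
    qs s' = qs s ++ sample_queries /\ tk s' = tk s + n / w) s.
Proof.
  intros Hg HC. consts_of HC. unfold sample.
  assert (Hnw : n / w * w <= n)
    by (rewrite Nat.mul_comm; apply Nat.Div0.mul_div_le).
  assert (Hnw2 : n < (n / w + 1) * w).
  { pose proof (Nat.mul_succ_div_gt n w ltac:(lia)). lia. }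
  assert (n / w <= n) by (apply Nat.Div0.div_le_upper_bound; nia).
  asg. asg.
  match goal with |- wp _ _ _ _ ?st => set (s1 := st) end.
  apply wp_for with (N := n / w) (I := fun j s' => rg s' 40 = (j + 1) * w /\
    rg s' 41 = SM + j /\
    (forall j', j' < j -> mm s' (SM + j') = g ((j' + 1) * w)) /\
    (forall a, a < SM \/ BK <= a -> mm s' a = mm s a) /\
    qs s' = qs s ++ map (fun j => (j + 1) * w) (seq 0 j) /\ tk s' = tk s + j).
  - unfold s1. rs. cbn [seq map]. rewrite app_nil_r. repeat split; auto; lia.
  - intros j s2 Hj (R40 & R41 & M & MF & Q2 & T2) Hs.
    pose proof (same_Consts _ _ s1 Hs eq_refl HC) as HC2.
    clear Hs s1.
    consts_of HC2.
    pose proof (mul_succ_le j (n / w) w Hj).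
    assert (Hj1 : 1 <= (j + 1) * w <= n) by lia.
    pose proof (Hg _ Hj1).
    arith.
    apply wp_seq, wp_ask; [arith|]. rs.
    (* The machine reduces answers modulo [2 ^ w]; an answer in [[1..n]] is unchanged. *)
    rewrite Nat.mod_small by lia.
    apply wp_seq, wp_sto; [arith|arith|]; rs.
    asg. asg1. arith.
    + intros j' Hj'. destruct (Nat.eqb_spec (SM + j') (SM + j)).
      * f_equal. f_equal. lia.
      * apply M. lia.
    + intros a Ha. destruct (Nat.eqb_spec a (SM + j)); [unfold BK in Ha; lia|auto].
    + rewrite Q2, seq_S, map_app, app_assoc. reflexivity.
  - intros s2 (R40 & R41 & M & MF & Q2 & T2) Hs.
    pose proof (same_Consts _ _ s1 Hs eq_refl HC) as HC2.
    clear Hs s1.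
    consts_of HC2. rs. split; [lia|]. split; [lia|]. split; [lia|].
    split; [auto|]. split; [|auto].
    intros j Hj. apply M.
    destruct (Nat.lt_ge_cases j (n / w)) as [|Lj]; [assumption|].
    pose proof (Nat.mul_le_mono_r _ _ w Lj). lia.
Qed.

Definition plc (i p : nat) : nat := place (E * h) (pat i) (suffix T p).

Lemma plc_key_mono i i' p : i < k -> i' < k ->
  mval (E * h) (pat i) <= mval (E * h) (pat i') ->
  plc i p = 0 -> plc i' p = 0.
Proof.
  intros Hi Hi' Hle. apply place_key_mono; [|exact Hle].
  rewrite !pat_length; auto.
Qed.

Lemma sorted_ids_sorted p q : p <= q < k ->
  mval (E * h) (pat (nth p sorted_ids 0)) <=
  mval (E * h) (pat (nth q sorted_ids 0)).
Proof.
  intros Hpq. destruct (radix_ids E) as [HL _].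
  apply (StronglySorted_nth (fun i => mval (E * h) (pat i)) sorted_ids p q).
  - apply radix_sorted.
  - unfold sorted_ids. lia.
Qed.

(* The first suffix that is not smaller than the pattern [i] has its rank in
   [lo + 1 .. lo + len], as far as the oracle [g] tells. *)
Definition bracket (g : nat -> nat) (len i lo : nat) : Prop :=
  lo <= n /\ (0 < lo -> plc i (g lo) = 0) /\
  (lo + len <= n -> plc i (g (lo + len)) <> 0).

(** Every end of a bracket that lies in [[1..n]] was compared with the pattern itself or, for the
    lower end, possibly with an earlier pattern of no greater key. So the claim holds for any oracle
    in the range, sorted or not. *)
Lemma merge_spec g s : in_range g -> Consts s -> static (mm s) ->
  ord_is (mm s) sorted_ids -> samples_ok g (mm s) ->
  wp w g merge (fun s' => Consts s' /\ static (mm s') /\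
    (forall i, i < k -> bracket g w i (mm s' (LO + i))) /\
    qs s' = qs s /\ tk s' <= tk s + (k + n / w) * (E + 1)) s.
Proof.
  intros Hg HC HS [_ HO] HSM. consts_of HC. unfold merge.
  destruct (radix_ids E) as [HL HI]. fold sorted_ids in HL, HI.
  set (L := sorted_ids) in *.
  assert (HLk : forall p, p < k -> nth p L 0 < k).
  { intros p Hp. apply HI, nth_In. lia. }
  asg. asg. asg.
  match goal with |- wp _ _ _ _ ?st => set (s1 := st) end.
  (* Each iteration advances to the next pattern or to the next sample, so there are at most
     [k + n / w] of them. *)
  apply wp_while with (mu := fun s' => (k - rg s' 40) + (n - rg s' 41))
    (I := fun s' => exists p j, rg s' 40 = p /\ p <= k /\ rg s' 41 = j * w /\
      j * w <= n /\ rg s' 47 = SM + j /\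
      (forall p', 0 < j -> p <= p' -> p' < k ->
         plc (nth p' L 0) (g (j * w)) = 0) /\
      (forall p', p' < p -> bracket g w (nth p' L 0) (mm s' (LO + nth p' L 0))) /\
      (forall a, a < LO \/ SM <= a -> mm s' a = mm s a) /\
      qs s' = qs s /\ tk s' <= tk s + (p + j) * (E + 1)).
  { exists 0, 0. unfold s1. rs. repeat split; auto; lia. }
  intros s2 (p & j & R40 & Hp & R41 & Hj & R47 & HJ & HB & MF & Q2 & T2) Hs.
  pose proof (same_Consts _ _ s1 Hs eq_refl HC) as HC2.
  clear Hs s1.
  consts_of HC2. rs. split; [auto|]. split; [auto|]. split; intros Lpk.
  2: { split; [auto|]. split.
       { eapply static_ext; [|exact HS]. intros a Ha. apply MF. lia. }
       split; [|split; [auto|]].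
       - intros i Hi. apply HI in Hi. apply (In_nth _ _ 0) in Hi.
         destruct Hi as (q & Hq & <-). apply HB. lia.
       - assert (j <= n / w) by (apply Nat.div_le_lower_bound; lia).
         assert ((p + j) * (E + 1) <= (k + n / w) * (E + 1))
           by (apply Nat.mul_le_mono_r; lia). lia. }
  set (x := nth p L 0) in *.
  assert (Hx : x < k) by (apply HLk; lia).
  assert (Mx : mm s2 (ORD + p) = x) by (rewrite MF by lia; apply HO; lia).
  asg. rewrite Mx. asg.
  apply wp_seq.
  eapply wp_conseq with (Q := fun s' =>
    rg s' rRes = (if j * w + w <=? n then plc x (g (j * w + w)) else 1) /\
    mm s' = mm s2 /\ qs s' = qs s2 /\ tk s' <= tk s2 + 1 + E).
  { apply wp_ite; [arith|arith| |]; rs; intros L1.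
    - rewrite (proj2 (Nat.leb_le _ _)) by lia.
      asg.
      assert (Mj : mm s2 (SM + j) = g (j * w + w)).
      { rewrite MF by lia. rewrite HSM by lia. f_equal. lia. }
      rewrite Mj.
      eapply wp_conseq.
      { eapply compare_spec with (p := g (j * w + w)) (i := x); rd;
          try eassumption; try reflexivity.
        - eapply static_ext; [|exact HS]. intros a Ha. apply MF. lia.
        - apply Hg. lia. }
      intros s3 _ (A1 & A2 & A3 & A4). rd. unfold plc. repeat split; auto. lia.
    - apply wp_skip. rs.
      destruct (Nat.leb_spec (j * w + w) n); [lia|]. repeat split; auto; lia. }
  intros s3 Hs (R32 & M3 & Q3 & T3).
  pose proof (same_Consts _ _ _ Hs eq_refl HC2) as HC3.
  pose proof (Hs 40 eq_refl) as R40b. pose proof (Hs 41 eq_refl) as R41b.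
  pose proof (Hs 47 eq_refl) as R47b. pose proof (Hs rI eq_refl) as R31. rd.
  rewrite R40 in R40b. rewrite R41 in R41b. rewrite R47 in R47b.
  clear Hs.
  consts_of HC3.
  assert (j * 1 <= j * w) by (apply Nat.mul_le_mono_l; lia).
  apply wp_ite; [arith|arith| |]; rs; intros L1.
  - destruct (Nat.leb_spec (j * w + w) n) as [Lj|Lj]; [|lia].
    assert (HP0 : plc x (g (j * w + w)) = 0) by lia.
    asg. asg1. split; [|lia].
    exists p, (S j). repeat split; auto; try lia.
    + intros p' _ Hp1 Hp2. replace (S j * w) with (j * w + w) by lia.
      (* The remaining patterns have no smaller keys, so the sample precedes them as well. *)
      apply plc_key_mono with (i := x); auto. apply sorted_ids_sorted. lia.
    + rewrite M3. auto. apply HB; auto.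
    + rewrite M3. auto. apply HB; auto.
    + rewrite M3. auto. apply HB; auto.
    + rewrite M3. auto.
    + congruence.
  - apply wp_seq, wp_sto; [arith|arith|]; rs.
    asg1. split; [|lia].
    assert (Hbx : bracket g w x (j * w)).
    { split; [lia|]. split.
      - intros ?. apply HJ; lia.
      - intros ?. destruct (Nat.leb_spec (j * w + w) n) as [Lj|Lj]; lia. }
    exists (p + 1), j. split; [lia|]. split; [lia|]. split; [lia|].
    split; [lia|]. split; [lia|]. split; [|split; [|split; [|split]]].
    + intros p' ? ? ?. apply HJ; lia.
    + intros p' Hp'. cbn [upd].
      destruct (Nat.eqb_spec (LO + nth p' L 0) (LO + x)) as [Ex|Ex].
      * replace (nth p' L 0) with x by lia. exact Hbx.
      * rewrite M3. apply HB. destruct (Nat.eq_dec p' p) as [->|]; [|lia].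
        unfold x in Ex. lia.
    + intros a Ha. cbn [upd]. destruct (Nat.eqb_spec a (LO + x)); [lia|].
      rewrite M3. auto.
    + congruence.
    + lia.
Qed.

Definition mid_of (s : state) (sg i : nat) : nat := mm s (LO + i) + sg.

Definition round_queries (s : state) (sg : nat) : list nat :=
  filter (fun q => q <=? n) (map (mid_of s sg) (seq 0 k)).

Definition hit (g : nat -> nat) (s : state) (sg i : nat) : bool :=
  (mid_of s sg i <=? n) && (plc i (g (mid_of s sg i)) =? 1).

Definition new_lo (g : nat -> nat) (s : state) (sg i : nat) : nat :=
  if (mid_of s sg i <=? n) && (plc i (g (mid_of s sg i)) =? 0)
  then mid_of s sg i else mm s (LO + i).

(** [round_queries] depends on the state before the round but not on [g]; this is why the queries
    for all patterns form one round. *)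
Lemma round_spec g s tau : in_range g -> Consts s -> static (mm s) ->
  rg s 40 = tau -> 1 <= tau <= w -> (forall i, i < k -> mm s (LO + i) <= n) ->
  let sg := (tau + 1) / 2 in
  wp w g search_round (fun s' => Consts s' /\ static (mm s') /\
    rg s' 40 = (if 1 <? tau then sg else 0) /\
    (forall i, i < k -> mm s' (LO + i) = new_lo g s sg i) /\
    rg s' rAns = (if existsb (hit g s sg) (seq 0 k) then 1 else rg s rAns) /\
    qs s' = qs s ++ round_queries s sg /\
    tk s' <= tk s + k * (E + 1)) s.
Proof.
  intros Hg HC HS R40 Htau HLO sg. consts_of HC. unfold search_round.
  assert (Hsg : 1 <= sg <= tau).
  { unfold sg. split; [apply Nat.div_le_lower_bound; lia|].
    apply Nat.Div0.div_le_upper_bound; lia. }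
  asg; try (fold sg; lia). fold sg.
  asg.
  apply wp_seq.
  match goal with |- wp _ _ _ _ ?st => set (s1 := st) end.
  (* Iteration [i] changes no cell of [LO] but its own, so later middles still come from the state
     before the round. *)
  apply wp_for with (N := k) (I := fun i s' => rg s' 42 = i /\
    (forall i', i' < k -> mm s' (LO + i') =
       if i' <? i then new_lo g s sg i' else mm s (LO + i')) /\
    (forall a, a < LO -> mm s' a = mm s a) /\
    rg s' rAns = (if existsb (hit g s sg) (seq 0 i) then 1 else rg s rAns) /\
    qs s' = qs s ++
      filter (fun q => q <=? n) (map (mid_of s sg) (seq 0 i)) /\
    tk s' <= tk s + i * (E + 1)).
  - unfold s1. rs. cbn [seq map filter existsb]. rewrite app_nil_r.
    repeat split; auto; lia.
  - intros i s2 Hi (R42 & MO & MF & RA & Q2 & T2) Hs.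
    pose proof (same_Consts _ _ s1 Hs eq_refl HC) as HC2.
    pose proof (Hs 40 eq_refl) as R40'. pose proof (Hs 41 eq_refl) as R41.
    unfold s1 in R40', R41. rd. rewrite R40 in R40'.
    clear Hs s1.
    consts_of HC2.
    assert (Mi : mm s2 (LO + i) = mm s (LO + i)).
    { rewrite MO by lia. now rewrite Nat.ltb_irrefl. }
    pose proof (HLO i Hi) as Hlo.
    assert (HST : static (mm s2)).
    { eapply static_ext; [|exact HS]. intros a Ha. apply MF. lia. }
    rewrite seq_S, map_app, filter_app. cbn [map filter Nat.add].
    arith.
    asg. rewrite Mi. asg. fold (mid_of s sg i).
    assert (Hmid : 1 <= mid_of s sg i < 2 ^ w) by (unfold mid_of; lia).
    remember (mid_of s sg i) as mid eqn:Emid.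
    apply wp_seq.
    eapply wp_conseq with (Q := fun s' => rg s' 42 = i /\
      mm s' (LO + i) = new_lo g s sg i /\
      (forall a, a <> LO + i -> mm s' a = mm s2 a) /\
      rg s' rAns = (if hit g s sg i then 1 else rg s2 rAns) /\
      qs s' = qs s2 ++ (if mid <=? n then [mid] else []) /\
      tk s' <= tk s2 + 1 + E).
    { unfold new_lo, hit. rewrite <- Emid.
      apply wp_ite; [arith|arith| |]; rs; intros L1.
      2: { apply wp_skip. destruct (Nat.leb_spec mid n); [lia|]. cbn [andb].
           rs. rewrite app_nil_r. repeat split; auto; lia. }
      destruct (Nat.leb_spec mid n) as [Lm|]; [|lia]. cbn [andb].
      pose proof (Hg mid ltac:(lia)) as Hgm.
      apply wp_seq, wp_ask; [arith|]. rs. rewrite Nat.mod_small by lia.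
      asg. apply wp_seq.
      eapply wp_conseq.
      { eapply compare_spec with (p := g mid) (i := i); rd;
          try eassumption; try reflexivity. }
      intros s3 Hs (A1 & A2 & A3 & A4). rd.
      pose proof (same_Consts _ _ _ Hs eq_refl HC2) as HC3.
      pose proof (Hs rAns eq_refl) as RA3. pose proof (Hs 42 eq_refl) as R42c.
      pose proof (Hs 43 eq_refl) as R43c. rd. rewrite R42 in R42c.
      fold (plc i (g mid)) in A1.
      assert (Hp2 : plc i (g mid) <= 2) by apply place_le2.
      clear Hs.
      consts_of HC3.
      apply wp_ite; [arith|arith| |]; rs; intros L2.
      - apply wp_sto; [arith|arith|]; rs.
        replace (plc i (g mid)) with 0 by lia. cbn [Nat.eqb].
        rewrite Nat.eqb_refl. repeat split; auto; try lia.
        intros a Ha. destruct (Nat.eqb_spec a (LO + i)); [lia|congruence].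
      - apply wp_ite; [arith|arith| |]; rs; intros L3.
        + asg1. replace (plc i (g mid)) with 1 by lia. cbn [Nat.eqb].
          repeat split; auto; try congruence; lia.
        + apply wp_skip. replace (plc i (g mid)) with 2 by lia. cbn [Nat.eqb].
          repeat split; auto; try congruence; lia. }
    intros s3 Hs (R42c & Mi3 & MF3 & RA3 & Q3 & T3).
    clear Hs.
    asg1. split; [lia|]. split; [|split; [|split; [|split]]].
    + intros i' Hi'. destruct (Nat.eq_dec i' i) as [->|N].
      * rewrite Mi3, (proj2 (Nat.ltb_lt i (S i))) by lia. reflexivity.
      * rewrite MF3, MO by lia.
        destruct (Nat.ltb_spec i' i), (Nat.ltb_spec i' (S i)); auto; lia.
    + intros a Ha. rewrite MF3 by lia. auto.
    + rewrite ?RA3, ?RA, existsb_app. cbn [existsb]. rewrite orb_false_r.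
      destruct (existsb _ _), (hit g s sg i); reflexivity.
    + rewrite Q3, Q2, <- app_assoc. reflexivity.
    + lia.
  - intros s2 (R42 & MO & MF & RA & Q2 & T2) Hs.
    pose proof (same_Consts _ _ s1 Hs eq_refl HC) as HC2.
    pose proof (Hs 40 eq_refl) as R40'. pose proof (Hs 41 eq_refl) as R41.
    unfold s1 in R40', R41. rd. rewrite R40 in R40'.
    clear Hs s1.
    consts_of HC2.
    assert (HST : static (mm s2)).
    { eapply static_ext; [|exact HS]. intros a Ha. apply MF. lia. }
    assert (HN : forall i, i < k -> mm s2 (LO + i) = new_lo g s sg i).
    { intros i Hi. rewrite MO by exact Hi.
      now rewrite (proj2 (Nat.ltb_lt i k)). }
    rs. split; [auto|]. split; [auto|]. split; [lia|].
    apply wp_ite; [arith|arith| |]; rs; intros L1.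
    + asg1. rewrite (proj2 (Nat.ltb_lt 1 tau)) by lia.
      repeat split; auto; apply HST.
    + asg1. rewrite (proj2 (Nat.ltb_ge 1 tau)) by lia.
      repeat split; auto; apply HST.
Qed.

(** * Correctness of the search when the oracle lists the suffixes in order *)

Section Oracle.
Variable f : nat -> nat.
Hypothesis Hf : in_range f.
Hypothesis Hmono : forall i a b, i < k -> 1 <= a -> a <= b -> b <= n ->
  plc i (f a) <= plc i (f b).
Hypothesis Hsurj : forall p, 1 <= p <= n -> exists a, 1 <= a <= n /\ f a = p.

Definition matches : Prop := exists i p, i < k /\ 1 <= p <= n /\ plc i p = 1.

(** If the middle precedes the pattern, [tau - sg <= sg] ranks remain behind it, and monotonicity
    moves the upper end to distance [sg]; otherwise the middle itself is the new upper end. *)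
Lemma new_lo_bracket s sg tau i : i < k -> 1 <= sg -> tau <= 2 * sg ->
  1 <= tau -> bracket f tau i (mm s (LO + i)) ->
  bracket f sg i (new_lo f s sg i).
Proof.
  intros Hi Hsg Ht Ht1 (A1 & A2 & A3). unfold new_lo.
  destruct (Nat.leb_spec (mid_of s sg i) n) as [L|L]; cbn [andb].
  - destruct (Nat.eqb_spec (plc i (f (mid_of s sg i))) 0) as [Z|Z].
    + unfold mid_of in *. split; [lia|]. split; [auto|]. intros L2.
      pose proof (Hmono i (mm s (LO + i) + tau) (mm s (LO + i) + sg + sg) Hi).
      specialize (A3 ltac:(lia)). lia.
    + unfold mid_of in *. split; [lia|]. split; [auto|]. auto.
  - unfold mid_of in *. split; [lia|]. split; [auto|]. lia.
Qed.

Lemma hit_matches s sg i : i < k -> 1 <= sg -> hit f s sg i = true -> matches.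
Proof.
  intros Hi Hsg Hh'. unfold hit in Hh'. apply andb_prop in Hh'.
  destruct Hh' as [H1 H2]. apply Nat.leb_le in H1. apply Nat.eqb_eq in H2.
  exists i, (f (mid_of s sg i)). split; [exact Hi|]. split; [|exact H2].
  apply Hf. unfold mid_of in *. lia.
Qed.

(** A matching suffix has a rank beyond [lo]. The suffix of rank [lo + 1] is not before the pattern
    and, by monotonicity, has no greater place than the match, so it matches too. *)
Lemma last_round_hit s : (forall i, i < k -> bracket f 1 i (mm s (LO + i))) ->
  matches -> existsb (hit f s 1) (seq 0 k) = true.
Proof.
  intros HB (i & p & Hi & Hp & Hpl). apply existsb_exists. exists i.
  split; [apply in_seq; lia|]. destruct (HB i Hi) as (A1 & A2 & A3).
  destruct (Hsurj p Hp) as (a & Ha & <-).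
  set (lo := mm s (LO + i)) in *.
  assert (La : lo < a).
  { apply Nat.nle_gt. intros Hle. pose proof (Hmono i a lo Hi). lia. }
  pose proof (Hmono i (lo + 1) a Hi ltac:(lia) ltac:(lia) ltac:(lia)).
  unfold hit, mid_of. fold lo.
  rewrite (proj2 (Nat.leb_le _ _)) by lia. apply Nat.eqb_eq.
  specialize (A3 ltac:(lia)). lia.
Qed.

Lemma round_queries_spec s sg q : 1 <= sg ->
  In q (round_queries s sg) -> 1 <= q <= n.
Proof.
  intros Hsg Hq. apply filter_In in Hq. destruct Hq as [Hq L].
  apply Nat.leb_le in L. apply in_map_iff in Hq.
  destruct Hq as (i & <- & _). unfold mid_of in *. lia.
Qed.

Lemma search_step s tau : Consts s -> static (mm s) -> rg s 40 = tau ->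
  1 <= tau <= w -> rg s rAns <= 1 ->
  (forall i, i < k -> bracket f tau i (mm s (LO + i))) ->
  let sg := (tau + 1) / 2 in
  exists s1 l, in_rounds f search_round (tick s) [l] s1 /\
    Consts s1 /\ static (mm s1) /\ rg s1 40 = (if 1 <? tau then sg else 0) /\
    (forall i, i < k -> bracket f sg i (mm s1 (LO + i))) /\
    (length l <= k /\ forall q, In q l -> 1 <= q <= n) /\
    tk s1 <= tk s + (k * (E + 1) + 1) /\ rg s1 rAns <= 1 /\
    (rg s1 rAns = 1 -> rg s rAns = 1 \/ matches) /\
    (rg s rAns = 1 \/ tau = 1 /\ matches -> rg s1 rAns = 1).
Proof.
  intros HC HS R40 Ht HA HB sg.
  assert (Hsg : 1 <= sg /\ tau <= 2 * sg /\ 2 * sg <= tau + 1).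
  { unfold sg. pose proof (Nat.div_mod (tau + 1) 2).
    pose proof (Nat.mod_upper_bound (tau + 1) 2). lia. }
  assert (HLO : forall i, i < k -> mm (tick s) (LO + i) <= n).
  { intros i Hi. apply (HB i Hi). }
  pose proof (fun g Hg => round_spec g (tick s) tau Hg HC HS R40 Ht HLO) as RS.
  cbn zeta in RS. fold sg in RS.
  destruct (RS f Hf) as (s1 & X1 & HC1 & HS1 & R40' & HN & RA & Q1 & T1).
  cbn [tick rg tk] in RA, T1.
  exists s1, (round_queries (tick s) sg).
  split; [apply in_rounds_one; auto; intros g Hg;
          destruct (RS g Hg) as (s2 & X2 & G); exists s2; tauto|].
  split; [exact HC1|]. split; [exact HS1|]. split; [exact R40'|].
  split.
  { intros i Hi. rewrite HN by exact Hi.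
    apply new_lo_bracket with (tau := tau); [auto|lia|lia|lia|apply (HB i Hi)]. }
  split.
  { split; [|intros q; apply round_queries_spec; lia].
    etransitivity; [apply filter_length_le|]. rewrite length_map, length_seq. lia. }
  split; [lia|]. rewrite RA. split; [destruct (existsb _ _); lia|]. split.
  - destruct (existsb _ _) eqn:Ex; [|auto]. intros _. right.
    apply existsb_exists in Ex. destruct Ex as (i & Hi & Ex).
    apply in_seq in Hi. apply (hit_matches (tick s) sg i); auto; lia.
  - intros [->|[Et M]]; [destruct (existsb _ _); reflexivity|].
    replace sg with 1 in * by lia.
    rewrite last_round_hit; auto. intros i Hi. rewrite Et in HB.
    apply (HB i Hi).
Qed.

(** Halving with rounding up keeps [tau <= 2 ^ J] while [J] decreases, and the round with [tau = 1]
    is the extra one. Earlier rounds may set the answer already, but only on a true match. *)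
Lemma search_loop J : forall s tau, Consts s -> static (mm s) ->
  rg s 40 = tau -> 1 <= tau <= w -> tau <= 2 ^ J -> rg s rAns <= 1 ->
  (forall i, i < k -> bracket f tau i (mm s (LO + i))) ->
  exists s' rs, in_rounds f (While (Cst 0) $40 search_round) s rs s' /\
    length rs <= J + 1 /\
    (forall l, In l rs -> length l <= k /\ forall q, In q l -> 1 <= q <= n) /\
    tk s' <= tk s + length rs * (k * (E + 1) + 1) /\
    rg s' rAns <= 1 /\ (rg s' rAns = 1 <-> rg s rAns = 1 \/ matches).
Proof.
  induction J as [|J IH]; intros s tau HC HS R40 Ht HtJ HA HB;
    destruct (search_step s tau HC HS R40 Ht HA HB)
      as (s1 & l & IR & HC1 & HS1 & R40' & HB1 & Hl & T1 & HA1 & Hs & Hc);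
    (destruct (Nat.eq_dec tau 1) as [Et|Nt];
     [exists s1, ([l] ++ [])|]).
  1, 3: rewrite Et in R40'; cbn [Nat.ltb Nat.leb] in R40';
    (split; [apply in_rounds_while with (s1 := s1);
             [rd; lia|exact I|rd; lia|exact IR|
              apply in_rounds_while_end; [rd; lia|exact I|rd; lia]]|]);
    rewrite app_nil_r; (split; [cbn; lia|]);
    (split; [intros l' [<-|[]]; exact Hl|]);
    (split; [cbn [length]; lia|]); split; [exact HA1|tauto].
  - cbn in HtJ. lia.
  - rewrite (proj2 (Nat.ltb_lt 1 tau)) in R40' by lia.
    pose proof (Nat.div_mod (tau + 1) 2). pose proof (Nat.mod_upper_bound (tau + 1) 2).
    rewrite Nat.pow_succ_r' in HtJ.
    destruct (IH s1 _ HC1 HS1 R40' ltac:(lia) ltac:(lia) HA1 HB1)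
      as (s' & rs & A & L & HQ & T' & HA' & Hiff).
    exists s', ([l] ++ rs).
    split; [apply in_rounds_while with (s1 := s1);
            [rd; lia|exact I|rd; lia|exact IR|exact A]|].
    split; [cbn [length app]; lia|].
    split; [intros l' Hl'; apply in_app_or in Hl'; destruct Hl' as [[<-|[]]|];
            auto|].
    split; [cbn [length app]; lia|]. split; [exact HA'|].
    rewrite Hiff. tauto.
Qed.

Lemma dictionary_matching_spec J s : 1 <= H -> w <= 2 ^ J ->
  rg s rN = n -> rg s rW = w -> rg s rK = k -> rg s rM = m ->
  packed w (mm s) 0 T ->
  (forall i, i < k -> packed w (mm s) (NT + i * EW) (pat i)) ->
  (forall a, REV <= a -> mm s a = 0) -> qs s = [] -> tk s = 0 ->
  exists s' rs, in_rounds f (dictionary_matching H) s rs s' /\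
    length rs <= J + 2 /\
    (forall l, In l rs -> length l <= k + n / w /\
       forall q, In q l -> 1 <= q <= n) /\
    tk s' <= B + k * (E + 1) + E * (1 + k + B + k) + n / w
      + (k + n / w) * (E + 1) + (J + 1) * (k * (E + 1) + 1) /\
    rg s' rAns <= 1 /\ (rg s' rAns = 1 <-> matches).
Proof.
  intros HH HwJ R0 R1 R2 R3 HT HP HZ HQ0 HT0. unfold dictionary_matching.
  destruct (setup_spec f s HH R0 R1 R2 R3) as (s1 & X1 & HC1 & M1 & Q1 & T1).
  destruct (rev_table_spec f s1 HC1) as (s2 & X2 & HC2 & HR2 & MF2 & Q2 & T2).
  { intros a Ha. rewrite M1. auto. }
  rewrite M1 in MF2.
  destruct (digit_table_spec f s2 HC2) as
    (s3 & X3 & HC3 & HS3 & HO3 & MF3 & Q3 & T3).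
  { intros q Hq. rewrite MF2; [auto|]. pose proof (text_addr q Hq).
    unfold REV. lia. }
  { intros i Hi q Hq. rewrite MF2; [apply HP; auto|]. left.
    rewrite pat_length in Hq by exact Hi.
    assert (q < EW) by (apply div_up_gt; lia).
    pose proof (mul_succ_le i k EW Hi). unfold REV. lia. }
  { exact HR2. }
  destruct (radix_sort_spec f s3 HC3 HS3 HO3) as
    (s4 & X4 & HC4 & HS4 & HO4 & Q4 & T4).
  { intros a Ha. rewrite MF3, MF2 by lia. apply HZ. lia. }
  pose proof (fun g Hg => sample_spec g s4 Hg HC4) as SP.
  destruct (SP f Hf) as (s5 & X5 & HC5 & HSM5 & MF5 & Q5 & T5).
  assert (HS5 : static (mm s5)).
  { eapply static_ext; [|exact HS4]. intros a Ha. apply MF5. lia. }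
  destruct (merge_spec f s5 Hf HC5 HS5) as (s6 & X6 & HC6 & HS6 & HB6 & Q6 & T6).
  { destruct HO4 as [HL4 HO4]. split; [exact HL4|]. intros p Hp.
    rewrite MF5 by lia. auto. }
  { exact HSM5. }
  set (s7 := set_rg (set_rg s6 rAns 0) 40 w).
  assert (HC7 : Consts s7) by exact HC6.
  destruct (search_loop J s7 w HC7 HS6) as
    (s8 & rs & IR & HL & HQ & T8 & HA & Hiff); auto; try lia.
  (* Only sampling and search ask. The sample is a single round because its ranks are fixed in
     advance. *)
  exists s8, ([] ++ [] ++ [] ++ [] ++ [sample_queries] ++ [] ++ [] ++ [] ++ rs).
  split.
  { apply in_rounds_seq with s1; [apply in_rounds_quiet; auto|].
    apply in_rounds_seq with s2; [apply in_rounds_quiet; auto|].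
    apply in_rounds_seq with s3; [apply in_rounds_quiet; auto|].
    apply in_rounds_seq with s4; [apply in_rounds_quiet; auto|].
    apply in_rounds_seq with s5.
    { apply in_rounds_one; auto. intros g Hg.
      destruct (SP g Hg) as (s' & X' & G). exists s'. tauto. }
    apply in_rounds_seq with s6; [apply in_rounds_quiet; auto|].
    apply in_rounds_seq with (set_rg s6 rAns 0).
    { apply in_rounds_quiet; [|reflexivity]. apply (exec_asg w f rAns (Cst 0)).
      rd. lia. }
    apply in_rounds_seq with s7; [|exact IR].
    apply in_rounds_quiet; [|reflexivity].
    assert (Ew : w = val $rW (set_rg s6 rAns 0)) by (symmetry; apply HC6).
    unfold s7. rewrite Ew at 2. constructor. exact I. }
  cbn [app].
  assert (Hlen : length sample_queries = n / w).
  { unfold sample_queries. now rewrite length_map, length_seq. }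
  split; [cbn [length]; lia|]. split.
  { intros l [<-|Hl].
    - split; [lia|]. intros q Hq. apply in_map_iff in Hq.
      destruct Hq as (j & <- & Hj). apply in_seq in Hj.
      pose proof (mul_succ_le j (n / w) w ltac:(lia)).
      pose proof (Nat.Div0.mul_div_le n w). lia.
    - destruct (HQ l Hl). split; [lia|auto]. }
  split.
  { assert (length rs * (k * (E + 1) + 1) <= (J + 1) * (k * (E + 1) + 1))
      by (apply Nat.mul_le_mono_r; lia).
    cbn [s7 set_rg tk] in T8. lia. }
  split; [exact HA|]. rewrite Hiff. cbn. split; [intros [?|?]; [lia|auto]|auto].
Qed.

End Oracle.

End Algorithm.

(** * The whole program *)

Definition init_st (w m : nat) (T : list bool) (D : list (list bool)) : state :=
  St (init_reg (length T) (length D) m w) (init_mem w T D) [] 0.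

Definition solves (w m : nat) (T : list bool) (D : list (list bool)) (c : cmd)
  (tmax rmax lmax : nat) : Prop :=
  exists s' rs, in_rounds w (length T) (SA T) c (init_st w m T D) rs s' /\
    length rs <= rmax /\
    (forall l, In l rs ->
       length l <= lmax /\ forall q, In q l -> 1 <= q <= length T) /\
    tk s' <= tmax /\ rg s' rAns <= 1 /\
    (rg s' rAns = 1 <-> positive_instance T D).

(** Here the oracle becomes [SA T]: its answers are in range, their places are monotone by the order
    of the suffixes, and every position is an answer. *)
Lemma dictionary_matching_solves H w m T D J :
  let n := length T in let k := length D in let h := w / H in let B := 2 ^ h in
  let E := (m + h - 1) / h in let EW := (m + w - 1) / w in
  let NT := (n + w - 1) / w in
  (forall p, In p D -> length p = m) -> 1 <= k -> 1 <= m -> 1 <= H ->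
  1 <= h < w -> w <= 2 ^ J ->
  NT + k * EW + B + k * E + k + k + n + 1 + E * B * (k + 1)
    + n + m + 2 * w + H + 2 < 2 ^ w ->
  solves w m T D (dictionary_matching H)
    (B + k * (E + 1) + E * (1 + k + B + k) + n / w
      + (k + n / w) * (E + 1) + (J + 1) * (k * (E + 1) + 1))
    (J + 2) (k + n / w).
Proof.
  intros n k h B E EW NT HDm Hk Hm HH Hh HJ Hsize.
  pose proof (E_bounds H w k m T D eq_refl Hk Hm Hh Hsize) as HE. fold h E in HE.
  assert (Hkw : k < 2 ^ w) by lia. assert (Hmw : m < 2 ^ w) by lia.
  destruct (dictionary_matching_spec H w k m T D eq_refl HDm Hk Hm Hh Hsize (SA T))
    with (J := J) (s := init_st w m T D) as (s' & rs & A1 & A2 & A3 & A4 & A5 & A6);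
    auto; try reflexivity.
  - intros i Hi. apply SA_spec, Hi.
  - intros i a b Hi Ha Hab Hb. apply place_mono.
    + fold h E. unfold pat. rewrite HDm by (apply nth_In; exact Hi). lia.
    + apply SA_mono; auto.
  - intros p Hp. exists (suffix_rank T p).
    split; [apply suffix_rank_range, Hp|apply SA_rank, Hp].
  - cbn. unfold digit. rewrite Nat.mul_0_r, Nat.div_1_r. apply Nat.mod_small, Hkw.
  - cbn. unfold digit. rewrite Nat.mul_0_r, Nat.div_1_r. apply Nat.mod_small, Hmw.
  - apply init_mem_text. lia.
  - intros i Hi. apply init_mem_pattern; auto. lia.
  - intros a Ha. apply init_mem_zero with (m := m); auto.
  - exists s', rs. split; [exact A1|]. split; [exact A2|]. split; [exact A3|].
    split; [exact A4|]. split; [exact A5|]. rewrite A6.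
    assert (HP : forall P, In P D -> 1 <= length P <= E * h).
    { intros P HP. rewrite HDm by exact HP. lia. }
    unfold matches, plc, pat. fold h E. split.
    + intros (i & p & Hi & Hp & Hpl). exists (nth i D []).
      assert (In (nth i D []) D) by (apply nth_In; exact Hi).
      split; [assumption|]. apply (occurs_place (E * h)); [auto|].
      exists p. auto.
    + intros (P & HPD & Ho).
      apply (occurs_place (E * h)) in Ho; [|auto].
      destruct Ho as (p & Hp & Hpl).
      apply (In_nth _ _ []) in HPD. destruct HPD as (i & Hi & <-).
      exists i, p. auto.
Qed.

(* The answer of [c] is in [R4]. *)
Definition assemble (K : nat) (c : cmd) : program :=
  let code := ccmd K 0 c in
  code ++ [Const K 0; JumpEq rAns K (length code + 3); Halt true; Halt false].

Lemma assemble_correct K c w m T D tmax rmax lmax :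
  cmd_below K c = true -> rAns < K ->
  solves w m T D c tmax rmax lmax ->
  exists (t : nat) (answer : bool) (rounds : list (list nat)),
    let start := init w m T D in
    let final := run (assemble K c) w (SA T) t start in
    output (assemble K c) final = Some answer /\
    (answer = true <-> positive_instance T D) /\
    t <= length (ccmd K 0 c) * (tmax + 1) + 2 /\
    (forall q, In q (asked final) -> 1 <= q <= length T) /\
    length (asked final) <= rmax * lmax /\
    asked final = concat rounds /\ length rounds <= rmax /\
    (forall l, In l rounds -> length l <= lmax) /\
    depend_on_preceding_rounds (assemble K c) w (length T) (SA T) start rounds.
Proof.
  intros Hb HK (s' & rs & (X & Q & G) & HR & HL & HT & HA & Hiff).
  cbn [qs init_st app] in Q, G.
  set (P := assemble K c). set (code := ccmd K 0 c).
  set (start := init w m T D).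
  assert (HP : P = code ++
    [Const K 0; JumpEq rAns K (length code + 3); Halt true; Halt false])
    by reflexivity.
  assert (Hc : code_at P 0 code).
  { exists [], [Const K 0; JumpEq rAns K (length code + 3); Halt true; Halt false].
    split; reflexivity. }
  assert (Hsim : sim K start (init_st w m T D)) by (repeat split; auto).
  destruct (ccmd_correct K P w (SA T) c _ _ X 0 start Hb Hc eq_refl Hsim)
    as (t & A1 & (A2 & A3 & A4) & A5).
  fold code in A1, A5. cbn [tk init_st Nat.add] in A1, A5.
  assert (Hn : forall i, nth_error P (length code + i) = nth_error
    [Const K 0; JumpEq rAns K (length code + 3); Halt true; Halt false] i).
  { intros i. rewrite HP, nth_error_app2 by lia. f_equal. lia. }
  set (cf := run P w (SA T) t start) in *.
  (* Two steps follow the compiled code: the scratch register [K] becomes 0, and the answer is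
     compared with it. *)
  assert (E2 : run P w (SA T) 2 cf =
    Config (if rg s' rAns =? 0 then length code + 3 else length code + 2)
      (upd (reg cf) K 0) (mem cf) (asked cf)).
  { change (run P w (SA T) 2 cf) with (run P w (SA T) (1 + 1) cf).
    rewrite run_add, !run_one. unfold step at 2.
    rewrite A1. replace (length code) with (length code + 0) at 1 by lia.
    rewrite Hn. cbn [nth_error]. unfold step.
    unfold set_reg. cbn [pc]. rewrite A1.
    replace (S (length code)) with (length code + 1) by lia. rewrite Hn.
    cbn [nth_error]. unfold goto. cbn [pc reg mem asked].
    rewrite Nat.Div0.mod_0_l. unfold upd at 1 2. rewrite Nat.eqb_refl.
    destruct (Nat.eqb_spec rAns K); [lia|].
    rewrite (A2 rAns HK). destruct (rg s' rAns =? 0); f_equal. lia. }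
  exists (t + 2), (negb (rg s' rAns =? 0)), rs. cbn zeta.
  rewrite run_add. fold cf. rewrite E2. unfold output. cbn [pc asked].
  split.
  { destruct (rg s' rAns =? 0); rewrite Hn; reflexivity. }
  split.
  { rewrite <- Hiff. destruct (Nat.eqb_spec (rg s' rAns) 0); cbn; split;
      (easy || lia). }
  split.
  { fold code. rewrite Nat.mul_0_r, Nat.add_0_r in A5.
    assert (length code * (tk s' + 1) <= length code * (tmax + 1))
      by (apply Nat.mul_le_mono_l; lia). lia. }
  rewrite A4, Q.
  split.
  { intros q Hq. apply in_concat in Hq. destruct Hq as (l & Hl & Hq).
    apply (HL l Hl). exact Hq. }
  split.
  { etransitivity; [|apply Nat.mul_le_mono_r, HR].
    clear -HL. induction rs as [|l rs IH]; cbn; [lia|]. rewrite length_app.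
    specialize (IH ltac:(intros; apply HL; now right)).
    pose proof (proj1 (HL l (or_introl eq_refl))). lia. }
  split; [reflexivity|]. split; [exact HR|].
  split; [intros l Hl; apply (HL l Hl)|].
  intros r g Hr Hg Ha.
  destruct (asks_correct K P w g c _ _ (G r g Hr Hg Ha) 0 start Hb Hc eq_refl Hsim)
    as (t' & E'). exists t'. exact E'.
Qed.

(** * Short texts *)

(** Each leaf is a constant answer, chosen by excluded middle according to [F]; the tree is finite
    because every expression has at most [V] values. *)
Lemma decision_tree (w V : nat) (src : list expr) : V <= 2 ^ w ->
  forall F : list nat -> Prop,
  exists c,
    (forall K, rAns < K -> forallb (vars_below K) src = true ->
       cmd_below K c = true) /\
    forall g s, (forall e, In e src -> safe w e s /\ val e s < V) ->
      1 < 2 ^ w ->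
      wp w g c (fun s' => qs s' = qs s /\ tk s' = tk s /\ rg s' rAns <= 1 /\
        (rg s' rAns = 1 <-> F (map (fun e => val e s) src))) s.
Proof.
  intros HV. induction src as [|e src IH]; intros F.
  - destruct (classic (F [])) as [Y|N].
    + exists (Asg rAns (Cst 1)). split.
      * intros K HK _. cbn [cmd_below vars_below]. rewrite andb_true_r.
        now apply Nat.ltb_lt.
      * intros g s _ Hw. apply wp_asg; [exact Hw|]. cbn.
        split; [auto|]. split; [auto|]. split; [lia|]. tauto.
    + exists (Asg rAns (Cst 0)). split.
      * intros K HK _. cbn [cmd_below vars_below]. rewrite andb_true_r.
        now apply Nat.ltb_lt.
      * intros g s _ Hw. apply wp_asg; [cbn; lia|]. cbn.
        split; [auto|]. split; [auto|]. split; [lia|]. split; [easy|tauto].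
  (* A chain of comparisons with [V - 1, ..., 0]: a value below [S N] but not below [N] equals [N],
     and its branch uses the tree for the rest of the list. *)
  - assert (G : forall N, N <= V -> exists c,
      (forall K, rAns < K -> forallb (vars_below K) (e :: src) = true ->
         cmd_below K c = true) /\
      forall g s, (forall e', In e' (e :: src) -> safe w e' s /\ val e' s < V) ->
        1 < 2 ^ w -> val e s < N ->
        wp w g c (fun s' => qs s' = qs s /\ tk s' = tk s /\ rg s' rAns <= 1 /\
          (rg s' rAns = 1 <-> F (map (fun e => val e s) (e :: src)))) s).
    { induction N as [|N IHN]; intros HN.
      - exists Skip. split; [reflexivity|]. intros; lia.
      - destruct (IHN ltac:(lia)) as (c1 & B1 & W1).
        destruct (IH (fun l => F (N :: l))) as (c2 & B2 & W2).
        exists (Ite e (Cst N) c1 c2). split.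
        + intros K HK HB. cbn [cmd_below vars_below].
          rewrite (B1 K HK HB). cbn [forallb] in HB. apply andb_prop in HB.
          destruct HB as [HB1 HB2]. rewrite HB1, (B2 K HK HB2). reflexivity.
        + intros g s Hs Hw Hv. apply wp_ite.
          * apply Hs. now left.
          * cbn. lia.
          * intros L. apply W1; auto.
          * intros L. cbn [val] in L. assert (E : val e s = N) by lia.
            cbn [map]. rewrite E. apply W2; auto.
            intros e' He'. apply Hs. now right. }
    destruct (G V (le_n V)) as (c & B & W). exists c. split; [exact B|].
    intros g s Hs Hw. apply W; auto. apply Hs. now left.
Qed.

Lemma digit_inj w J x y : 1 <= w -> x < 2 ^ (w * J) -> y < 2 ^ (w * J) ->
  (forall j, j < J -> digit w x j = digit w y j) -> x = y.
Proof.
  intros Hw Hx Hy HD.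
  assert (Z : forall z i, z < 2 ^ (w * J) -> w * J <= i -> Nat.testbit z i = false).
  { intros z i Hz Hi. rewrite <- (Nat.mod_small z (2 ^ (w * J))) by exact Hz.
    apply Nat.mod_pow2_bits_high. exact Hi. }
  apply Nat.bits_inj. intros i.
  destruct (Nat.lt_ge_cases i (w * J)) as [L|L]; [|now rewrite !Z].
  pose proof (Nat.div_mod i w ltac:(lia)) as DM.
  pose proof (Nat.mod_upper_bound i w ltac:(lia)) as Hr.
  assert (Hj : i / w < J) by (apply Nat.Div0.div_lt_upper_bound; lia).
  assert (B : forall z, Nat.testbit z i = Nat.testbit (digit w z (i / w)) (i mod w)).
  { intros z. unfold digit. rewrite Nat.mod_pow2_bits_low by exact Hr.
    rewrite Nat.div_pow2_bits. f_equal. lia. }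
  rewrite !B, HD by exact Hj. reflexivity.
Qed.

Lemma packed_inj w f f' base s s' : 1 <= w -> packed w f base s ->
  packed w f' base s' -> length s = length s' ->
  (forall q, q * w < length s -> f (base + q) = f' (base + q)) -> s = s'.
Proof.
  intros Hw Hp Hp' HL HF. apply nth_ext with (d := false) (d' := false); [exact HL|].
  intros i Hi.
  pose proof (Nat.div_mod i w ltac:(lia)) as DM.
  pose proof (Nat.mod_upper_bound i w ltac:(lia)) as Hr.
  assert (B : forall f s, packed w f base s -> i < length s ->
    nth i s false = Nat.testbit (f (base + i / w)) (i mod w)).
  { intros f0 s0 Hp0 Hi0. rewrite Hp0 by lia.
    rewrite word_of_bits_testbit, nth_firstn, nth_skipn.
    rewrite (proj2 (Nat.ltb_lt _ _)) by exact Hr. f_equal. lia. }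
  rewrite (B f s), (B f' s') by (auto; lia). f_equal. apply HF. lia.
Qed.

(* For a single length [n], the finitely many inputs are told apart by finitely
   many registers and memory cells. *)
Lemma short_texts (n w kmax mmax : nat) : 1 <= w -> n < 2 ^ w -> exists c,
  (exists K0, forall K, K0 <= K -> cmd_below K c = true) /\
  forall m T D, length T = n -> length D <= kmax -> m <= mmax ->
    1 <= m -> (forall p, In p D -> length p = m) -> solves w m T D c 0 0 0.
Proof.
  intros Hw Hn.
  (* Enough digits: [2 ^ (w * J)] exceeds [kmax] and [mmax], so [J] digits determine [k] and [m]. *)
  set (J := kmax + mmax + 1).
  set (L := (n + w - 1) / w + kmax * ((mmax + w - 1) / w)).
  set (src := map Var (seq 2 (2 * J)) ++ map FetchAt (seq 0 L)).
  (* The view determines [k], [m], [T] and [D]. Hence accepting every view that some positive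
     instance produces decides the instance at hand. *)
  set (view := fun m T D => map (fun e => val e (init_st w m T D)) src).
  set (F := fun l => exists m T D, length T = n /\ length D <= kmax /\
    m <= mmax /\ (forall p, In p D -> length p = m) /\ view m T D = l /\
    positive_instance T D).
  destruct (decision_tree w (2 ^ w) src (le_n _) F) as (c & HB & HW).
  exists c. split.
  { exists (2 * J + 10). intros K HK. apply HB; [lia|].
    apply forallb_forall. intros e He. apply in_app_or in He.
    destruct He as [He|He]; apply in_map_iff in He; destruct He as (x & <- & Hx);
      cbn [vars_below]; [|reflexivity].
    apply in_seq in Hx. apply Nat.ltb_lt. lia. }
  intros m T D HT HD Hm Hm1 Hp.
  assert (Hw1 : 2 ^ w <> 0) by (apply Nat.pow_nonzero; lia).
  destruct (HW (SA T) (init_st w m T D)) as (s' & X & Q & HT' & HA & Hiff).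
  { intros e He. apply in_app_or in He.
    destruct He as [He|He]; apply in_map_iff in He; destruct He as (x & <- & Hx);
      apply in_seq in Hx; (split; [exact I|]); cbn [val init_st rg mm].
    - destruct x as [|[|x]]; [lia|lia|]. cbn [init_reg].
      apply Nat.mod_upper_bound, Hw1.
    - apply init_mem_bound. }
  { apply Nat.lt_le_trans with (2 ^ 1); [cbn; lia|apply Nat.pow_le_mono_r; lia]. }
  exists s', []. split; [apply in_rounds_quiet; auto|].
  split; [cbn; lia|]. split; [easy|]. split; [rewrite HT'; cbn; lia|].
  split; [exact HA|]. rewrite Hiff. fold (view m T D). unfold F. split.
  2: { intros Hpos. exists m, T, D. auto 10. }
  intros (m' & T' & D' & HT1 & HD1 & Hm' & Hp' & HV & Hpos).
  assert (V1 : forall e, In e src ->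
    val e (init_st w m' T' D') = val e (init_st w m T D)).
  { apply ext_in_map. exact HV. }
  assert (VR : forall r, r < 2 * J -> init_reg (length T') (length D') m' w (2 + r)
    = init_reg (length T) (length D) m w (2 + r)).
  { intros r Hr. apply (V1 (Var (2 + r))). apply in_or_app. left.
    apply in_map_iff. exists (2 + r). split; [reflexivity|]. apply in_seq. lia. }
  assert (VM : forall a, a < L -> init_mem w T' D' a = init_mem w T D a).
  { intros a Ha. apply (V1 (FetchAt a)). apply in_or_app. right.
    apply in_map_iff. exists a. split; [reflexivity|]. apply in_seq. lia. }
  assert (big : forall x, x <= kmax + mmax -> x < 2 ^ (w * J)).
  { intros x Hx. apply Nat.lt_le_trans with (2 ^ J).
    - apply Nat.lt_trans with J; [lia|]. apply Nat.pow_gt_lin_r. lia.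
    - apply Nat.pow_le_mono_r; [lia|]. nia. }
  assert (Ek : length D' = length D).
  { apply (digit_inj w J); auto; try (apply big; lia). intros j Hj.
    specialize (VR (2 * j) ltac:(lia)). cbn [Nat.add init_reg] in VR.
    rewrite Nat.even_even, Nat.div2_double in VR. exact VR. }
  assert (Em : m' = m).
  { apply (digit_inj w J); auto; try (apply big; lia). intros j Hj.
    specialize (VR (2 * j + 1) ltac:(lia)). cbn [Nat.add init_reg] in VR.
    rewrite Nat.even_odd, Nat.div2_odd' in VR. exact VR. }
  subst m'.
  assert (ET : T' = T).
  { apply (packed_inj w (init_mem w T' D') (init_mem w T D) 0); [exact Hw| | |lia|].
    - apply init_mem_text, Hw.
    - apply init_mem_text, Hw.
    - intros q Hq. apply VM. cbn [Nat.add].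
      apply div_up_gt in Hq; [|exact Hw]. rewrite HT1 in Hq. unfold L. lia. }
  subst T'.
  assert (ED : D' = D).
  { apply nth_ext with (d := []) (d' := []); [exact Ek|]. intros i Hi.
    assert (Hi2 : i < length D) by lia.
    apply (packed_inj w (init_mem w T D') (init_mem w T D)
      ((length T + w - 1) / w + i * ((m + w - 1) / w))).
    - exact Hw.
    - apply init_mem_pattern; auto.
    - apply init_mem_pattern; auto.
    - rewrite (Hp' _ (nth_In _ _ Hi)), (Hp _ (nth_In _ _ Hi2)). reflexivity.
    - intros q Hq. apply VM. rewrite (Hp' _ (nth_In _ _ Hi)) in Hq.
      apply div_up_gt in Hq; [|exact Hw].
      pose proof (mul_succ_le i kmax ((m + w - 1) / w) ltac:(lia)).
      assert ((m + w - 1) / w <= (mmax + w - 1) / w)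
        by (apply Nat.Div0.div_le_mono; lia).
      assert (kmax * ((m + w - 1) / w) <= kmax * ((mmax + w - 1) / w))
        by (apply Nat.mul_le_mono_l; assumption).
      unfold L. rewrite HT in *. lia. }
  subst D'. exact Hpos.
Qed.

(** * Case distinction on the length of the text *)

(** Starting from some [j <= n], the test [n < S j] is reached only while [j <= n], so it singles
    out [n = j]. *)
Fixpoint dispatch (br : nat -> cmd) (main : cmd) (j d : nat) : cmd :=
  match d with
  | 0 => main
  | S d => Ite $rN (Cst (S j)) (br j) (dispatch br main (S j) d)
  end.

Lemma dispatch_below br main K j d :
  rN < K -> cmd_below K main = true ->
  (forall i, j <= i < j + d -> cmd_below K (br i) = true) ->
  cmd_below K (dispatch br main j d) = true.
Proof.
  intros HK HM. revert j; induction d as [|d IH]; intros j HB; [exact HM|].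
  cbn [dispatch cmd_below vars_below]. rewrite HB by lia.
  rewrite IH by (intros; apply HB; lia).
  rewrite (proj2 (Nat.ltb_lt _ _) HK). reflexivity.
Qed.

Lemma dispatch_large w m T D br main tmax rmax lmax d : forall j,
  j + d <= length T -> length T < 2 ^ w ->
  solves w m T D main tmax rmax lmax ->
  solves w m T D (dispatch br main j d) tmax rmax lmax.
Proof.
  induction d as [|d IH]; intros j Hj Hw HM; [exact HM|].
  destruct (IH (S j) ltac:(lia) Hw HM) as (s' & rs & (X & Q & G) & R).
  exists s', rs. split; [|exact R].
  assert (S1 : safe w $rN (init_st w m T D)) by exact I.
  assert (S2 : safe w (Cst (S j)) (init_st w m T D)) by (cbn; lia).
  assert (Hge : val (Cst (S j)) (init_st w m T D) <= val $rN (init_st w m T D))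
    by (cbn; lia).
  split; [apply exec_ite_f; auto|]. split; [exact Q|].
  intros r g Hr Hg Ha. apply asks_ite_f; auto.
Qed.

Lemma dispatch_small w m T D br main d : forall j,
  j <= length T < j + d -> length T + 1 < 2 ^ w ->
  solves w m T D (br (length T)) 0 0 0 ->
  solves w m T D (dispatch br main j d) 0 0 0.
Proof.
  induction d as [|d IH]; intros j Hj Hw HM; [lia|]. cbn [dispatch].
  assert (S1 : safe w $rN (init_st w m T D)) by exact I.
  assert (S2 : safe w (Cst (S j)) (init_st w m T D)) by (cbn; lia).
  destruct (Nat.eq_dec j (length T)) as [->|N].
  - destruct HM as (s' & rs & (X & Q & G) & R1 & R2).
    destruct rs; [|cbn in R1; lia].
    exists s', []. split; [|auto].
    apply in_rounds_quiet; [|now rewrite app_nil_r in Q].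
    apply exec_ite_t; auto.
  - destruct (IH (S j) ltac:(lia) Hw HM) as (s' & rs & (X & Q & G) & R1 & R2).
    destruct rs; [|cbn in R1; lia].
    exists s', []. split; [|auto].
    apply in_rounds_quiet; [|now rewrite app_nil_r in Q].
    apply exec_ite_f; auto. cbn. lia.
Qed.

(** * Choice of the parameters *)

(** About a quarter of [n ^ 2 <= 2 ^ w] goes to the buckets, since [4 * E * B <= w * B <= n]. The
    other terms are linear in [n]; with [4 * (2 * b + E0 + 14) <= w <= n] another quarter absorbs
    them. *)
Lemma size_bound (n k m w H B E b E0 : nat) :
  1 <= H <= w -> B * B <= n -> w * w <= n -> k <= n -> m <= b * w -> E <= E0 ->
  n * n <= 2 ^ w -> 4 * (2 * b + E0 + 14) <= w ->
  (n + w - 1) / w + k * ((m + w - 1) / w) + B + k * E + k + k + n + 1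
    + E * B * (k + 1) + n + m + 2 * w + H + 2 < 2 ^ w.
Proof.
  intros HH HB Hw Hk Hm HE Hn HwE.
  assert (Hwn : w <= n) by nia.
  (* Both [B] and [w] are at most the square root of [n]. *)
  assert (HBw : B * w <= n).
  { apply Nat.square_le_simpl_nonneg; nia. }
  assert (HBn : B <= n) by nia.
  assert (N1 : (n + w - 1) / w <= n).
  { apply Nat.lt_succ_r, Nat.Div0.div_lt_upper_bound. nia. }
  assert (N2 : (m + w - 1) / w <= b).
  { apply Nat.lt_succ_r, Nat.Div0.div_lt_upper_bound. nia. }
  assert (N3 : k * ((m + w - 1) / w) <= n * b) by (apply Nat.mul_le_mono; lia).
  assert (N4 : k * E <= n * E0) by (apply Nat.mul_le_mono; lia).
  assert (N5 : b * w <= n * b) by (rewrite Nat.mul_comm; apply Nat.mul_le_mono_r; lia).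
  assert (N6 : 4 * (E * B * (k + 1)) <= n * (n + 1)).
  { rewrite Nat.mul_assoc. apply Nat.mul_le_mono; [|lia].
    etransitivity; [|exact HBw]. rewrite Nat.mul_assoc, Nat.mul_comm.
    apply Nat.mul_le_mono_l. lia. }
  assert (N7 : n * (4 * (2 * b + E0 + 14)) <= n * n)
    by (apply Nat.mul_le_mono_l; lia).
  clear - HH Hwn Hk Hm Hn HwE HBn N1 N3 N4 N5 N6 N7.
  revert N1 N3 N4 N5 N6.
  generalize ((n + w - 1) / w) (k * ((m + w - 1) / w)) (k * E) (E * B * (k + 1)).
  intros x1 x2 x3 x4 N1 N3 N4 N5 N6. nia.
Qed.

(** As [h >= 1], [w < H * (h + 1) <= 2 * H * h]: rounding [w / H] down costs at most a factor 2. *)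
Lemma digits_bound (m w H b : nat) : let h := w / H in
  1 <= H -> 1 <= h -> m <= b * w -> (m + h - 1) / h <= 2 * b * H.
Proof.
  intros h HH Hh Hm. apply Nat.lt_succ_r, Nat.Div0.div_lt_upper_bound.
  pose proof (Nat.mul_succ_div_gt w H ltac:(lia)) as G. fold h in G.
  assert (w <= 2 * (H * h)) by nia. nia.
Qed.

(** The factor 8 is 7 for all that precedes the search and 1 for the search rounds, in units of
    [(k + q) * (E0 + 1)]. *)
Lemma time_bound (B k E E0 q J : nat) : E <= E0 -> B <= q -> 1 <= q ->
  B + k * (E + 1) + E * (1 + k + B + k) + q + (k + q) * (E + 1)
    + (J + 1) * (k * (E + 1) + 1) <= 8 * (E0 + 1) * ((J + 2) * (k + q)).
Proof.
  intros HE HB Hq.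
  assert (A1 : (J + 1) * (k * (E + 1) + 1) <= (J + 2) * ((k + q) * (E0 + 1))).
  { apply Nat.mul_le_mono; nia. }
  assert (A2 : B + k * (E + 1) + E * (1 + k + B + k) + q + (k + q) * (E + 1)
    <= 7 * ((k + q) * (E0 + 1))) by nia.
  assert (A3 : 1 * ((k + q) * (E0 + 1)) <= (J + 2) * ((k + q) * (E0 + 1)))
    by (apply Nat.mul_le_mono_r; lia).
  nia.
Qed.

(** * Estimates with real logarithms *)

Local Open Scope R_scope.

Lemma ln2_pos : 0 < ln 2.
Proof. pose proof ln_lt_2. lra. Qed.

Lemma log_le x y : 0 < x -> x <= y -> log x <= log y.
Proof.
  intros Hx H. unfold log. apply Rmult_le_compat_r.
  - apply Rlt_le, Rinv_0_lt_compat, ln2_pos.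
  - destruct H as [H| ->]; [|lra]. apply Rlt_le, ln_increasing; lra.
Qed.

Lemma log_1 : log 1 = 0.
Proof. unfold log. rewrite ln_1. lra. Qed.

Lemma log_2 : log 2 = 1.
Proof. unfold log. pose proof ln2_pos. field. lra. Qed.

Lemma log_mult x y : 0 < x -> 0 < y -> log (x * y) = log x + log y.
Proof. intros. unfold log. rewrite ln_mult by lra. pose proof ln2_pos. field. lra. Qed.

Lemma log_pow2 h : log (INR (2 ^ h)) = INR h.
Proof.
  induction h as [|h IH].
  - cbn. apply log_1.
  - rewrite Nat.pow_succ_r', mult_INR, log_mult, IH, (S_INR h).
    + replace (INR 2) with 2 by (cbn; lra). rewrite log_2. lra.
    + cbn; lra.
    + apply lt_0_INR, Nat.neq_0_lt_0, Nat.pow_nonzero. discriminate.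
Qed.

Lemma log_le_inv x y : 0 < x -> 0 < y -> log x <= log y -> x <= y.
Proof.
  intros Hx Hy H. apply Rnot_lt_le. intros L. apply ln_increasing in L; [|lra].
  unfold log in H. apply Rmult_le_reg_r in H; [lra|].
  apply Rinv_0_lt_compat, ln2_pos.
Qed.

Lemma log_pos_ge1 n : (2 <= n)%nat -> 1 <= log (INR n).
Proof.
  intros H. rewrite <- log_2. apply log_le; [lra|].
  replace 2 with (INR 2) by (cbn; lra). apply le_INR, H.
Qed.

Lemma log_le_self n : (1 <= n)%nat -> log (INR n) <= INR n.
Proof.
  intros H. rewrite <- (log_pow2 n) at 2. apply log_le.
  - apply lt_0_INR. lia.
  - apply le_INR, Nat.lt_le_incl, Nat.pow_gt_lin_r. lia.
Qed.

(* [n = exp (log n * ln 2)], [ln 2 > 1/2] and [exp x >= (x / 3)^3]. *)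
Lemma log_cube n : (2 <= n)%nat -> log (INR n) ^ 3 <= 216 * INR n.
Proof.
  intros Hn. pose proof (log_pos_ge1 n Hn) as Hy. set (y := log (INR n)) in *.
  assert (Hn0 : 0 < INR n) by (apply lt_0_INR; lia).
  assert (E : INR n = exp (y * ln 2)).
  { unfold y, log. replace (ln (INR n) / ln 2 * ln 2) with (ln (INR n)).
    - now rewrite exp_ln.
    - pose proof ln2_pos. field. lra. }
  assert (E3 : exp (y * ln 2) = exp (y * ln 2 / 3) ^ 3).
  { cbn [pow]. rewrite Rmult_1_r, <- !exp_plus. f_equal. lra. }
  pose proof (exp_ineq1_le (y * ln 2 / 3)) as I1. pose proof ln_lt_2.
  assert (I2 : y / 6 <= exp (y * ln 2 / 3)).
  { assert (y * / 2 <= y * ln 2) by (apply Rmult_le_compat_l; lra). lra. }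
  rewrite E, E3.
  assert ((y / 6) ^ 3 <= exp (y * ln 2 / 3) ^ 3) by (apply pow_incr; lra).
  replace (y ^ 3) with (216 * (y / 6) ^ 3) by field. lra.
Qed.

Lemma INR_sq_le x y : INR x * INR x <= INR y -> (x * x <= y)%nat.
Proof. intros H. apply INR_le. now rewrite mult_INR. Qed.

Definition nlogn (n : nat) : R := INR n / log (INR n).
Definition loglog (n : nat) : R := 1 + log (log (INR n)).

Lemma nlogn_ge1 n : (2 <= n)%nat -> 1 <= nlogn n.
Proof.
  intros Hn. pose proof (log_pos_ge1 n Hn). pose proof (log_le_self n ltac:(lia)).
  unfold nlogn. apply (Rmult_le_reg_r (log (INR n))); [lra|].
  unfold Rdiv. rewrite Rmult_assoc, Rinv_l; lra.
Qed.

Lemma loglog_ge1 n : (2 <= n)%nat -> 1 <= loglog n.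
Proof.
  intros Hn. pose proof (log_pos_ge1 n Hn). unfold loglog.
  pose proof (log_le 1 (log (INR n)) ltac:(lra) ltac:(lra)).
  rewrite log_1 in *. lra.
Qed.

Section Asymptotics.
Variables (c a2 b2 : R).
Hypotheses (hc : 2 <= c) (ha2 : 0 < a2) (hb2 : 0 < b2).

Definition word_size (n w : nat) : Prop :=
  c * log (INR n) <= INR w < c * log (INR n) + 1.

(** Here [c >= 2] enters: [2 ^ w >= n ^ c]. *)
Lemma word_size_sq n w : (2 <= n)%nat -> word_size n w -> (n * n <= 2 ^ w)%nat.
Proof.
  intros Hn [Hw _]. pose proof (log_pos_ge1 n Hn).
  assert (0 < INR n) by (apply lt_0_INR; lia).
  apply INR_le. apply log_le_inv.
  - rewrite mult_INR. nra.
  - apply lt_0_INR, Nat.neq_0_lt_0, Nat.pow_nonzero. discriminate.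
  - rewrite log_pow2, mult_INR, log_mult by lra. nra.
Qed.

(** Lets the branch for a fixed length be built for one concrete [w]. *)
Lemma word_size_unique n w w' : word_size n w -> word_size n w' -> w = w'.
Proof.
  intros [A1 A2] [B1 B2].
  assert (INR w < INR w' + 1) as H1 by lra. assert (INR w' < INR w + 1) as H2 by lra.
  rewrite <- S_INR in H1, H2. apply INR_lt in H1, H2. lia.
Qed.

Lemma bounded_nat (r : R) : exists N, forall x, INR x <= r -> (x <= N)%nat.
Proof.
  destruct (INR_unbounded r) as [N HN]. exists N. intros x Hx.
  apply INR_le. lra.
Qed.

Lemma large_n : exists (H N0 : nat) (A : R), 0 < A /\
  forall (m w : nat) (T : list bool) (D : list (list bool)),
    let n := length T in let k := length D in
    (N0 <= n)%nat -> (2 <= n)%nat -> (1 <= k)%nat -> (1 <= m)%nat ->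
    INR k <= a2 * nlogn n -> INR m <= b2 * log (INR n) -> word_size n w ->
    (forall p, In p D -> length p = m) ->
    exists tmax rmax lmax,
      solves w m T D (dictionary_matching H) tmax rmax lmax /\
      INR tmax <= A * (nlogn n * loglog n) /\
      INR rmax <= A * loglog n /\ INR lmax <= A * nlogn n.
Proof.
  (* As [w <= (c + 1) * log n], this makes [h <= log n / 2] and so [B * B <= n]. *)
  destruct (INR_unbounded (2 * c + 2)) as [H HH].
  destruct (INR_unbounded b2) as [b Hb].
  set (E0 := (2 * b * H)%nat).
  (* Once [log n >= M], each summand is at most [log n]. The first yields [w * w <= n] through
     [log_cube], [a2] yields [k <= n], and the last two yield [H <= w] and the room that
     [size_bound] asks for. *)
  destruct (INR_unbounded (216 * (c + 1) * (c + 1) + a2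
    + INR H + INR (4 * (2 * b + E0 + 14)))) as [M HM].
  set (lc := log (c + 1)).
  assert (Hlc : 0 <= lc).
  { unfold lc. rewrite <- log_1. apply log_le; lra. }
  (* [A1] bounds the number of rounds relative to [loglog n], [A2] their size relative to [nlogn n];
     their product enters [A] with the factor of [time_bound]. *)
  set (A1 := 3 + lc). set (A2 := a2 + 1).
  set (A := A1 + A2 + INR (8 * (E0 + 1)) * (A1 * A2)).
  assert (HA0 : 0 <= INR (8 * (E0 + 1)) * (A1 * A2)).
  { apply Rmult_le_pos; [apply pos_INR|]. unfold A1, A2.
    apply Rmult_le_pos; lra. }
  exists H, (2 ^ M)%nat, A. split; [unfold A, A1, A2 in *; lra|].
  intros m w T D n k HN Hn2 Hk Hm HkR HmR HwS HDm.
  pose proof (log_pos_ge1 n Hn2) as Hy1.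
  set (y := log (INR n)) in *. destruct (HwS) as [Hw1 Hw2]. fold y in Hw1, Hw2.
  assert (HyM : INR M <= y).
  { rewrite <- log_pow2. apply log_le.
    - apply lt_0_INR, Nat.neq_0_lt_0, Nat.pow_nonzero. discriminate.
    - apply le_INR, HN. }
  pose proof (pos_INR H) as HH0. pose proof (pos_INR (4 * (2 * b + E0 + 14))) as HE00.
  assert (Hcc : 0 <= 216 * (c + 1) * (c + 1)) by nra.
  assert (Hyw : y <= INR w) by nra.
  assert (HHw : (H <= w)%nat) by (apply INR_le; lra).
  assert (HEw : (4 * (2 * b + E0 + 14) <= w)%nat) by (apply INR_le; lra).
  assert (HH2 : (2 <= H)%nat).
  { apply INR_le. cbn. lra. }
  assert (Hn0 : 0 < INR n) by (apply lt_0_INR; lia).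
  assert (Hwy : INR w <= (c + 1) * y) by lra.
  assert (Hww : (w * w <= n)%nat).
  { apply INR_sq_le. pose proof (log_cube n Hn2) as Hc3. fold y in Hc3.
    assert (INR w * INR w <= ((c + 1) * y) * ((c + 1) * y)).
    { apply Rmult_le_compat; try lra; apply pos_INR. }
    assert (216 * ((c + 1) * y * ((c + 1) * y)) <= y ^ 3).
    { replace (y ^ 3) with (y * (y * y)) by ring.
      replace (216 * ((c + 1) * y * ((c + 1) * y)))
        with (216 * (c + 1) * (c + 1) * (y * y)) by ring.
      apply Rmult_le_compat_r; nra. }
    lra. }
  set (h := (w / H)%nat). set (B := (2 ^ h)%nat).
  assert (Hh1 : (1 <= h)%nat) by (apply Nat.div_le_lower_bound; lia).
  assert (Hhw : (h < w)%nat) by (apply Nat.div_lt; lia).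
  assert (HBB : (B * B <= n)%nat).
  { apply INR_sq_le.
    assert (0 < INR B).
    { apply lt_0_INR, Nat.neq_0_lt_0, Nat.pow_nonzero. discriminate. }
    apply log_le_inv; [nra|lra|]. rewrite log_mult by lra.
    unfold B. rewrite log_pow2. fold y.
    assert (Hhh : (H * h <= w)%nat) by apply Nat.Div0.mul_div_le.
    apply le_INR in Hhh. rewrite mult_INR in Hhh.
    assert ((2 * c + 2) * INR h <= INR H * INR h).
    { apply Rmult_le_compat_r; [apply pos_INR|lra]. }
    assert ((2 * c + 2) * INR h <= (c + 1) * y) by lra.
    assert (Hg : (c + 1) * (2 * INR h) <= (c + 1) * y) by lra.
    apply Rmult_le_reg_l in Hg; lra. }
  assert (Hkn : (k <= n)%nat).
  { apply INR_le. etransitivity; [exact HkR|]. unfold nlogn. fold y.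
    apply (Rmult_le_reg_r y); [lra|].
    replace (a2 * (INR n / y) * y) with (a2 * INR n) by (field; lra). nra. }
  assert (Hmb : (m <= b * w)%nat).
  { apply INR_le. rewrite mult_INR. etransitivity; [exact HmR|]. fold y.
    apply Rmult_le_compat; lra. }
  assert (HE : ((m + h - 1) / h <= E0)%nat) by (apply digits_bound; lia).
  set (E := ((m + h - 1) / h)%nat) in *.
  (* The least [J] with [w <= 2 ^ J]; then [2 ^ (J - 1) < w] bounds [J] by [log (log n)] plus a
     constant. *)
  set (J := Nat.log2_up w).
  pose proof (Nat.log2_up_spec w ltac:(lia)) as [HJ1 HJ2]. fold J in HJ1, HJ2.
  assert (HBw : (B * w <= n)%nat).
  { apply Nat.square_le_simpl_nonneg; [lia|].
    replace (B * w * (B * w))%nat with ((B * B) * (w * w))%nat by lia.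
    apply Nat.mul_le_mono; assumption. }
  (* Scanning all buckets takes no more iterations than sampling. *)
  assert (HBq : (B <= n / w)%nat) by (apply Nat.div_le_lower_bound; lia).
  assert (HB1 : (1 <= B)%nat).
  { apply Nat.neq_0_lt_0, Nat.pow_nonzero. discriminate. }
  exists (B + k * (E + 1) + E * (1 + k + B + k) + n / w
      + (k + n / w) * (E + 1) + (J + 1) * (k * (E + 1) + 1))%nat,
    (J + 2)%nat, (k + n / w)%nat.
  assert (HJR : INR (J + 2) <= A1 * loglog n).
  { assert (Hlog : INR (J - 1) <= lc + log y).
    { rewrite <- log_pow2. unfold lc. rewrite <- log_mult by lra.
      apply log_le; [apply lt_0_INR, Nat.neq_0_lt_0, Nat.pow_nonzero; discriminate|].
      replace (J - 1)%nat with (Nat.pred J) by lia.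
      apply lt_INR in HJ1. lra. }
    pose proof (loglog_ge1 n Hn2) as Hll. unfold loglog in *. fold y in Hll |- *.
    assert (INR (J + 2) <= INR (J - 1) + 3).
    { replace 3 with (INR 3) by (cbn; lra). rewrite <- plus_INR.
      apply le_INR. lia. }
    unfold A1. nra. }
  assert (HqR : INR (k + n / w) <= A2 * nlogn n).
  { rewrite plus_INR. unfold A2. rewrite Rmult_plus_distr_r.
    apply Rplus_le_compat; [exact HkR|]. rewrite Rmult_1_l.
    unfold nlogn. fold y. apply (Rmult_le_reg_r y); [lra|].
    replace (INR n / y * y) with (INR n) by (field; lra).
    assert (G : (n / w * w <= n)%nat)
      by (rewrite Nat.mul_comm; apply Nat.Div0.mul_div_le).
    apply le_INR in G. rewrite mult_INR in G.
    pose proof (pos_INR (n / w)). nra. }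
  pose proof (loglog_ge1 n Hn2) as Hll. pose proof (nlogn_ge1 n Hn2) as Hnl.
  split; [|split; [|split]].
  - apply dictionary_matching_solves; auto; try lia.
    apply size_bound with (b := b) (E0 := E0); auto; try lia.
    apply word_size_sq; auto.
  - apply Rle_trans with (INR (8 * (E0 + 1) * ((J + 2) * (k + n / w)))).
    + apply le_INR, time_bound; lia.
    + rewrite !(mult_INR _ ((J + 2) * (k + n / w))), (mult_INR (J + 2)).
      assert (INR (J + 2) * INR (k + n / w) <= A1 * loglog n * (A2 * nlogn n)).
      { apply Rmult_le_compat; auto; apply pos_INR. }
      assert (INR (8 * (E0 + 1)) * (INR (J + 2) * INR (k + n / w)) <=
        INR (8 * (E0 + 1)) * (A1 * loglog n * (A2 * nlogn n))).
      { apply Rmult_le_compat_l; [apply pos_INR|assumption]. }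
      unfold A. assert (0 <= (A1 + A2) * (nlogn n * loglog n)).
      { unfold A1, A2. apply Rmult_le_pos; [lra|]. apply Rmult_le_pos; lra. }
      lra.
  - apply Rle_trans with (A1 * loglog n); [exact HJR|].
    apply Rmult_le_compat_r; [lra|]. unfold A, A2 in *. lra.
  - apply Rle_trans with (A2 * nlogn n); [exact HqR|].
    apply Rmult_le_compat_r; [lra|]. unfold A, A1 in *. lra.
Qed.

Lemma small_n (n : nat) : exists cn K0,
  (forall K, (K0 <= K)%nat -> cmd_below K cn = true) /\
  forall (m w : nat) (T : list bool) (D : list (list bool)),
    length T = n -> (2 <= n)%nat -> (1 <= m)%nat ->
    INR (length D) <= a2 * nlogn n -> INR m <= b2 * log (INR n) ->
    word_size n w -> (forall p, In p D -> length p = m) ->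
    solves w m T D cn 0 0 0.
Proof.
  destruct (classic (exists w, (2 <= n)%nat /\ word_size n w)) as [(w & Hn & Hw)|N].
  (* No instance has such a length, so any command will do. *)
  2: { exists Skip, 0%nat. split; [reflexivity|]. intros m w T D _ Hn _ _ _ Hw.
       exfalso. apply N. exists w. auto. }
  destruct (bounded_nat (a2 * nlogn n)) as [kmax Hk].
  destruct (bounded_nat (b2 * log (INR n))) as [mmax Hm].
  pose proof (word_size_sq n w Hn Hw) as Hsq.
  assert (Hw1 : (1 <= w)%nat).
  { destruct w; [|lia]. cbn in Hsq. nia. }
  destruct (short_texts n w kmax mmax Hw1 ltac:(nia)) as (cn & [K0 HK] & HS).
  exists cn, K0. split; [exact HK|]. intros m w' T D HT _ Hm1 HkR HmR Hw' HD.
  rewrite (word_size_unique n w' w Hw' Hw). apply HS; auto.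
Qed.

Lemma small_ns (N0 : nat) : exists (br : nat -> cmd) K0,
  forall n, (n < N0)%nat ->
  (forall K, (K0 <= K)%nat -> cmd_below K (br n) = true) /\
  forall (m w : nat) (T : list bool) (D : list (list bool)),
    length T = n -> (2 <= n)%nat -> (1 <= m)%nat ->
    INR (length D) <= a2 * nlogn n -> INR m <= b2 * log (INR n) ->
    word_size n w -> (forall p, In p D -> length p = m) ->
    solves w m T D (br n) 0 0 0.
Proof.
  induction N0 as [|N0 (br & K0 & IH)].
  - exists (fun _ => Skip), 0%nat. intros n Hn. lia.
  - destruct (small_n N0) as (cn & K1 & H1 & H2).
    exists (fun n => if n =? N0 then cn else br n)%nat, (K0 + K1)%nat.
    intros n Hn. destruct (Nat.eqb_spec n N0) as [->|N].
    + split; [intros; apply H1; lia|exact H2].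
    + destruct (IH n ltac:(lia)) as [I1 I2].
      split; [intros; apply I1; lia|exact I2].
Qed.

Lemma dictionary_matching_program : exists (cm : cmd) (K : nat) (A : R),
  (rAns < K)%nat /\ cmd_below K cm = true /\ 0 < A /\
  forall (m w : nat) (T : list bool) (D : list (list bool)),
    let n := length T in
    (2 <= n)%nat -> (1 <= length D)%nat -> (1 <= m)%nat ->
    INR (length D) <= a2 * nlogn n -> INR m <= b2 * log (INR n) ->
    word_size n w -> (forall p, In p D -> length p = m) ->
    exists tmax rmax lmax, solves w m T D cm tmax rmax lmax /\
      INR tmax <= A * (nlogn n * loglog n) /\
      INR rmax <= A * loglog n /\ INR lmax <= A * nlogn n.
Proof.
  destruct large_n as (H & N0 & A & HA & HL).
  destruct (small_ns N0) as (br & K0 & HS).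
  (* 60 exceeds every register of [dictionary_matching], and [K0] those of the branches. *)
  exists (dispatch br (dictionary_matching H) 0 N0), (K0 + 60)%nat, A.
  split; [lia|]. split.
  { apply dispatch_below; [lia| |].
    - apply cmd_below_mono with 60%nat; [lia|reflexivity].
    - intros i Hi. apply HS; lia. }
  split; [exact HA|].
  intros m w T D n Hn Hk Hm HkR HmR Hw HD.
  pose proof (word_size_sq n w Hn Hw) as Hsq.
  destruct (Nat.lt_ge_cases n N0) as [L|L].
  - exists 0%nat, 0%nat, 0%nat.
    pose proof (loglog_ge1 n Hn). pose proof (nlogn_ge1 n Hn).
    assert (0 <= nlogn n * loglog n) by (apply Rmult_le_pos; lra).
    split; [|cbn [INR]; repeat split; apply Rmult_le_pos; lra].
    apply dispatch_small; [fold n; lia|fold n; nia|].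
    apply (HS n); auto.
  - destruct (HL m w T D L Hn Hk Hm HkR HmR Hw HD)
      as (tmax & rmax & lmax & HSol & R).
    exists tmax, rmax, lmax. split; [|exact R].
    apply dispatch_large; [fold n; lia|fold n; nia|exact HSol].
Qed.

End Asymptotics.

Theorem theorem8p4 (c a1 a2 b1 b2 : R)
  (hc : 2 <= c) (ha1 : 0 < a1) (ha2 : 0 < a2) (hb1 : 0 < b1) (hb2 : 0 < b2) :
  exists (P : program) (C : R), 0 < C /\
  forall (n k m w : nat) (T : list bool) (D : list (list bool)),
    (2 <= n)%nat -> (1 <= k)%nat -> (1 <= m)%nat ->
    a1 * (INR n / log (INR n)) <= INR k <= a2 * (INR n / log (INR n)) ->
    b1 * log (INR n) <= INR m <= b2 * log (INR n) ->
    c * log (INR n) <= INR w < c * log (INR n) + 1 ->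
    length T = n -> length D = k -> (forall p, In p D -> length p = m) ->
    exists (t : nat) (answer : bool) (rounds : list (list nat)),
      let start := init w m T D in
      let final := run P w (SA T) t start in
      output P final = Some answer /\
      (answer = true <-> positive_instance T D) /\
      INR t <= C * (INR n * (1 + log (log (INR n))) / log (INR n)) /\
      (forall q, In q (asked final) -> (1 <= q <= n)%nat) /\
      INR (length (asked final))
        <= C * (INR n * (1 + log (log (INR n))) / log (INR n)) /\
      asked final = concat rounds /\
      INR (length rounds) <= C * (1 + log (log (INR n))) /\
      (forall qs, In qs rounds -> INR (length qs) <= C * (INR n / log (INR n))) /\
      depend_on_preceding_rounds P w n (SA T) start rounds.
Proof.
  destruct (dictionary_matching_program c a2 b2 hc ha2 hb2)
    as (cm & K & A & HK & HB & HA & HS).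
  set (len := INR (length (ccmd K 0 cm))).
  assert (Hlen : 0 <= len) by apply pos_INR.
  (* [A] serves for the number and the size of the rounds, [A * A] for the total number of queries
     as their product, and [len * (A + 1) + 2] for the steps. *)
  set (C := A + A * A + (len * (A + 1) + 2)).
  assert (HC0 : 0 <= A * A) by nra.
  assert (HC1 : 0 <= len * (A + 1)) by (apply Rmult_le_pos; lra).
  exists (assemble K cm), C. split; [unfold C; lra|].
  intros n k m w T D Hn Hk Hm [_ HkR] [_ HmR] Hw HT HD HDm. subst n k.
  set (n := length T) in *.
  destruct (HS m w T D Hn Hk Hm HkR HmR Hw HDm)
    as (tmax & rmax & lmax & HSol & Ht & Hr & Hl). fold n in Ht, Hr, Hl.
  pose proof (loglog_ge1 n Hn) as Hll. pose proof (nlogn_ge1 n Hn) as Hnl.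
  pose proof (log_pos_ge1 n Hn) as Hy.
  set (X := nlogn n * loglog n) in *.
  assert (HX : INR n * (1 + log (log (INR n))) / log (INR n) = X).
  { unfold X, nlogn, loglog. field. lra. }
  assert (HX1 : 1 <= X) by (unfold X; nra).
  destruct (assemble_correct K cm w m T D tmax rmax lmax HB HK HSol)
    as (t & answer & rounds & G1 & G2 & G3 & G4 & G5 & G6 & G7 & G8 & G9).
  exists t, answer, rounds. cbn zeta. rewrite HX.
  split; [exact G1|]. split; [exact G2|]. split; [|split; [exact G4|split;
    [|split; [exact G6|split; [|split; [|exact G9]]]]]].
  - apply le_INR in G3. rewrite plus_INR, mult_INR, plus_INR in G3.
    fold len in G3. cbn [INR] in G3.
    assert (len * (INR tmax + 1) <= len * ((A + 1) * X)).
    { apply Rmult_le_compat_l; lra. }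
    unfold C. nra.
  - apply le_INR in G5. rewrite mult_INR in G5.
    assert (INR rmax * INR lmax <= (A * loglog n) * (A * nlogn n)).
    { apply Rmult_le_compat; auto; apply pos_INR. }
    replace (A * loglog n * (A * nlogn n)) with (A * A * X) in * by (unfold X; ring).
    assert (A * A * X <= C * X) by (apply Rmult_le_compat_r; unfold C; lra). lra.
  - apply le_INR in G7. fold (loglog n).
    assert (A * loglog n <= C * loglog n)
      by (apply Rmult_le_compat_r; unfold C; lra). lra.
  - intros l Hin. apply G8, le_INR in Hin. fold (nlogn n).
    assert (A * nlogn n <= C * nlogn n)
      by (apply Rmult_le_compat_r; unfold C; lra). lra.
Qed.
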